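(* Assume that the matrix $P_{1,\mathrm{ext}} \in \mathbb{C}^{(n+r)\times(n+r)}$ is invertible and that the $(n+r)\times(n+r)$-matrix $$W_{\mathrm{B}} \begin{pmatrix} 0 & I_{n+r} \\ I_{n+r} & 0 \end{pmatrix} W_{\mathrm{B}}^*$$ is positive semi-definite. Assume in addition that the matrix $G_1 \in \mathbb{C}^{n\times r}$ has rank $n$. If $(e^{tA_{\mathrm{ext}}})_{t\ge0}$ is exponentially stable, then so is $(e^{tL})_{t\ge0}$. (The matrices $P_{1,\mathrm{ext}}, W_{\mathrm{B}}, G_1$ and the operators $A_{\mathrm{ext}}, L$ are those defined in the context.)
   Context: Let $n, r \ge 1$ be integers and let $\partial$ denote the spatial derivative on $(0,1)$. Parameters: (1) $\mathcal{H} \in L^\infty((0,1);\mathbb{C}^{n\times n})$ with $\mathcal{H}(\zeta)^* = \mathcal{H}(\zeta)$ and $\mathcal{H}(\zeta) \ge m I_n$ for a constant $m>0$ and almost all $\zeta\in(0,1)$ (in the sense of positive semi-definiteness); (2) $P_0, P_1 \in \mathbb{C}^{n\times n}$ with $P_1^*=P_1$ and $P_0^* = -P_0$; (3) $G_0, G_1 \in \mathbb{C}^{n\times r}$; (4) $S \in L^\infty((0,1);\mathbb{C}^{r\times r})$ with $\frac12(S(\zeta)+S(\zeta)^* ) \ge \nu I_r$ for a constant $\nu>0$ and almost all $\zeta\in(0,1)$; (5) $\tilde W_{\mathrm{B}} \in \mathbb{C}^{(n+r)\times 2(n+r)}$ has full rank. The operator $L: \operatorname{dom}(L) \subseteq L^2((0,1);\mathbb{C}^n)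 \to L^2((0,1);\mathbb{C}^n)$ acts as $$Lx = \Big( P_1\partial + P_0 + (G_1\partial + G_0)\, S\, (G_1^*\partial - G_0^* ) \Big)\mathcal{H}x$$ on the domain of all $x \in L^2((0,1);\mathbb{C}^n)$ such that $\mathcal{H}x \in H^1((0,1);\mathbb{C}^n)$, $S(G_1^*\partial - G_0^* )\mathcal{H}x \in H^1((0,1);\mathbb{C}^r)$ and $$\tilde W_{\mathrm{B}} \begin{pmatrix} (\mathcal{H}x)(1) \\ \big(S(G_1^*\partial - G_0^* )\mathcal{H}x\big)(1) \\ (\mathcal{H}x)(0) \\ \big(S(G_1^*\partial - G_0^* )\mathcal{H}x\big)(0) \end{pmatrix} = 0.$$ Put $$P_{1,\mathrm{ext}} = \begin{pmatrix} P_1 & G_1 \\ G_1^* & 0 \end{pmatrix}, \qquad P_{0,\mathrm{ext}} = \begin{pmatrix} P_0 & G_0 \\ -G_0^* & 0\end{pmatrix}.$$ The operator $A_{\mathrm{ext}}$ on $L^2((0,1);\mathbb{C}^n)\times L^2((0,1);\mathbb{C}^r)$ acts as $$A_{\mathrm{ext}}\begin{pmatrix} x \\ x_p\end{pmatrix} = (P_{1,\mathrm{ext}}\,\partial + P_{0,\mathrm{ext}})\begin{pmatrix}\mathcal{H}x \\ x_p\end{pmatrix}$$ on the domain of all $(x,x_p)$ such that $(\mathcal{H}x, x_p) \in H^1((0,1);\mathbb{C}^{n+r})$ and $\tilde W_{\mathrm{B}}\big((\mathcal{H}x)(1), x_p(1), (\mathcal{H}x)(0), x_p(0)\big)^{\mathrm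 T} = 0$. If $P_{1,\mathrm{ext}}$ is invertible, define $$W_{\mathrm{B}} = \sqrt2\;\tilde W_{\mathrm{B}} \begin{pmatrix} P_{1,\mathrm{ext}} & -P_{1,\mathrm{ext}} \\ I & I \end{pmatrix}^{-1} \in \mathbb{C}^{(n+r)\times 2(n+r)}$$ (the inverse exists). Known results: if $P_{1,\mathrm{ext}}$ is invertible and the positive semi-definiteness condition in the claim holds, then both $A_{\mathrm{ext}}$ and $L$ generate $C_0$-semigroups $(e^{tA_{\mathrm{ext}}})_{t\ge0}$ and $(e^{tL})_{t\ge0}$ (contractive with respect to suitable equivalent inner products). A $C_0$-semigroup is exponentially stable if it converges to $0$ with respect to the operator norm as $t\to\infty$. *)

(* Defs.v *)
From HB Require Import structures.
From mathcomp Require Import all_boot all_order all_algebra.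
From mathcomp Require Import generic_quotient ring_quotient.
From mathcomp Require Import complex ring lra.
From mathcomp Require Import all_classical all_reals all_analysis.
From mathcomp Require Import measurable_realfun.

Set Implicit Arguments.
Unset Strict Implicit.
Unset Printing Implicit Defensive.

Import Order.TTheory GRing.Theory Num.Theory.
Import numFieldNormedType.Exports.

Local Open Scope classical_set_scope.
Local Open Scope ring_scope.
Local Open Scope complex_scope.
Local Open Scope sesquilinear_scope.
Local Open Scope quotient_scope.

(* [R[i]] carries no topology or sigma-algebra, so continuity and measurability
   of matrix-valued functions are required of the real and imaginary part of
   every entry. *)
Definition entrywise (R : realType) (p q : nat) (P : (R -> R) -> Prop)
    (F : R -> 'M[R[i]]_(p, q)) : Prop :=
  forall i j, P (fun z => complex.Re (F z i j)) /\
              P (fun z => complex.Im (F z i j)).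

Definition ae01 (R : realType) (P : R -> Prop) : Prop :=
  {ae (@lebesgue_measure R), forall z, `]0, 1[%classic z -> P z}.

Lemma ae01S2 (R : realType) (P Q S : R -> Prop) :
  (forall z, `]0, 1[%classic z -> P z -> Q z -> S z) ->
  ae01 P -> ae01 Q -> ae01 S.
Proof.
move=> PQS; rewrite /ae01.
have F := @ae_filter_ringOfSetsType _ _ _ (@lebesgue_measure R).
apply: (@filterS2 _ _ F) => z p q hz.
by apply: PQS; [exact: hz | exact: p | exact: q].
Qed.

Lemma ae01S (R : realType) (P Q : R -> Prop) :
  (forall z, `]0, 1[%classic z -> P z -> Q z) -> ae01 P -> ae01 Q.
Proof. by move=> PQ aeP; apply: (ae01S2 _ aeP aeP) => z hz p _; exact: PQ. Qed.

Lemma ae01T (R : realType) (P : R -> Prop) : (forall z, P z) -> ae01 P.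
Proof. by move=> p; apply: aeW => z _; exact: p. Qed.

Definition sqnorm (R : realType) (k : nat) (v : 'cV[R[i]]_k) : R :=
  \sum_(i < k) (complex.Re (v i ord0) ^+ 2 + complex.Im (v i ord0) ^+ 2).

Section L2_functions.
Context (R : realType) (k : nat).
Local Notation mu := (@lebesgue_measure R).
Local Notation I01 := (`]0%R, 1%R[%classic : set R).
Implicit Types (f g : R -> 'cV[R[i]]_k) (u v : 'cV[R[i]]_k).

Definition isL2 f : Prop :=
  entrywise (measurable_fun I01) f /\
  (\int[mu]_(z in I01) (sqnorm (f z))%:E < +oo)%E.

Definition l2norm f : R := Num.sqrt (\int[mu]_(z in I01) sqnorm (f z)).

Lemma sqnorm_ge0 v : 0 <= sqnorm v.
Proof. by apply: sumr_ge0 => i _; rewrite addr_ge0 ?sqr_ge0. Qed.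

Lemma sqnorm0 : sqnorm (0 : 'cV[R[i]]_k) = 0.
Proof.
by rewrite /sqnorm big1 // => i _; rewrite mxE /= expr0n /= addr0.
Qed.

Lemma sqnorm_eq0 v : sqnorm v = 0 -> v = 0.
Proof.
move/eqP; rewrite /sqnorm psumr_eq0; last first.
  by move=> i _; rewrite addr_ge0 ?sqr_ge0.
move/allP => h; apply/matrixP => i j; rewrite (ord1 j) mxE.
have := h i (mem_index_enum i); rewrite /= paddr_eq0 ?sqr_ge0 //.
rewrite !sqrf_eq0; case: (v i ord0) => a b /= /andP[/eqP -> /eqP ->].
by [].
Qed.

Lemma sqnormZ (a : R[i]) v :
  sqnorm (a *: v) = (complex.Re a ^+ 2 + complex.Im a ^+ 2) * sqnorm v.
Proof.
rewrite /sqnorm mulr_sumr; apply: eq_bigr => i _; rewrite mxE.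
case: a (v i ord0) => a b [c d] /=; ring.
Qed.

Lemma sqnormD (e : R) u v : 0 < e ->
  sqnorm (u + v) <= (1 + e) * sqnorm u + (1 + e^-1) * sqnorm v.
Proof.
move=> e0.
have key (a b : R) : (a + b) ^+ 2 <= (1 + e) * a ^+ 2 + (1 + e^-1) * b ^+ 2.
  rewrite -subr_ge0.
  have -> : (1 + e) * a ^+ 2 + (1 + e^-1) * b ^+ 2 - (a + b) ^+ 2 =
            e^-1 * (e * a - b) ^+ 2 by field; rewrite gt_eqF.
  by rewrite mulr_ge0 ?sqr_ge0 // invr_ge0 ltW.
rewrite /sqnorm !mulr_sumr -big_split /=; apply: ler_sum => i _.
rewrite mxE; case: (u i ord0) (v i ord0) => a b [c d] /=.
by have := key a c; have := key b d; lra.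
Qed.

Lemma measurable_sqnorm f : entrywise (measurable_fun I01) f ->
  measurable_fun I01 (fun z => sqnorm (f z)).
Proof.
move=> mf; rewrite /sqnorm; apply: measurable_sum => i.
have [mr mi] := mf i ord0.
by apply: measurable_funD; apply: measurable_funX.
Qed.

Lemma isL2_integrable f : isL2 f -> mu.-integrable I01 (EFin \o (fun z => sqnorm (f z))).
Proof.
move=> [mf fi]; apply/integrableP.
have mm : measurable_fun I01 (EFin \o (fun z => sqnorm (f z))).
  by apply/measurable_EFinP; exact: measurable_sqnorm.
split=> //.
by under eq_integral do rewrite /= ger0_norm ?sqnorm_ge0 //.
Qed.

Lemma isL2_0 : isL2 0.
Proof.
split.
  have E (z : R) i j : (0 : R -> 'cV[R[i]]_k) z i j = 0.
    by rewrite -[LHS]/((0 : 'cV[R[i]]_k) i j) mxE.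
  move=> i j; split.
    rewrite (_ : (fun z => _) = cst 0); first exact: measurable_cst.
    by apply/funext => z; rewrite E.
  rewrite (_ : (fun z => _) = cst 0); first exact: measurable_cst.
  by apply/funext => z; rewrite E.
rewrite (eq_integral (cst 0%E)) ?integral0 // => z _ /=.
by rewrite -[(0 : R -> _) z]/(0 : 'cV[R[i]]_k) sqnorm0.
Qed.

Lemma isL2_Z a f : isL2 f -> isL2 (a *: f).
Proof.
move=> hf; have [mf fi] := hf.
have E z i j : (a *: f) z i j = a * f z i j.
  by rewrite -[LHS]/((a *: f z) i j) mxE.
have ReM (c d : R[i]) : complex.Re (c * d) =
    complex.Re c * complex.Re d - complex.Im c * complex.Im d by case: c d => ? ? [].
have ImM (c d : R[i]) : complex.Im (c * d) =
    complex.Re c * complex.Im d + complex.Im c * complex.Re d by case: c d => ? ? [].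
split.
  move=> i j; have [mr mi] := mf i j; split.
    rewrite (_ : (fun z => _) = (fun z => complex.Re a * complex.Re (f z i j)) \-
      (fun z => complex.Im a * complex.Im (f z i j))); last first.
      by apply/funext => z; rewrite E ReM.
    by apply: measurable_funB; apply: measurable_funM.
  rewrite (_ : (fun z => _) = (fun z => complex.Re a * complex.Im (f z i j)) \+
    (fun z => complex.Im a * complex.Re (f z i j))); last first.
    by apply/funext => z; rewrite E ImM.
  by apply: measurable_funD; apply: measurable_funM.
under eq_integral do rewrite sqnormZ EFinM.
rewrite ge0_integralZl_EFin //.
- by rewrite lte_mul_pinfty ?lee_fin ?addr_ge0 ?sqr_ge0.
- by move=> z _; rewrite lee_fin sqnorm_ge0.
- by apply/measurable_EFinP; exact: measurable_sqnorm.
- by rewrite addr_ge0 ?sqr_ge0.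
Qed.

Lemma isL2_meas_D f g : entrywise (measurable_fun I01) f ->
  entrywise (measurable_fun I01) g -> entrywise (measurable_fun I01) (f + g).
Proof.
move=> mf mg i j; have [fr fi] := mf i j; have [gr gi] := mg i j.
have E z : (f + g) z i j = f z i j + g z i j.
  by rewrite -[LHS]/((f z + g z) i j) mxE.
have ReD (c d : R[i]) : complex.Re (c + d) = complex.Re c + complex.Re d.
  by case: c d => ? ? [].
have ImD (c d : R[i]) : complex.Im (c + d) = complex.Im c + complex.Im d.
  by case: c d => ? ? [].
split.
  rewrite (_ : (fun z => _) = (fun z => complex.Re (f z i j)) \+
    (fun z => complex.Re (g z i j))); first exact: measurable_funD.
  by apply/funext => z; rewrite E ReD.
rewrite (_ : (fun z => _) = (fun z => complex.Im (f z i j)) \+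
  (fun z => complex.Im (g z i j))); first exact: measurable_funD.
by apply/funext => z; rewrite E ImD.
Qed.

Lemma isL2_D f g : isL2 f -> isL2 g -> isL2 (f + g).
Proof.
move=> hf hg; have [mf fi] := hf; have [mg gi] := hg; split.
  exact: isL2_meas_D.
have mmf := measurable_sqnorm mf; have mmg := measurable_sqnorm mg.
have mD := measurable_sqnorm (isL2_meas_D mf mg).
apply: (@le_lt_trans _ _
  (\int[mu]_(z in I01) (2%:E * (sqnorm (f z))%:E + 2%:E * (sqnorm (g z))%:E))%E).
  apply: ge0_le_integral => //.
  - by move=> z _; rewrite lee_fin sqnorm_ge0.
  - exact/measurable_EFinP.
  - by apply: emeasurable_funD; apply: emeasurable_funM => //; exact/measurable_EFinP.
  - move=> z _; rewrite -!EFinM -EFinD lee_fin.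
    have := @sqnormD 1 (f z) (g z) ltr01; rewrite invr1.
    by have -> : (1 + 1 : R) = 2 by [].
rewrite ge0_integralD //=.
- rewrite !ge0_integralZl_EFin //.
  + by rewrite lte_add_pinfty // lte_mul_pinfty ?lee_fin.
  + by move=> z _; rewrite lee_fin sqnorm_ge0.
  + exact/measurable_EFinP.
  + by move=> z _; rewrite lee_fin sqnorm_ge0.
  + exact/measurable_EFinP.
- by move=> z _; rewrite -EFinM lee_fin mulr_ge0 ?sqnorm_ge0.
- by apply: emeasurable_funM => //; exact/measurable_EFinP.
- by move=> z _; rewrite -EFinM lee_fin mulr_ge0 ?sqnorm_ge0.
- by apply: emeasurable_funM => //; exact/measurable_EFinP.
Qed.

Lemma sqr_l2norm f : l2norm f ^+ 2 = \int[mu]_(z in I01) sqnorm (f z).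
Proof.
by rewrite sqr_sqrtr // Rintegral_ge0 // => z _; exact: sqnorm_ge0.
Qed.

Lemma l2norm_ge0 f : 0 <= l2norm f.
Proof. exact: sqrtr_ge0. Qed.

Lemma l2normZ a f : isL2 f -> l2norm (a *: f) = Normc.normc a * l2norm f.
Proof.
move=> hf; rewrite /l2norm.
under eq_Rintegral do rewrite sqnormZ.
rewrite RintegralZl //; last exact: isL2_integrable.
by rewrite sqrtrM ?addr_ge0 ?sqr_ge0 //; case: a.
Qed.

Lemma l2normD f g : isL2 f -> isL2 g -> l2norm (f + g) <= l2norm f + l2norm g.
Proof.
move=> hf hg.
have If := isL2_integrable hf; have Ig := isL2_integrable hg.
have ID := isL2_integrable (isL2_D hf hg).
have IZ c (h : R -> 'cV[R[i]]_k) : mu.-integrable I01 (EFin \o (fun z => sqnorm (h z))) ->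
    mu.-integrable I01 (EFin \o (fun z => c * sqnorm (h z))).
  by move=> Ih; apply: (integrableZl _ c Ih); exact: measurable_itv.
have key e : 0 < e -> l2norm (f + g) ^+ 2 <=
    (1 + e) * l2norm f ^+ 2 + (1 + e^-1) * l2norm g ^+ 2.
  move=> e0; rewrite !sqr_l2norm -!RintegralZl // -RintegralD //; try exact: IZ.
  apply: le_Rintegral => //; last by move=> z _; exact: sqnormD.
  by apply: (integrableD _ (IZ _ _ If) (IZ _ _ Ig)); exact: measurable_itv.
have f0 := l2norm_ge0 f; have g0 := l2norm_ge0 g.
have D0 := l2norm_ge0 (f + g).
apply/ler_addgt0Pr => d d0.
pose a := l2norm f + d / 2; pose b := l2norm g + d / 2.
have a0 : 0 < a by rewrite /a; lra.
have b0 : 0 < b by rewrite /b; lra.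
have -> : l2norm f + l2norm g + d = a + b by rewrite /a /b; lra.
have ab0 : 0 <= a + b by lra.
rewrite -(@ler_pXn2r _ 2) ?nnegrE //.
apply: (le_trans (key (b / a) _)); first by rewrite divr_gt0.
have -> : (a + b) ^+ 2 = (1 + b / a) * a ^+ 2 + (1 + (b / a)^-1) * b ^+ 2.
  by field; rewrite !gt_eqF.
apply: lerD; apply: ler_wpM2l.
- by rewrite addr_ge0 // ltW // divr_gt0.
- by rewrite ler_pXn2r ?nnegrE // ?(ltW a0) // /a; lra.
- by rewrite addr_ge0 // invr_ge0 ltW // divr_gt0.
- by rewrite ler_pXn2r ?nnegrE // ?(ltW b0) // /b; lra.
Qed.

Lemma l2norm_eq0 f : isL2 f -> l2norm f = 0 <-> ae01 (fun z => f z = 0).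
Proof.
move=> hf; have If := isL2_integrable hf.
have [mf _] := hf; have mm := measurable_sqnorm mf.
have eqI : (\int[mu]_(z in I01) sqnorm (f z))%:E =
    (\int[mu]_(z in I01) `|(sqnorm (f z))%:E|)%E.
  rewrite /Rintegral fineK; last exact: integrable_fin_num If.
  by apply: eq_integral => z _; rewrite gee0_abs // lee_fin sqnorm_ge0.
have := @ae_eq_integral_abs _ _ _ mu I01 _ (fun z => (sqnorm (f z))%:E).
move=> H; have {H} := H (measurable_itv _) ((measurable_EFinP _ _).2 mm).
rewrite -eqI => -[H1 H2]; split => [h0|ae0].
- have : (\int[mu]_(z in I01) sqnorm (f z))%:E = 0%E.
    by rewrite -sqr_l2norm h0 expr0n.
  move/H1 => /(ae01S (P := fun z => (sqnorm (f z))%:E = 0%E)); apply=> z _.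
  by move=> [/sqnorm_eq0].
- have /H2 [h] : ae_eq mu I01 (fun z => (sqnorm (f z))%:E) (cst 0%E).
    by apply: (ae01S _ ae0) => z _ ->; rewrite sqnorm0.
  by rewrite /l2norm h sqrtr0.
Qed.

Definition L2pred : {pred R -> 'cV[R[i]]_k} := [pred f | `[< isL2 f >]].

Lemma L2pred_submod_closed : submod_closed L2pred.
Proof.
split; first by apply/asboolP; exact: isL2_0.
by move=> a f g /asboolP hf /asboolP hg; apply/asboolP; apply: isL2_D hg; exact: isL2_Z.
Qed.

HB.instance Definition _ :=
  GRing.isSubmodClosed.Build _ _ L2pred L2pred_submod_closed.

Record L2fun := MkL2fun { L2fun_val :> R -> 'cV[R[i]]_k; _ : L2fun_val \in L2pred }.

HB.instance Definition _ := [isSub for L2fun_val].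
HB.instance Definition _ := [Choice of L2fun by <:].
HB.instance Definition _ := [SubChoice_isSubLmodule of L2fun by <:].

Lemma L2funP (f : L2fun) : isL2 f.
Proof. by case: f => f /= /asboolP. Qed.

Definition L2null : {pred L2fun} := [pred f : L2fun | `[< ae01 (fun z : R => f z = 0) >]].

Lemma L2null_zmod_closed : zmod_closed L2null.
Proof.
split; first by apply/asboolP; apply: ae01T.
move=> f g /asboolP hf /asboolP hg; apply/asboolP.
apply: (ae01S2 _ hf hg) => z _ fz gz.
have -> : (f - g : L2fun) z = f z - g z by [].
by rewrite fz gz subrr.
Qed.

HB.instance Definition _ := GRing.isZmodClosed.Build _ L2null L2null_zmod_closed.

(* $L^2((0,1);\mathbb{C}^k)$: square-integrable functions modulo almost
   everywhere equality; [L2rep x] is some representative of the class [x]. *)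
Definition L2 : Type := {ideal_quot L2null}.
HB.instance Definition _ := GRing.Zmodule.on L2.
HB.instance Definition _ := EqQuotient.on L2.

Definition L2rep (x : L2) : R -> 'cV[R[i]]_k := L2fun_val (repr x).

Definition L2class (f : L2fun) : L2 := \pi f.

Lemma L2classE (f g : L2fun) : (L2class f = L2class g) <-> ae01 (fun z => f z = g z).
Proof.
have E : (f - g \in L2null) = (L2class f == L2class g) by exact: Quotient.idealrBE.
split=> [/eqP|h].
  rewrite -E => /asboolP; apply: ae01S => z _ /eqP.
  by rewrite -[(f - g : L2fun) z]/(f z - g z) subr_eq0 => /eqP.
apply/eqP; rewrite -E; apply/asboolP; apply: ae01S h => z _ h.
by rewrite -[(f - g : L2fun) z]/(f z - g z) h subrr.
Qed.

Lemma L2class_rep (f : L2fun) : ae01 (fun z => L2rep (L2class f) z = f z).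
Proof. by apply/L2classE; rewrite /L2class reprK. Qed.

Lemma L2repK (x : L2) : L2class (repr x) = x.
Proof. exact: reprK. Qed.

Lemma L2classD (f g : L2fun) : L2class (f + g) = L2class f + L2class g.
Proof. exact: raddfD. Qed.

Definition L2scale (a : R[i]) (x : L2) : L2 := L2class (a *: (repr x : L2fun)).

Lemma L2classZ a (f : L2fun) : L2class (a *: f) = L2scale a (L2class f).
Proof.
apply/L2classE; apply: ae01S (L2class_rep f) => z _ h.
rewrite -[LHS]/(a *: f z) -h; by [].
Qed.

Lemma L2scaleA a b (x : L2) : L2scale a (L2scale b x) = L2scale (a * b) x.
Proof. by rewrite -[x]L2repK -!L2classZ scalerA. Qed.

Lemma L2scale1 : left_id 1 L2scale.
Proof. by move=> x; rewrite -[x]L2repK -L2classZ scale1r. Qed.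

Lemma L2scaleDr : right_distributive L2scale +%R.
Proof.
move=> a x y; rewrite -[x]L2repK -[y]L2repK -L2classD -!L2classZ.
by rewrite scalerDr L2classD.
Qed.

Lemma L2scaleDl (x : L2) : {morph L2scale^~ x : a b / a + b}.
Proof. by move=> a b; rewrite -[x]L2repK -!L2classZ scalerDl L2classD. Qed.

HB.instance Definition _ := GRing.Zmodule_isLmodule.Build R[i] L2
  L2scaleA L2scale1 L2scaleDr L2scaleDl.

Definition L2norm (x : L2) : R[i] := (l2norm (L2rep x))%:C.

Lemma l2norm_ae (f g : L2fun) : ae01 (fun z => f z = g z) -> l2norm f = l2norm g.
Proof.
have le (u v : L2fun) : ae01 (fun z => u z = v z) -> l2norm u <= l2norm v.
  move=> h; have -> : (u : R -> _) = (v : R -> _) + (u - v : L2fun).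
    by rewrite -[RHS]/(L2fun_val (v + (u - v))) addrC subrK.
  apply: (le_trans (l2normD (L2funP v) (L2funP (u - v)))).
  have -> : l2norm (u - v : L2fun) = 0; last by rewrite addr0.
  apply/(l2norm_eq0 (L2funP _)); apply: ae01S h => z _ h.
  by rewrite -[(u - v : L2fun) z]/(u z - v z) h subrr.
move=> h; apply/eqP; rewrite eq_le !le //.
by apply: ae01S h => z _ ->.
Qed.

Lemma L2norm_class (f : L2fun) : L2norm (L2class f) = (l2norm f)%:C.
Proof. by congr (_%:C); apply: l2norm_ae; exact: L2class_rep. Qed.

Lemma ler_L2normD (x y : L2) : L2norm (x + y) <= L2norm x + L2norm y.
Proof.
rewrite -[x]L2repK -[y]L2repK -L2classD !L2norm_class -rmorphD /= lecR.
exact: (l2normD (L2funP _) (L2funP _)).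
Qed.

Lemma L2normZ (a : R[i]) (x : L2) : L2norm (a *: x) = `|a| * L2norm x.
Proof.
rewrite -[x]L2repK -[a *: _]L2classZ !L2norm_class.
rewrite -[LHS]/(l2norm (a *: (repr x : R -> _)))%:C l2normZ ?rmorphM //.
exact: L2funP.
Qed.

Lemma L2norm_eq0 (x : L2) : L2norm x = 0 -> x = 0.
Proof.
rewrite -[x]L2repK L2norm_class => /complexI /(l2norm_eq0 (L2funP _)) h.
have -> : 0 = L2class 0 by rewrite [RHS]raddf0.
by apply/L2classE; apply: ae01S h => z _ ->.
Qed.

HB.instance Definition _ :=
  Lmodule_isNormed.Build R[i] L2 ler_L2normD L2normZ L2norm_eq0.

End L2_functions.

Section semigroups.
Context (R : realType) (V : normedModType R[i]).

(* Only the restriction of [T] to $[0,\infty)$ matters. *)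
Definition C0_semigroup (T : R -> {linear V -> V}) : Prop :=
  [/\ forall t, 0 <= t -> continuous (T t),
      forall x, T 0 x = x,
      forall s t x, 0 <= s -> 0 <= t -> T (s + t) x = T s (T t x) &
      forall x, T t x @[t --> 0^'+] --> x].

(* Unbounded operators on [V] are given by their graphs: [A x y] means that
   [x] is in the domain of the operator and is mapped to [y]. *)
Definition generated_by (A : V -> V -> Prop) (T : R -> {linear V -> V}) : Prop :=
  C0_semigroup T /\
  forall x y, A x y <-> (h%:C^-1 *: (T h x - x)) @[h --> 0^'+] --> y.

Definition opnorm (B : V -> V) : R :=
  sup [set c : R | exists2 x, `|x| <= 1 & c = complex.Re `|B x|].

Definition exponentially_stable (T : R -> {linear V -> V}) : Prop :=
  opnorm (T t) @[t --> +oo] --> (0 : R).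

End semigroups.

Section Sobolev.
Context (R : realType) (k : nat).
Local Notation mu := (@lebesgue_measure R).
Local Notation I01 := (`]0%R, 1%R[%classic : set R).
Implicit Types (f g F : R -> 'cV[R[i]]_k).

(* $C^1_c(0,1)$ *)
Definition test_function (phi : R -> R) : Prop :=
  [/\ forall z, derivable phi z 1,
      continuous (derive1 phi) &
      exists a b, [/\ 0 < a, b < 1 & forall z, z \notin `[a, b] -> phi z = 0]].

Definition weak_derivative f g : Prop :=
  forall phi, test_function phi -> forall i,
    (\int[mu]_(z in I01) (complex.Re (f z i ord0) * derive1 phi z) =
     - \int[mu]_(z in I01) (complex.Re (g z i ord0) * phi z)) /\
    (\int[mu]_(z in I01) (complex.Im (f z i ord0) * derive1 phi z) =
     - \int[mu]_(z in I01) (complex.Im (g z i ord0) * phi z)).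

Definition H1 f : Prop := isL2 f /\ exists2 g, isL2 g & weak_derivative f g.

(* The weak derivative of [f] in $L^2$, determined up to a null set when [H1 f]
   holds. *)
Definition wderiv f : R -> 'cV[R[i]]_k :=
  xget (0 : R -> 'cV[R[i]]_k) [set g | isL2 g /\ weak_derivative f g].

(* The value at [a], in [0, 1], of the continuous representative of [f], which
   exists and is unique on [0, 1] when [H1 f] holds. *)
Definition trace f (a : R) : 'cV[R[i]]_k :=
  xget (0 : R -> 'cV[R[i]]_k)
    [set F | entrywise (fun u => {within `[0, 1], continuous u}) F /\
             ae01 (fun z => F z = f z)] a.

End Sobolev.

Section matrices.
Context (R : realType).

Definition psdmx (N : nat) (A : 'M[R[i]]_N) : Prop :=
  A^t* = A /\ forall v : 'cV[R[i]]_N, 0 <= (v^t* *m A *m v) ord0 ord0.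

Definition Linfty (p q : nat) (A : R -> 'M[R[i]]_(p, q)) : Prop :=
  entrywise (measurable_fun (`]0%R, 1%R[%classic : set R)) A /\
  exists M : R, ae01 (fun z => forall i j, `|A z i j| <= M%:C).

End matrices.

Section operators.
Context (R : realType) (n r : nat).
Local Notation C := R[i].
Variables (H : R -> 'M[C]_n) (P0 P1 : 'M[C]_n) (G0 G1 : 'M[C]_(n, r)).
Variables (S : R -> 'M[C]_r) (WBt : 'M[C]_(n + r, (n + r) + (n + r))).

Definition P1ext : 'M[C]_(n + r) := block_mx P1 G1 (G1^t*) 0.

Definition P0ext : 'M[C]_(n + r) := block_mx P0 G0 (- G0^t*) 0.

Definition WB : 'M[C]_(n + r, (n + r) + (n + r)) :=
  (Num.sqrt 2)%:C *: (WBt *m invmx (block_mx P1ext (- P1ext) 1%:M 1%:M)).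

Definition Hmul (x : R -> 'cV[C]_n) : R -> 'cV[C]_n := fun z => H z *m x z.

(* $S (G_1^\ast \partial - G_0^\ast) \mathcal{H} x$; the outer [wderiv] is taken in [opL]. *)
Definition flux (x : R -> 'cV[C]_n) : R -> 'cV[C]_r :=
  fun z => S z *m (G1^t* *m wderiv (Hmul x) z - G0^t* *m Hmul x z).

Definition boundary_condition (f : R -> 'cV[C]_n) (g : R -> 'cV[C]_r) : Prop :=
  WBt *m col_mx (col_mx (trace f 1) (trace g 1))
                (col_mx (trace f 0) (trace g 0)) = 0.

Definition opL (x y : L2 R n) : Prop :=
  let Hx := Hmul (L2rep x) in
  let p := flux (L2rep x) in
  [/\ H1 Hx, H1 p, boundary_condition Hx p &
      ae01 (fun z => L2rep y z =
        P1 *m wderiv Hx z + P0 *m Hx z + (G1 *m wderiv p z + G0 *m p z))].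

(* The product [L2 R n * L2 R r] carries the maximum norm of the library, which
   is equivalent to the Hilbert space norm. *)
Definition opAext (x y : (L2 R n * L2 R r)%type) : Prop :=
  let Hx := Hmul (L2rep x.1) in
  let xp := L2rep x.2 in
  let w := fun z => col_mx (Hx z) (xp z) in
  [/\ H1 w, boundary_condition Hx xp &
      ae01 (fun z => col_mx (L2rep y.1 z) (L2rep y.2 z) =
        P1ext *m wderiv w z + P0ext *m w z)].

End operators.

(* Main.v *)
Require Import Defs.
From mathcomp Require Import all_boot all_order all_algebra.
From mathcomp Require Import complex ring lra.
From mathcomp Require Import all_classical all_reals all_analysis.
From mathcomp Require Import measurable_realfun.

Set Implicit Arguments.
Unset Strict Implicit.
Unset Printing Implicit Defensive.

Import Order.TTheory GRing.Theory Num.Theory.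
Import numFieldNormedType.Exports.

Local Open Scope classical_set_scope.
Local Open Scope ring_scope.
Local Open Scope complex_scope.
Local Open Scope sesquilinear_scope.

(** Why the exponential stability of A_ext passes to L. For [x] in the domain of L write [w = H x],
    [v = G1^* w' - G0^* w] and [p = S v], and let [E x = Re <x, H x>] be the energy. Two facts link
    the operators. First, integration by parts gives [Re <L x, H x> <= - nu |v|^2], because the
    condition on [W_B] makes the boundary form nonpositive ([boundary_le], [dissipation]): along an
    orbit of L, the loss of energy pays for the integral of [|v|^2]. Secondly, [(x, p)] lies in the
    domain of A_ext and is mapped to [(L x, v)] ([extension]). Hence an orbit of L, lifted by [p],
    follows A_ext up to a defect that is bounded by [|v|]. Choose a time [b] at which the semigroup of
    A_ext is small. By Duhamel's formula an orbit of L is then small after the time [b] unless a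
    definite part of its energy has been lost, and in either case a fixed fraction of the
    energy is gone. Iteration gives exponential decay.

    Two points need care. The defect contains the derivative of the lift, so Duhamel's formula is
    applied to an average of the orbit over a short window of time ([window_decay]). To return from
    the average to the orbit one needs that orbits move little over the window as long as little
    energy is lost ([oscillation]). This is where the rank of [G1] enters: as [G1^*] has a left
    inverse, [|x|] and [|v|] bound [w] in H1 and hence pointwise ([domain_bounds]). Tested against
    [chi w_d], where [w_d = H d] for an increment [d] of the orbit and [chi] is a cut-off function,
    [L x] is bounded by [|x| + |v|], since the derivative of [p] can be shifted to [chi w_d] without
    boundary terms; and [(1 - chi) w_d] is small in L2 by the pointwise bound
    ([cutoff_functional]).

    The argument in time is carried out for abstract semigroups ([semigroup_stable]), with
    differential inequalities for one-sided slopes ([slope_le]) in the place of integrals;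
    Young's inequality trades [|v|] for the loss of energy. It uses that L2 is complete
    ([L2_complete]), through the uniform boundedness principle and through primitives of orbits. The
    argument in space rests on absolutely continuous representatives of H1 functions ([H1_rep]),
    obtained from [du_bois_reymond], and on the product rule [acM]. *)

(** * Equalities in abelian groups *)

(** Vector identities in a [zmodType] are decided by comparing integer coefficients of
    reified terms. *)
Section zmod_reflection.
Context (V : zmodType).

Inductive zexp := ZVar of nat | ZAdd of zexp & zexp | ZOpp of zexp | ZZero.

Fixpoint zval (env : seq V) (e : zexp) : V :=
  match e with
  | ZVar n => env`_n
  | ZAdd a b => zval env a + zval env b
  | ZOpp a => - zval env a
  | ZZero => 0
  end.

Fixpoint zcoef (e : zexp) (i : nat) : int :=
  match e with
  | ZVar n => (n == i)%:R
  | ZAdd a b => zcoef a i + zcoef b i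
  | ZOpp a => - zcoef a i
  | ZZero => 0
  end.

Lemma zvalE env e : zval env e = \sum_(i < size env) env`_i *~ zcoef e i.
Proof.
elim: e => [n|a IHa b IHb|a IHa|] /=.
- have [hn|hn] := ltnP n (size env); last first.
    rewrite nth_default // big1 // => i _; case: eqP => [ni|]; last by rewrite mulr0z.
    by move: (ltn_ord i); rewrite -ni ltnNge hn.
  rewrite (bigD1 (Ordinal hn)) //= eqxx mulr1z big1 ?addr0 // => i hi.
  case: eqP => [ni|]; last by rewrite mulr0z.
  by case/eqP: hi; apply: val_inj.
- by rewrite IHa IHb -big_split; apply: eq_bigr => i _; rewrite mulrzDr.
- by rewrite IHa -sumrN; apply: eq_bigr => i _; rewrite mulrNz.
- by rewrite big1 // => i _; rewrite mulr0z.
Qed.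

Lemma zmod_eq env a b :
  all (fun i => zcoef a i == zcoef b i) (iota 0 (size env)) -> zval env a = zval env b.
Proof.
move=> /allP h; rewrite !zvalE; apply: eq_bigr => i _; congr (_ *~ _); apply/eqP.
by apply: h; rewrite mem_iota /= ltn_ord.
Qed.

End zmod_reflection.

(* Atoms are compared up to conversion: the same term may carry different
   canonical structure paths. *)
Ltac zmod_index x l :=
  match l with
  | cons ?y _ => let _ := match goal with _ => unify x y end in constr:(O)
  | cons _ ?l' => let k := zmod_index x l' in constr:(S k)
  end.

Ltac zmod_insert x l0 l :=
  match l with
  | nil => constr:(cons x l0)
  | cons ?y _ => let _ := match goal with _ => unify x y end in l0
  | cons _ ?l' => zmod_insert x l0 l'
  end.

Ltac zmod_atoms e l :=
  lazymatch e with
  | (?a + ?b)%R => let l1 := zmod_atoms a l in zmod_atoms b l1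
  | (- ?a)%R => zmod_atoms a l
  | 0%R => l
  | _ => zmod_insert e l l
  end.

Ltac zmod_reify e l :=
  lazymatch e with
  | (?a + ?b)%R => let a' := zmod_reify a l in let b' := zmod_reify b l in constr:(ZAdd a' b')
  | (- ?a)%R => let a' := zmod_reify a l in constr:(ZOpp a')
  | 0%R => constr:(ZZero)
  | _ => let k := zmod_index e l in constr:(ZVar k)
  end.

Ltac zmod :=
  lazymatch goal with
  | |- @eq ?T ?a ?b =>
    let l := zmod_atoms a (@nil T) in
    let l := zmod_atoms b l in
    let a' := zmod_reify a l in
    let b' := zmod_reify b l in
    apply: (@zmod_eq _ l a' b'); vm_compute; reflexivity
  end.

(** * Norms with real values *)

Section real_norm.
Context (R : realType).

Lemma posc_real (c : R[i]) : 0 < c -> c = (complex.Re c)%:C /\ 0 < complex.Re c.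
Proof. by rewrite ltcE; case: c => a b /= /andP[/eqP -> ->]. Qed.

(** The library norm of a complex space takes values in [R[i]]; all estimates below are
    between real numbers. *)
Definition rnorm (V : normedModType R[i]) (x : V) : R := complex.Re `|x|.

Context (V : normedModType R[i]).
Implicit Types (x y : V) (a b : R).

Lemma normrE x : `|x| = (rnorm x)%:C.
Proof.
rewrite /rnorm; have /= := normr_ge0 x; rewrite lecE.
by case: (`|x|) => a b /= /andP[/eqP-> _].
Qed.

Lemma rnorm_ge0 x : 0 <= rnorm x.
Proof. by have := normr_ge0 x; rewrite normrE lecR. Qed.

Lemma rnorm0 : rnorm (0 : V) = 0.
Proof. by rewrite /rnorm normr0. Qed.

Lemma rnormN x : rnorm (- x) = rnorm x.
Proof. by rewrite /rnorm normrN. Qed.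

Lemma rnormD x y : rnorm (x + y) <= rnorm x + rnorm y.
Proof. by rewrite -lecR rmorphD /= -!normrE ler_normD. Qed.

Lemma rnormB x y : rnorm (x - y) <= rnorm x + rnorm y.
Proof. by rewrite -(rnormN y); exact: rnormD. Qed.

Lemma rnorm_distC x y : rnorm (x - y) = rnorm (y - x).
Proof. by rewrite -rnormN opprB. Qed.

Lemma rnormZ a x : rnorm (a%:C *: x) = `|a| * rnorm x.
Proof.
have h : (`|a%:C| : R[i]) = `|a|%:C by rewrite normc_def /= expr0n addr0 sqrtr_sqr.
by apply: complexI; rewrite -normrE normrZ h normrE -rmorphM.
Qed.

Lemma rnorm_tri x y z : rnorm (x - z) <= rnorm (x - y) + rnorm (y - z).
Proof. by have := rnormD (x - y) (y - z); rewrite addrA subrK. Qed.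

Lemma rnorm_le_dist x y : rnorm x <= rnorm y + rnorm (x - y).
Proof. by have := rnormD (x - y) y; rewrite subrK addrC. Qed.

Lemma rnorm_eq0 x : rnorm x = 0 -> x = 0.
Proof. by move=> h; apply/eqP; rewrite -normr_eq0 normrE h. Qed.

(** Phrased with sequences: completeness is applied only to explicit sequences. *)
Definition rcomplete : Prop := forall u : nat -> V,
  (forall e : R, 0 < e -> exists n0, forall p q, (n0 <= p)%N -> (n0 <= q)%N ->
     rnorm (u p - u q) <= e) ->
  exists l, forall e : R, 0 < e -> exists n0, forall p, (n0 <= p)%N -> rnorm (u p - l) <= e.

Lemma cvg_rightP (f : R -> V) (t0 : R) (l : V) :
  f t @[t --> t0^'+] --> l <->
  forall e : R, 0 < e -> exists2 d : R, 0 < d & forall h : R, 0 < h < d -> rnorm (f (t0 + h) - l) <= e.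
Proof.
split=> [/cvgrPdist_le H e e0|H].
- have e0' : 0 < e%:C by rewrite ltcR.
  have := H _ e0'; rewrite /at_right near_withinE.
  move=> /nbhs_ballP[d /= d0 Hd]; exists d => // h /andP[h0 hd].
  have := Hd (t0 + h); rewrite /ball /= opprD addNKr normrN gtr0_norm // => /(_ hd).
  by rewrite ltrDl => /(_ h0); rewrite normrE lecR rnorm_distC.
- apply/cvgrPdist_le => e e0.
  have [er e0r] := posc_real e0.
  have [d d0 Hd] := H _ e0r.
  rewrite /at_right near_withinE; apply/nbhs_ballP; exists d => // t.
  rewrite /ball /= => td t0t; rewrite er normrE lecR rnorm_distC.
  have := Hd (t - t0); rewrite [t0 + _]addrC subrK; apply.
  rewrite subr_gt0 t0t /= (le_lt_trans _ td) // distrC.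
  by rewrite ler_norm.
Qed.

End real_norm.

Section bounded_linear.
Context (R : realType).

Lemma linear_bounded (V W : normedModType R[i]) (f : {linear V -> W}) :
  continuous f -> exists2 M : R, 0 < M & forall x, rnorm (f x) <= M * rnorm x.
Proof.
move=> /(_ 0) /cvgrPdist_le /(_ 1 ltr01); rewrite (linear0 f).
move=> /nbhs_ballP[d /= d0 Hd].
have [dr d0r] := posc_real d0.
set r := complex.Re d in dr d0r.
exists (2 / r); first by rewrite divr_gt0.
move=> x; have [->|x0] := eqVneq x 0.
  by rewrite (linear0 f) !rnorm0 mulr0.
have nx : 0 < rnorm x.
  rewrite lt_neqAle rnorm_ge0 andbT eq_sym; apply: contra x0 => /eqP h.
  by apply/eqP; exact: rnorm_eq0.
set s := r / (2 * rnorm x).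
have s0 : 0 < s by rewrite divr_gt0 // mulr_gt0.
have := Hd (s%:C *: x); rewrite -ball_normE /= !sub0r !normrN !normrE rnormZ.
rewrite gtr0_norm // {1}dr ltcR.
have -> : s * rnorm x = r / 2 by rewrite /s; field; rewrite gt_eqF.
have h2 : r / 2 < r by lra.
move=> /(_ h2); have -> : (1 : R[i]) = 1%:C by [].
rewrite linearZ lecR rnormZ gtr0_norm // /s => h.
rewrite -(ler_pM2l s0); apply: le_trans h _.
by rewrite /s le_eqVlt; apply/orP; left; apply/eqP; field; rewrite !gt_eqF.
Qed.

End bounded_linear.

(** * Differential inequalities with one-sided slopes *)

Section slopes.
Context (R : realType).
Implicit Types (k : R -> R) (a b t m e : R).

(** The upper right Dini derivative of [k] at [t] is at most [m]. *)
Definition rslope k t m : Prop := forall e : R, 0 < e ->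
  exists2 d : R, 0 < d & forall h : R, 0 < h < d -> k (t + h) <= k t + (m + e) * h.

(** Lower semicontinuity from the left. *)
Definition lcont k t : Prop := forall e : R, 0 < e ->
  exists2 d : R, 0 < d & forall h : R, 0 < h < d -> k t <= k (t - h) + e.

Lemma rslopeW k t m m' : m <= m' -> rslope k t m -> rslope k t m'.
Proof.
move=> mm' H e e0; have [d d0 Hd] := H _ e0; exists d => // h /[dup] /andP[h0 _] /Hd.
by move/le_trans; apply; rewrite lerD2l ler_pM2r // lerD2r.
Qed.

Lemma rslopeD k1 k2 t m1 m2 : rslope k1 t m1 -> rslope k2 t m2 ->
  rslope (fun s => k1 s + k2 s) t (m1 + m2).
Proof.
move=> H1 H2 e e0; have e20 : 0 < e / 2 by lra.
have [d1 d10 Hd1] := H1 _ e20; have [d2 d20 Hd2] := H2 _ e20.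
exists (Num.min d1 d2); first by rewrite lt_min d10.
move=> h /andP[h0]; rewrite lt_min => /andP[hd1 hd2].
have := Hd1 h; rewrite h0 hd1 => /(_ isT); have := Hd2 h; rewrite h0 hd2 => /(_ isT).
by lra.
Qed.

Lemma rslopeZ c k t m : 0 <= c -> rslope k t m ->
  rslope (fun s => c * k s) t (c * m).
Proof.
move=> c0 H e e0; have e1 : 0 < e / (c + 1) by rewrite divr_gt0 // ltr_wpDl.
have [d d0 Hd] := H _ e1; exists d => // h /[dup] hh /Hd /(ler_wpM2l c0) /le_trans; apply.
have /andP[h0 _] := hh.
rewrite mulrDr lerD2l mulrA ler_pM2r // mulrDr lerD2l mulrCA ler_piMr ?(ltW e0) //.
by rewrite ler_pdivrMr ?ltr_wpDl // mul1r; lra.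
Qed.

Lemma rslope_lin c t : rslope (fun s => c * s) t c.
Proof.
move=> e e0; exists 1 => // h /andP[h0 _]; rewrite mulrDr lerD2l ler_pM2r //; lra.
Qed.

Lemma rslope_shift k s0 t m : rslope k (t + s0) m -> rslope (fun s => k (s + s0)) t m.
Proof.
move=> H e e0; have [d d0 Hd] := H _ e0; exists d => // h /Hd.
by rewrite addrAC.
Qed.

Lemma lcontD k1 k2 t : lcont k1 t -> lcont k2 t -> lcont (fun s => k1 s + k2 s) t.
Proof.
move=> H1 H2 e e0; have e20 : 0 < e / 2 by lra.
have [d1 d10 Hd1] := H1 _ e20; have [d2 d20 Hd2] := H2 _ e20.
exists (Num.min d1 d2); first by rewrite lt_min d10.
move=> h /andP[h0]; rewrite lt_min => /andP[hd1 hd2].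
have := Hd1 h; rewrite h0 hd1 => /(_ isT); have := Hd2 h; rewrite h0 hd2 => /(_ isT).
by lra.
Qed.

Lemma lcontZ c k t : 0 <= c -> lcont k t -> lcont (fun s => c * k s) t.
Proof.
move=> c0 H e e0; have e1 : 0 < e / (c + 1) by rewrite divr_gt0 // ltr_wpDl.
have [d d0 Hd] := H _ e1; exists d => // h /Hd /(ler_wpM2l c0) /le_trans; apply.
rewrite mulrDr lerD2l mulrCA ler_piMr ?(ltW e0) //.
by rewrite ler_pdivrMr ?ltr_wpDl // mul1r; lra.
Qed.

Lemma lcont_lin c t : lcont (fun s => c * s) t.
Proof.
move=> e e0; exists (e / (`|c| + 1)); first by rewrite divr_gt0 // ltr_wpDl.
move=> h /andP[h0 hd]; rewrite mulrBr.
have : c * h <= e; last by lra.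
apply: (@le_trans _ _ ((`|c| + 1) * h)).
  by rewrite ler_pM2r //; have := ler_norm c; lra.
by rewrite mulrC -ler_pdivlMr ?ltr_wpDl // ltW.
Qed.

Lemma lcont_shift k s0 t : lcont k (t + s0) -> lcont (fun s => k (s + s0)) t.
Proof.
move=> H e e0; have [d d0 Hd] := H _ e0; exists d => // h /Hd.
by rewrite addrAC.
Qed.

(** Real induction: the points up to which [k] stays below the line of slope [c] form a set
    whose supremum belongs to it by left semicontinuity, and can be passed by the slope
    bound. Then [c] tends to zero. *)
Lemma slope_le0 k a b : a <= b ->
  (forall t, a <= t < b -> rslope k t 0) -> (forall t, a < t <= b -> lcont k t) ->
  k b <= k a.
Proof.
move=> ab Hr Hl; apply/ler_addgt0Pr => e e0.
wlog ltab : / a < b.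
  by move=> W; have := ab; rewrite le_eqVlt => /predU1P[->|/W //]; lra.
pose c := e / (b - a); have ba : 0 < b - a by rewrite subr_gt0.
have c0 : 0 < c by rewrite divr_gt0.
pose S : set R := [set t | a <= t <= b /\ k t <= k a + c * (t - a)].
have Sa : S a by split; [rewrite lexx ab|rewrite subrr mulr0 addr0].
have supS : has_sup S.
  by split; [exists a | exists b => t [/andP[]]].
have Sub : forall t, S t -> t <= sup S by move=> t; exact: sup_upper_bound.
have aS : a <= sup S by exact: Sub.
have Sb : sup S <= b by apply: ge_sup; [exists a | move=> t [/andP[]]].
set s := sup S in Sub aS Sb.
have Ss : S s.
  split; first by rewrite aS Sb.
  have := aS; rewrite le_eqVlt => /predU1P[<-|lts]; first by case: Sa.
  apply/ler_addgt0Pr => e' e'0.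
  have hs : a < s <= b by rewrite lts Sb.
  have [d d0 Hd] := Hl s hs e' e'0.
  have : exists2 t, S t & s - d < t by exact: sup_adherent.
  move=> [t [tab kt] st].
  have := Sub _ (conj tab kt); rewrite le_eqVlt => /predU1P[<-|ts]; first by lra.
  have := Hd (s - t); have -> : s - (s - t) = t by ring.
  have /[swap]/[apply] : 0 < s - t < d by apply/andP; split; lra.
  move/le_trans; apply; rewrite lerD2r (le_trans kt) // lerD2l ler_pM2l // lerD2r.
  exact: ltW.
suff bs : b = s.
  have [_ h] := Ss; rewrite {1}bs; apply: (le_trans h); rewrite lerD2l.
  by rewrite /c mulrAC ler_pdivrMr // ler_pM2l // lerD2r.
apply/eqP; rewrite eq_le Sb andbT leNgt; apply/negP => sb.
have hs : a <= s < b by rewrite aS sb.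
have [d d0 Hd] := Hr s hs c c0.
pose h := Num.min (d / 2) (b - s).
have h0 : 0 < h by rewrite lt_min; apply/andP; split; lra.
have hd : h < d by rewrite gt_min; apply/orP; left; lra.
have hb : h <= b - s by rewrite ge_min lexx orbT.
have : S (s + h).
  split; first by apply/andP; split; lra.
  have := Hd h; rewrite h0 hd => /(_ isT) /le_trans; apply.
  by case: Ss => _; lra.
by move/Sub; lra.
Qed.

(** Left semicontinuity rules out upward jumps, so a bound on one-sided upper derivatives
    is enough. This is the only calculus of the time variable used below: energy losses
    and norms along orbits are compared through their slopes, never integrated. *)
Lemma slope_le k a b m : a <= b ->
  (forall t, a <= t < b -> rslope k t m) -> (forall t, a < t <= b -> lcont k t) ->
  k b <= k a + m * (b - a).
Proof.
move=> ab Hr Hl.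
suff : k b + (- m) * b <= k a + (- m) * a by lra.
apply: (@slope_le0 (fun s => k s + (- m) * s)) => // t ht.
- by rewrite -(subrr m); apply: rslopeD; [exact: Hr | exact: rslope_lin].
- by apply: lcontD; [exact: Hl | exact: lcont_lin].
Qed.

End slopes.

(** * Uniform boundedness *)

Section uniform_boundedness.
Context (R : realType) (V W : normedModType R[i]).

(** One of [f (x + u)] and [f (x - u)] is at least as large as [f u]. *)
Lemma large_nearby (f : {linear V -> W}) (x z : V) (r M : R) : 0 < r -> 0 <= M ->
  M * rnorm z < rnorm (f z) -> exists2 x', rnorm (x' - x) <= r & M * r < rnorm (f x').
Proof.
move=> r0 M0 Hz.
have nz : 0 < rnorm z.
  rewrite lt_neqAle rnorm_ge0 andbT; apply/eqP => /esym /rnorm_eq0 z0.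
  by move: Hz; rewrite z0 (linear0 f) !rnorm0 mulr0 ltxx.
pose s := r / rnorm z; have s0 : 0 < s by rewrite divr_gt0.
pose u := s%:C *: z.
have nu : rnorm u = r by rewrite rnormZ gtr0_norm // /s divfK // gt_eqF.
have fu : M * r < rnorm (f u).
  have : M < rnorm (f z) / rnorm z by rewrite ltr_pdivlMr.
  by rewrite -(ltr_pM2r r0) linearZ rnormZ gtr0_norm // /s; congr (_ < _); ring.
have [h|h] := leP (rnorm (f (x + u))) (M * r); last first.
  by exists (x + u) => //; rewrite addrC addKr nu.
exists (x - u); first by rewrite addrC addKr rnormN nu.
have E : f u + f u = f (x + u) - f (x - u).
  by rewrite -linearB opprD opprK addrACA subrr add0r linearD.
have : rnorm (f u + f u) = 2 * rnorm (f u).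
  have -> : f u + f u = 2%:C *: f u by rewrite -[2]/(1 + 1) rmorphD /= scalerDl !scale1r.
  by rewrite rnormZ ger0_norm.
rewrite E => h2.
by have := rnormB (f (x + u)) (f (x - u)); rewrite h2; lra.
Qed.

(** Sokal's argument: if no uniform bound exists, [large_nearby] builds a sequence of
    shrinking balls, the [k]-th of which is mapped outside the ball of radius [k] by some
    [f n]; their common point contradicts pointwise boundedness. *)
Lemma uniform_bounded (cV : rcomplete V) (f : nat -> {linear V -> W}) :
  (forall n, exists2 M : R, 0 < M & forall x, rnorm (f n x) <= M * rnorm x) ->
  (forall x, exists M, forall n, rnorm (f n x) <= M) ->
  exists2 M : R, 0 < M & forall n x, rnorm (f n x) <= M * rnorm x.
Proof.
move=> fb pb; apply: contrapT => nub.
have unb (M : R) : 0 < M -> exists n z, M * rnorm z < rnorm (f n z).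
  move=> M0; apply: contrapT => H; apply: nub; exists M => // n x.
  by rewrite leNgt; apply/negP => h; apply: H; exists n, x.
(* A pair stands for the centre and the radius of a ball. *)
pose good (k : nat) (p q : V * R) := [/\ rnorm (q.1 - p.1) <= p.2, 0 < q.2,
  q.2 <= p.2 / 2 & exists n, forall x, rnorm (x - q.1) <= 2 * q.2 -> k%:R <= rnorm (f n x)].
have step (kp : nat * (V * R)) : exists q, 0 < kp.2.2 -> good kp.1 kp.2 q.
  case: kp => k [x r] /=; have [r0|] := ltP 0 r; last first.
    by move=> h; exists (0, 0).
  pose M := (k%:R + 1) / r; have M0 : 0 < M by rewrite divr_gt0 // ltr_wpDl.
  have [n [z Hz]] := unb M M0.
  have [x' xx' fx'] := large_nearby x r0 (ltW M0) Hz.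
  have [B B0 HB] := fb n.
  pose r' := Num.min (r / 2) (2 * B)^-1.
  have r'0 : 0 < r' by rewrite lt_min; apply/andP; split; [lra | by rewrite invr_gt0 mulr_gt0].
  exists (x', r') => _; split => //=; first by rewrite ge_min lexx.
  exists n => y hy.
  have := rnorm_le_dist (f n x') (f n y); rewrite -linearB rnorm_distC in hy *.
  have : rnorm (f n (x' - y)) <= 1.
    apply: (le_trans (HB _)); rewrite rnorm_distC in hy; rewrite rnorm_distC.
    apply: (le_trans (ler_wpM2l (ltW B0) hy)).
    have : r' <= (2 * B)^-1 by rewrite ge_min lexx orbT.
    move/(ler_wpM2l (ltW (mulr_gt0 (ltr0n _ 2) B0))).
    rewrite mulfV ?gt_eqF ?mulr_gt0 //; lra.
  move: fx'; rewrite /M divfK ?gt_eqF //; lra.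
have [g Hg] := choice step.
pose s := fix s n : V * R := if n is m.+1 then g (m, s m) else (0, 1).
have s0 n : 0 < (s n).2.
  by elim: n => [|n IH] //=; case: (Hg (n, s n) IH).
have sS n : good n (s n) (s n.+1) by exact: (Hg (n, s n) (s0 n)).
have tail n j : rnorm ((s (n + j)%N).1 - (s n).1) <= 2 * (s n).2 - 2 * (s (n + j)%N).2.
  elim: j => [|j IH]; first by rewrite addn0 !subrr rnorm0.
  have [h1 _ h2 _] := sS (n + j)%N.
  by have := rnorm_tri (s (n + j.+1)%N).1 (s (n + j)%N).1 (s n).1; rewrite addnS; lra.
have s2 n : (s n).2 <= (n.+1)%:R^-1.
  elim: n => [|n IH]; first by rewrite invr1.
  have [_ _ h _] := sS n; apply: (le_trans h).
  apply: (@le_trans _ _ (n.+1%:R^-1 / 2)); first by rewrite ler_pM2r.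
  rewrite -invfM lef_pV2 ?posrE ?mulr_gt0 ?ltr0n // -natrM ler_nat.
  by rewrite muln2 -addnn addSn ltnS addnS ltnS leq_addr.
have [l Hl] : exists l, forall e : R, 0 < e ->
    exists n0, forall p, (n0 <= p)%N -> rnorm ((s p).1 - l) <= e.
  apply: cV => e e0; pose n0 := Num.truncn (4 / e).
  have hn0 : 4 * (s n0).2 <= e.
    apply: (@le_trans _ _ (4 * n0.+1%:R^-1)); first by rewrite ler_pM2l.
    rewrite ler_pdivrMr ?ltr0n // mulrC -ler_pdivrMr //.
    by apply/ltW; exact: truncnS_gt.
  exists n0 => p q /subnK <- /subnK <-; rewrite ![(_ + n0)%N]addnC.
  have h1 := tail n0 (p - n0)%N; have h2 := tail n0 (q - n0)%N.
  have := rnorm_tri (s (n0 + (p - n0))%N).1 (s n0).1 (s (n0 + (q - n0))%N).1.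
  rewrite (rnorm_distC (s n0).1).
  have := s0 (n0 + (p - n0))%N; have := s0 (n0 + (q - n0))%N; lra.
have close n : rnorm (l - (s n).1) <= 2 * (s n).2.
  apply/ler_addgt0Pr => e e0; have [n0 Hn0] := Hl _ e0.
  have := Hn0 (n + n0)%N (leq_addl _ _); have := tail n n0.
  have := rnorm_tri l (s (n + n0)%N).1 (s n).1; rewrite (rnorm_distC l (s (n + n0)%N).1).
  have := s0 (n + n0)%N; lra.
have [M HM] := pb l.
have [_ _ _ [n Hn]] := sS (Num.truncn M).+1.
have := Hn l (close _); have := HM n; have := truncnS_gt M; lra.
Qed.

End uniform_boundedness.

(** * Primitives of continuous curves *)

Section primitives.
Context (R : realType) (V : normedModType R[i]).
Implicit Types (f F : R -> V) (b : R).

Definition ucont f b : Prop := forall e : R, 0 < e -> exists2 d : R, 0 < d &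
  forall s t, 0 <= s <= b -> 0 <= t <= b -> `|s - t| <= d -> rnorm (f s - f t) <= e.

(** [F] is an integral of [f] in the sense that its increments obey the mean value bound
    against every constant [v]; this is all that is needed of a vector-valued integral. *)
Definition primitive f b F : Prop := forall s t, 0 <= s -> s <= t -> t <= b ->
  forall v e, (forall u, s <= u <= t -> rnorm (f u - v) <= e) ->
  rnorm (F t - F s - (t - s)%:C *: v) <= (t - s) * e.

Lemma rnorm_sum (I : Type) (r : seq I) (P : pred I) (g : I -> V) :
  rnorm (\sum_(i <- r | P i) g i) <= \sum_(i <- r | P i) rnorm (g i).
Proof.
elim/big_rec2: _ => [|i x y _ h]; first by rewrite rnorm0.
by apply: (le_trans (rnormD _ _)); rewrite lerD2l.
Qed.

Definition clip (h s : R) : R := Num.max 0 (Num.min s h).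

Lemma clip_mono h s t : s <= t -> clip h s <= clip h t.
Proof. by rewrite /clip !maxEle !minEle; do !case: ifP; lra. Qed.

Lemma clip_eq0 h s : s <= 0 -> clip h s = 0.
Proof. by rewrite /clip !maxEle !minEle; do !case: ifP; lra. Qed.

Lemma clip_eqh h s : 0 <= h -> h <= s -> clip h s = h.
Proof. by rewrite /clip !maxEle !minEle; do !case: ifP; lra. Qed.

Lemma sum_clip (h t : R) (m : nat) : 0 < h -> 0 <= t ->
  \sum_(k < m) clip h (t - k%:R * h) = Num.min t (m%:R * h).
Proof.
move=> h0 t0; elim: m => [|m IH].
  by rewrite big_ord0 mul0r /Num.min; case: ltP => //; lra.
rewrite big_ord_recr /= IH -natr1 mulrDl mul1r.
have mh : 0 <= m%:R * h by rewrite mulr_ge0 // ltW.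
set c := m%:R * h in mh *.
by rewrite /clip !maxEle !minEle; do !case: ifP; lra.
Qed.

(** The primitive of the step function with steps of length [h]. *)
Definition polygon f h (m : nat) t : V :=
  \sum_(k < m) (clip h (t - k%:R * h))%:C *: f (k%:R * h).

(** The increment of a polygon is a combination of values of [f] at nearby points, with
    nonnegative weights that add up to [t - s]. *)
Lemma polygon_primitive f b (h : R) (m : nat) d w : 0 < h -> m%:R * h = b -> h <= d ->
  (forall s t, 0 <= s <= b -> 0 <= t <= b -> `|s - t| <= d -> rnorm (f s - f t) <= w) ->
  forall s t, 0 <= s -> s <= t -> t <= b ->
  forall v e, (forall u, s <= u <= t -> rnorm (f u - v) <= e) ->
  rnorm (polygon f h m t - polygon f h m s - (t - s)%:C *: v) <= (t - s) * (e + w).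
Proof.
move=> h0 mh hd fw s t s0 st tb v e Hv.
pose c (k : nat) := clip h (t - k%:R * h) - clip h (s - k%:R * h).
have c0 k : 0 <= c k by rewrite subr_ge0; apply: clip_mono; lra.
have sumc : \sum_(k < m) c k = t - s.
  rewrite sumrB !sum_clip //; last lra.
  by rewrite !(min_idPl _) ?mh //; lra.
have w0 : 0 <= w.
  have := fw s s; rewrite !subrr normr0 rnorm0; apply; [lra|lra|].
  by apply: le_trans hd; exact: ltW.
have -> : polygon f h m t - polygon f h m s - (t - s)%:C *: v =
    \sum_(k < m) (c k)%:C *: (f (k%:R * h) - v).
  rewrite -sumc (big_morph (real_complex R) (raddfD _) (raddf0 _)) scaler_suml.
  rewrite /polygon -!sumrB; apply: eq_bigr => k _.
  by rewrite -scalerBl -rmorphB /= -scalerBr.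
apply: (le_trans (rnorm_sum _ _ _)).
rewrite -sumc mulr_suml; apply: ler_sum => k _.
rewrite rnormZ ger0_norm //.
have [->|ck] := eqVneq (c k) 0; first by rewrite !mul0r.
rewrite ler_wpM2l //.
have kt : k%:R * h < t.
  rewrite ltNge; apply: contra ck => tk.
  by rewrite /c !clip_eq0 ?subrr //; lra.
have sk : s - k%:R * h < h.
  rewrite ltNge; apply: contra ck => tk.
  by rewrite /c !clip_eqh ?subrr //; lra.
have k0 : 0 <= k%:R * h by rewrite mulr_ge0 // ltW.
have [sk'|ks] := leP s (k%:R * h).
  by apply: (le_trans (Hv _ _)); [rewrite sk' ltW|lra].
have := rnorm_tri (f (k%:R * h)) (f s) v.
have := Hv s; rewrite lexx st => /(_ isT).
have := fw (k%:R * h) s; rewrite ltr0_norm; last lra.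
have /[swap]/[apply] : 0 <= k%:R * h <= b by apply/andP; split; lra.
have /[swap]/[apply] : 0 <= s <= b by apply/andP; split; lra.
have /[swap]/[apply] : - (k%:R * h - s) <= d by lra.
by lra.
Qed.

(** Polygons with small steps drift apart at a small rate, so they form a Cauchy sequence
    by [slope_le], and the mean value bound passes to the limit. *)
Lemma primitive_exists f b : rcomplete V -> 0 < b -> ucont f b ->
  exists2 F, F 0 = 0 & primitive f b F.
Proof.
move=> cV b0 fu.
pose h (n : nat) := b / n.+1%:R; pose P n := polygon f (h n) n.+1.
have h0 n : 0 < h n by rewrite divr_gt0 // ltr0n.
have hb n : n.+1%:R * h n = b by rewrite /h mulrC divfK // pnatr_eq0.
have hsmall d : 0 < d -> exists n0, forall n, (n0 <= n)%N -> h n <= d.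
  move=> d0; exists (Num.truncn (b / d)) => n hn.
  rewrite /h ler_pdivrMr ?ltr0n // mulrC -ler_pdivrMr // (le_trans (ltW (truncnS_gt _))) //.
  by rewrite ler_nat ltnS.
have cau t : 0 <= t <= b -> forall e : R, 0 < e -> exists n0, forall p q, (n0 <= p)%N ->
    (n0 <= q)%N -> rnorm (P p t - P q t) <= e.
  move=> /andP[t0 tb] e e0.
  pose w := e / (4 * b); have w0 : 0 < w by rewrite divr_gt0 // mulr_gt0.
  have [d d0 Hd] := fu _ w0; have [n0 Hn0] := hsmall d d0.
  exists n0 => p q hp hq.
  have Pstep n : (n0 <= n)%N -> forall r s, 0 <= r -> r <= s -> s <= b -> s - r <= d ->
      rnorm (P n s - P n r - (s - r)%:C *: f r) <= (s - r) * (2 * w).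
    move=> hn r s r0 rs sb sr.
    have -> : 2 * w = w + w by lra.
    apply: (@polygon_primitive f b (h n) n.+1 d w (h0 n) (hb n) (Hn0 n hn) Hd) => // u /andP[ru us].
    by apply: Hd; rewrite ?ger0_norm; try (apply/andP; split); lra.
  pose k s := rnorm (P p s - P q s).
  have kstep r s : 0 <= r -> r <= s -> s <= b -> s - r <= d ->
      `|k s - k r| <= (4 * w) * (s - r).
    move=> r0 rs sb sr; have h1 := Pstep p hp r s r0 rs sb sr.
    have h2 := Pstep q hq r s r0 rs sb sr.
    have E : (P p s - P q s) - (P p r - P q r) =
       (P p s - P p r - (s - r)%:C *: f r) - (P q s - P q r - (s - r)%:C *: f r).
      by zmod.
    have h3 := rnormB (P p s - P p r - (s - r)%:C *: f r) (P q s - P q r - (s - r)%:C *: f r).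
    rewrite -E in h3.
    have h4 := rnorm_le_dist (P p s - P q s) (P p r - P q r).
    have h5 := rnorm_le_dist (P p r - P q r) (P p s - P q s).
    rewrite [X in _ <= _ + X]rnorm_distC in h5.
    rewrite /k ler_norml; apply/andP; split; lra.
  have : k t <= k 0 + (4 * w) * (t - 0).
    apply: slope_le => // s /andP[h1 h2].
    - move=> e' e'0; exists (Num.min d (b - s)).
        by rewrite lt_min d0; lra.
      move=> eta /andP[eta0]; rewrite lt_min => /andP[etad etab].
      have /andP[_] : - (4 * w * (s + eta - s)) <= k (s + eta) - k s <= 4 * w * (s + eta - s).
        by rewrite -ler_norml; apply: kstep; lra.
      have := mulr_gt0 e'0 eta0; lra.
    - move=> e' e'0; exists (Num.min (Num.min d s) (e' / (4 * w))).
        by rewrite !lt_min d0 h1 divr_gt0 //; lra.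
      move=> eta /andP[eta0]; rewrite !lt_min => /andP[/andP[etad etas]].
      rewrite ltr_pdivlMr => [h3|]; last lra.
      have /andP[_] : - (4 * w * (s - (s - eta))) <= k s - k (s - eta) <= 4 * w * (s - (s - eta)).
        by rewrite -ler_norml; apply: kstep; lra.
      lra.
  have k0 : k 0 = 0.
    have P0 n : P n 0 = 0.
      rewrite /P /polygon big1 // => j _; rewrite clip_eq0 ?scale0r // sub0r oppr_le0.
      by rewrite mulr_ge0 // ltW.
    by rewrite /k !P0 subrr rnorm0.
  rewrite k0 add0r subr0 => /le_trans; apply.
  apply: (@le_trans _ _ (4 * w * b)); first by rewrite ler_pM2l //; lra.
  have -> : 4 * w * b = e by rewrite /w; field; rewrite gt_eqF.
  by [].
have lim t : exists l, 0 <= t <= b -> forall e : R, 0 < e ->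
    exists n0, forall n, (n0 <= n)%N -> rnorm (P n t - l) <= e.
  have [tb|ntb] := boolP (0 <= t <= b); last by exists 0.
  by have [l Hl] := cV _ (cau t tb); exists l.
have [L HL] := choice lim.
exists (fun t => L t - L 0); first by rewrite subrr.
move=> s t s0 st tb v e Hv.
have -> : L t - L 0 - (L s - L 0) = L t - L s by zmod.
apply/ler_addgt0Pr => x x0.
pose w := x / (2 * (b + 2)); have w0 : 0 < w by rewrite divr_gt0 // mulr_gt0 //; lra.
have [d d0 Hd] := fu _ w0; have [n0 Hn0] := hsmall d d0.
have sb : 0 <= s <= b by apply/andP; split; lra.
have tb' : 0 <= t <= b by apply/andP; split; lra.
have [n1 Hn1] := HL s sb w w0; have [n2 Hn2] := HL t tb' w w0.
pose n := (n0 + n1 + n2)%N.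
have n0n : (n0 <= n)%N by rewrite /n -addnA leq_addr.
have n1n : (n1 <= n)%N by rewrite /n addnAC leq_addl.
have n2n : (n2 <= n)%N by rewrite /n leq_addl.
have h1 := Hn1 n n1n; have h2 := Hn2 n n2n.
have h3 := @polygon_primitive f b (h n) n.+1 d w (h0 n) (hb n) (Hn0 n n0n) Hd s t s0 st tb v e Hv.
rewrite -/(P n) in h3.
have E : L t - L s - (t - s)%:C *: v = (P n t - P n s - (t - s)%:C *: v)
    + ((P n s - L s) - (P n t - L t)).
  by zmod.
rewrite E; apply: (le_trans (rnormD _ _)); have := rnormB (P n s - L s) (P n t - L t).
have : (t - s) * w <= b * w by rewrite ler_pM2r //; lra.
have : w * (b + 2) = x / 2 by rewrite /w; field; lra.
lra.
Qed.

End primitives.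

(** * Strongly continuous semigroups *)

Section semigroup_theory.
Context (R : realType) (V : normedModType R[i]) (T : R -> {linear V -> V}).
Hypothesis (cV : rcomplete V) (HT : C0_semigroup T).

Let semigroupZ t (a : R) x : T t (a%:C *: x) = a%:C *: T t x.
Proof. by rewrite linearZ. Qed.

Let semigroupB t x y : T t (x - y) = T t x - T t y.
Proof. exact: linearB. Qed.

Lemma semigroup_bounded t : 0 <= t ->
  exists2 M : R, 0 < M & forall x, rnorm (T t x) <= M * rnorm x.
Proof. by case: HT => cT _ _ _ t0; apply: linear_bounded; exact: cT. Qed.

Lemma semigroup_right0 x e : 0 < e ->
  exists2 d : R, 0 < d & forall h, 0 <= h <= d -> rnorm (T h x - x) <= e.
Proof.
case: HT => _ T0 _ /(_ x) /cvg_rightP H e0; have [d d0 Hd] := H _ e0.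
exists (d / 2); first lra.
move=> h /andP[]; rewrite le_eqVlt => /predU1P[<-|h0] hd.
  by rewrite T0 subrr rnorm0 ltW.
by have := Hd h; rewrite add0r; apply; rewrite h0; lra.
Qed.

(** Otherwise the bounds would fail along some [t_n] tending to [0]; but [T t_n x] tends
    to [x] for every [x], against the uniform boundedness principle. *)
Lemma semigroup_bounded_near0 : exists M d, [/\ 0 < M, 0 < d &
  forall t x, 0 <= t <= d -> rnorm (T t x) <= M * rnorm x].
Proof.
apply: contrapT => H.
have H1 (n : nat) : exists tx : R * V, 0 <= tx.1 <= n.+1%:R^-1 /\
    n.+1%:R * rnorm tx.2 < rnorm (T tx.1 tx.2).
  apply: contrapT => H1; apply: H; exists n.+1%:R, n.+1%:R^-1; split=> [||t x ht].
  - by rewrite ltr0n.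
  - by rewrite invr_gt0 ltr0n.
  - by rewrite leNgt; apply/negP => h; apply: H1; exists (t, x).
have [g Hg] := choice H1.
have [n||M M0 HM] := @uniform_bounded R V V cV (fun n => T (g n).1).
- by have [/andP[g0 _] _] := Hg n; exact: semigroup_bounded.
- move=> x; have [d d0 Hd] := semigroup_right0 x ltr01.
  pose n0 := Num.truncn d^-1.
  exists (rnorm x + 1 + \sum_(i < n0) rnorm (T (g i).1 x)) => n.
  have [n0n|nn0] := leqP n0 n.
    have [/andP[g0 gn] _] := Hg n.
    have := rnorm_le_dist (T (g n).1 x) x.
    have := Hd (g n).1; rewrite g0 (le_trans gn) /=.
      move=> /(_ isT).
      have : 0 <= \sum_(i < n0) rnorm (T (g i).1 x).
        by apply: sumr_ge0 => i _; exact: rnorm_ge0.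
      lra.
    rewrite -(invrK d) lef_pV2 ?posrE ?invr_gt0 ?ltr0n //.
    by rewrite (le_trans (ltW (truncnS_gt _))) // ler_nat ltnS.
  rewrite (bigD1 (Ordinal nn0)) //=.
  have : 0 <= \sum_(i < n0 | i != Ordinal nn0) rnorm (T (g i).1 x).
    by apply: sumr_ge0 => i _; exact: rnorm_ge0.
  have := rnorm_ge0 x; lra.
pose n := Num.truncn M; have [_] := Hg n; have := HM n (g n).2.
have : M * rnorm (g n).2 <= n.+1%:R * rnorm (g n).2.
  by rewrite ler_wpM2r ?rnorm_ge0 // ltW // truncnS_gt.
lra.
Qed.

Lemma semigroup_bounded_on b : 0 <= b -> exists2 M : R, 0 < M &
  forall t x, 0 <= t <= b -> rnorm (T t x) <= M * rnorm x.
Proof.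
move=> b0; have [M [d [M0 d0 HM]]] := semigroup_bounded_near0.
have [_ _ TD _] := HT.
have H (n : nat) : exists2 M : R, 0 < M &
    forall t x, 0 <= t <= n.+1%:R * d -> rnorm (T t x) <= M * rnorm x.
  elim: n => [|n [M' M'0 HM']].
    by exists M => // t x; rewrite mul1r; exact: HM.
  exists (M * M' + M'); first by have := mulr_gt0 M0 M'0; lra.
  move=> t x /andP[t0]; rewrite -natr1 mulrDl mul1r => tn.
  have xM := mulr_ge0 (ltW M'0) (rnorm_ge0 x).
  have [td|dt] := leP t (n.+1%:R * d).
    have := HM' t x; rewrite t0 td => /(_ isT).
    by have := mulr_ge0 (ltW M0) xM; lra.
  have nd : 0 <= n.+1%:R * d by rewrite mulr_ge0 // ltW.
  have -> : t = (t - n.+1%:R * d) + n.+1%:R * d by ring.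
  rewrite TD //; last lra.
  have h1 := HM (t - n.+1%:R * d) (T (n.+1%:R * d) x).
  have h2 := HM' (n.+1%:R * d) x.
  have {}h1 : rnorm (T (t - n.+1%:R * d) (T (n.+1%:R * d) x)) <= M * rnorm (T (n.+1%:R * d) x).
    by apply: h1; apply/andP; split; lra.
  have {}h2 : rnorm (T (n.+1%:R * d) x) <= M' * rnorm x by apply: h2; rewrite nd lexx.
  by have := ler_wpM2l (ltW M0) h2; lra.
have [M' M'0 HM'] := H (Num.truncn (b / d)).
exists M' => // t x /andP[t0 tb]; apply: HM'; rewrite t0 (le_trans tb) //.
by rewrite -ler_pdivrMr // ltW // truncnS_gt.
Qed.

Lemma orbit_ucont b x : 0 <= b -> ucont (fun t => T t x) b.
Proof.
move=> b0 e e0; have [M M0 HM] := semigroup_bounded_on b0.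
have [_ _ TD _] := HT.
have eM : 0 < e / M by rewrite divr_gt0.
have [d d0 Hd] := semigroup_right0 x eM; exists d => //.
have H s t : 0 <= s -> s <= t -> t <= b -> t - s <= d -> rnorm (T t x - T s x) <= e.
  move=> s0 st tb ts.
  have -> : T t x = T s (T (t - s) x).
    by rewrite -TD //; [congr (T _ _); ring | lra].
  rewrite -semigroupB; have /le_trans : rnorm (T s (T (t - s) x - x)) <= M * rnorm (T (t - s) x - x).
    by apply: HM; apply/andP; split; lra.
  apply; rewrite mulrC -ler_pdivlMr //; apply: Hd; apply/andP; split; lra.
move=> s t /andP[s0 sb] /andP[t0 tb] std.
have [st|ts] := leP s t.
  rewrite rnorm_distC; apply: H => //; apply: le_trans std.
  by rewrite distrC ler_norm.
by apply: H => //; [exact: ltW | apply: le_trans std; exact: ler_norm].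
Qed.

Lemma orbit_left t x e : 0 < t -> 0 < e ->
  exists2 d : R, 0 < d & forall h : R, 0 < h < d -> rnorm (T t x - T (t - h) x) <= e.
Proof.
move=> t0 e0; have [d d0 Hd] := orbit_ucont x (ltW t0) e0.
exists (Num.min d t); first by rewrite lt_min d0.
move=> h /andP[h0]; rewrite lt_min => /andP[hd ht].
apply: Hd; [by rewrite lexx ltW | by apply/andP; split; lra |].
by rewrite opprB addrC subrK gtr0_norm // ltW.
Qed.

(** The graph of the generator; the difference quotient is multiplied out by [h]. *)
Definition gen (x y : V) : Prop := forall e : R, 0 < e ->
  exists2 d : R, 0 < d & forall h : R, 0 < h < d -> rnorm (T h x - x - h%:C *: y) <= e * h.

Lemma genP (A : V -> V -> Prop) x y : generated_by A T -> A x y <-> gen x y.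
Proof.
case=> _ /(_ x y) ->; rewrite cvg_rightP; split=> H e e0.
all: have [d d0 Hd] := H _ e0; exists d => // h /[dup] hh /Hd.
all: have /andP[h0 _] := hh; rewrite ?add0r.
all: have h1 : h%:C != 0 :> R[i] by rewrite (_ : 0 = 0%:C) // (inj_eq (@complexI _)) gt_eqF.
all: have E : T h x - x - h%:C *: y = h%:C *: (h%:C^-1 *: (T h x - x) - y)
  by rewrite scalerBr scalerKV.
all: rewrite E rnormZ gtr0_norm // mulrC.
- by move=> H1; rewrite ler_pM2r.
- by rewrite ler_pM2r.
Qed.

Lemma gen_comb (a b : R) x y x' y' : gen x y -> gen x' y' ->
  gen (a%:C *: x + b%:C *: x') (a%:C *: y + b%:C *: y').
Proof.
move=> H1 H2 e e0; pose k := `|a| + `|b| + 1.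
have k0 : 0 < k by rewrite /k; have := normr_ge0 a; have := normr_ge0 b; lra.
have ek : 0 < e / k by rewrite divr_gt0.
have [d1 d10 Hd1] := H1 _ ek; have [d2 d20 Hd2] := H2 _ ek.
exists (Num.min d1 d2); first by rewrite lt_min d10.
move=> h /andP[h0]; rewrite lt_min => /andP[hd1 hd2].
have := Hd1 h; rewrite h0 hd1 => /(_ isT) /(ler_wpM2l (normr_ge0 a)).
have := Hd2 h; rewrite h0 hd2 => /(_ isT) /(ler_wpM2l (normr_ge0 b)).
have -> : T h (a%:C *: x + b%:C *: x') - (a%:C *: x + b%:C *: x')
    - h%:C *: (a%:C *: y + b%:C *: y') =
    a%:C *: (T h x - x - h%:C *: y) + b%:C *: (T h x' - x' - h%:C *: y').
  have TZ (c : R[i]) u : T h (c *: u) = c *: T h u by rewrite linearZ.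
  rewrite (linearD (T h)) !TZ !scalerBr scalerDr !scalerA (mulrC h%:C a%:C) (mulrC h%:C b%:C).
  by zmod.
move=> h2 h1; apply: (le_trans (rnormD _ _)); rewrite !rnormZ.
have eE : e * h = (e / k * h) * k by field; rewrite gt_eqF.
have : 0 <= e / k * h by apply: mulr_ge0; exact: ltW.
rewrite eE {3}/k => ekh; set q := e / k * h in h1 h2 ekh *; lra.
Qed.

Lemma genB x y x' y' : gen x y -> gen x' y' -> gen (x - x') (y - y').
Proof.
have E (u v : V) : u - v = 1%:C *: u + (-1)%:C *: v.
  by rewrite rmorphN scaleNr !scale1r.
by rewrite !E => h1 h2; exact: gen_comb.
Qed.

Lemma genZ (a : R) x y : gen x y -> gen (a%:C *: x) (a%:C *: y).
Proof.
move=> h; have := gen_comb a 0 h h.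
by rewrite !scale0r !addr0.
Qed.

Lemma gen_orbit t x y : 0 <= t -> gen x y -> gen (T t x) (T t y).
Proof.
move=> t0 H e e0; have [M M0 HM] := semigroup_bounded t0.
have eM : 0 < e / M by rewrite divr_gt0.
have [d d0 Hd] := H _ eM; exists d => // h /[dup] hh /Hd.
have /andP[h0 _] := hh; have [_ _ TD _] := HT.
have TC : T h (T t x) = T t (T h x) by rewrite -!TD ?(ltW h0) // addrC.
have -> : T h (T t x) - T t x - h%:C *: T t y = T t (T h x - x - h%:C *: y).
  by rewrite TC !semigroupB semigroupZ.
move=> h1; apply: (le_trans (HM _)); rewrite mulrC -ler_pdivlMr //; apply: le_trans h1 _.
by rewrite mulrAC.
Qed.

Section orbit_primitive.
Variables (x : V) (b : R) (F : R -> V).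
Hypotheses (F0 : F 0 = 0) (HF : primitive (fun t => T t x) b F).

Lemma primitive_right t e : 0 <= t < b -> 0 < e -> exists2 d : R, 0 < d &
  forall h : R, 0 < h < d -> rnorm (F (t + h) - F t - h%:C *: T t x) <= e * h.
Proof.
move=> /andP[t0 tb] e0.
have b0 : 0 <= b by lra.
have [d d0 Hd] := orbit_ucont x b0 e0.
exists (Num.min d (b - t)); first by rewrite lt_min d0; lra.
move=> h /andP[h0]; rewrite lt_min => /andP[hd hb].
have hE : t + h - t = h by ring.
have := @HF t (t + h) t0; rewrite hE mulrC; apply; [lra|lra|].
move=> u /andP[tu uh]; apply: Hd; rewrite ?ger0_norm; try (apply/andP; split); lra.
Qed.

Lemma primitive_left t e : 0 < t <= b -> 0 < e -> exists2 d : R, 0 < d &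
  forall h : R, 0 < h < d -> rnorm (F t - F (t - h)) <= e.
Proof.
move=> /andP[t0 tb] e0.
have b0 : 0 <= b by lra.
have [M M0 HM] := semigroup_bounded_on b0.
pose K := M * rnorm x + 1; have K0 : 0 < K by rewrite /K; have := rnorm_ge0 x; have := mulr_ge0 (ltW M0) (rnorm_ge0 x); lra.
exists (Num.min t (e / K)); first by rewrite lt_min t0 divr_gt0.
move=> h /andP[h0]; rewrite lt_min => /andP[ht]; rewrite ltr_pdivlMr // => hK.
have := @HF (t - h) t; have -> : t - (t - h) = h by ring.
move=> /(_ _ _ tb 0 K); rewrite scaler0 subr0 => H; apply: (le_trans (H _ _ _)); try lra.
move=> u /andP[u0 ut]; rewrite subr0; apply: (@le_trans _ _ (M * rnorm x)).
  by apply: HM; apply/andP; split; lra.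
by rewrite /K; lra.
Qed.

(** Both sides start from [0] and move with velocity [T (t + h) x]. *)
Lemma primitive_shift t h : 0 <= t -> 0 <= h -> t + h <= b ->
  T h (F t) = F (t + h) - F h.
Proof.
move=> t0 h0 thb; apply/eqP; rewrite -subr_eq0; apply/eqP.
pose k s := rnorm (T h (F s) - (F (s + h) - F h)).
have [M M0 HM] := semigroup_bounded h0.
have kE r s : k s <= k r + M * rnorm (F s - F r - (s - r)%:C *: T r x)
    + rnorm (F (s + h) - F (r + h) - (s - r)%:C *: T h (T r x)).
  rewrite /k; apply: (le_trans (rnorm_le_dist _ (T h (F r) - (F (r + h) - F h)))).
  rewrite -(addrA (rnorm (T h (F r) - _))) lerD2l.
  have -> : T h (F s) - (F (s + h) - F h) - (T h (F r) - (F (r + h) - F h)) =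
     T h (F s - F r - (s - r)%:C *: T r x) -
     (F (s + h) - F (r + h) - (s - r)%:C *: T h (T r x)).
    by rewrite !semigroupB semigroupZ; zmod.
  by apply: (le_trans (rnormB _ _)); rewrite lerD2r.
have [_ _ TD _] := HT.
have k0 : k 0 = 0 by rewrite /k F0 linear0 [0 + h]add0r subrr subr0 rnorm0.
have : k t <= k 0.
  apply: slope_le0 => // s /andP[s0 st] e e0.
  - have eM : 0 < e / (2 * M) by rewrite divr_gt0 // mulr_gt0.
    have e2 : 0 < e / 2 by lra.
    have hs1 : 0 <= s < b by apply/andP; split; lra.
    have hs2 : 0 <= s + h < b by apply/andP; split; lra.
    have [d1 d10 Hd1] := primitive_right hs1 eM.
    have [d2 d20 Hd2] := primitive_right hs2 e2.
    exists (Num.min d1 d2); first by rewrite lt_min d10.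
    move=> eta /andP[eta0]; rewrite lt_min => /andP[hd1 hd2].
    have := Hd1 eta; rewrite eta0 hd1 => /(_ isT) /(ler_wpM2l (ltW M0)).
    have := Hd2 eta; rewrite eta0 hd2 => /(_ isT) h2 h1.
    have := kE s (s + eta); have -> : s + eta - s = eta by ring.
    rewrite -TD // [h + s]addrC [s + eta + h]addrAC.
    have ME : M * (e / (2 * M) * eta) = e * eta / 2 by field; rewrite gt_eqF.
    rewrite ME in h1; have -> : (0 + e) * eta = e * eta by ring.
    have E2 : e / 2 * eta = e * eta / 2 by ring.
    rewrite E2 in h2; lra.
  - have hs1 : 0 < s <= b by apply/andP; split; lra.
    have hs2 : 0 < s + h <= b by apply/andP; split; lra.
    have eM : 0 < e / (2 * M) by rewrite divr_gt0 // mulr_gt0.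
    have e2 : 0 < e / 2 by lra.
    have [d1 d10 Hd1] := primitive_left hs1 eM.
    have [d2 d20 Hd2] := primitive_left hs2 e2.
    exists (Num.min d1 d2); first by rewrite lt_min d10.
    move=> eta /andP[eta0]; rewrite lt_min => /andP[hd1 hd2].
    have := Hd1 eta; rewrite eta0 hd1 => /(_ isT) /(ler_wpM2l (ltW M0)).
    have := Hd2 eta; rewrite eta0 hd2 => /(_ isT) h2 h1.
    have ME : M * (e / (2 * M)) = e / 2 by field; rewrite gt_eqF.
    rewrite ME in h1.
    rewrite /k; apply: (le_trans (rnorm_le_dist _ (T h (F (s - eta)) - (F (s - eta + h) - F h)))).
    rewrite lerD2l.
    have -> : T h (F s) - (F (s + h) - F h) - (T h (F (s - eta)) - (F (s - eta + h) - F h)) =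
      T h (F s - F (s - eta)) - (F (s + h) - F (s - eta + h)).
      by rewrite !semigroupB; zmod.
    apply: (le_trans (rnormB _ _)); rewrite [s - eta + h]addrAC.
    have := HM (F s - F (s - eta)); lra.
rewrite k0 => kt; apply: rnorm_eq0; apply/eqP; rewrite eq_le rnorm_ge0 andbT.
exact: kt.
Qed.

(** Averaging an orbit over time gains one order of regularity: [F t] lies in the domain for
    every [x], and in the domain of the square of the generator when [x] lies in the domain. *)
Lemma primitive_gen t : 0 <= t < b -> gen (F t) (T t x - x).
Proof.
move=> /andP[t0 tb] e e0.
have e2 : 0 < e / 2 by lra.
have b0 : 0 < b by lra.
have hs1 : 0 <= t < b by apply/andP; split; lra.
have hs2 : 0 <= (0 : R) < b by apply/andP; split; lra.
have [d1 d10 Hd1] := primitive_right hs1 e2.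
have [d2 d20 Hd2] := primitive_right hs2 e2.
exists (Num.min (b - t) (Num.min d1 d2)); first by rewrite !lt_min d10 d20 !andbT; lra.
move=> eta /andP[eta0]; rewrite !lt_min => /and3P[hb hd1 hd2].
have := Hd1 eta; rewrite eta0 hd1 => /(_ isT).
have := Hd2 eta; rewrite eta0 hd2 => /(_ isT).
have [_ T0 _ _] := HT; rewrite add0r F0 subr0 T0.
rewrite primitive_shift ?(ltW eta0) //; last lra.
move=> h2 h1; have := rnormB (F (t + eta) - F t - eta%:C *: T t x) (F eta - eta%:C *: x).
have -> : F (t + eta) - F t - eta%:C *: T t x - (F eta - eta%:C *: x) =
  F (t + eta) - F eta - F t - eta%:C *: (T t x - x) by rewrite scalerBr; zmod.
lra.
Qed.

End orbit_primitive.

Lemma orbit_primitive_exists x b : 0 < b ->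
  exists2 F, F 0 = 0 & primitive (fun t => T t x) b F.
Proof. by move=> b0; apply: primitive_exists => //; apply: orbit_ucont; exact: ltW. Qed.

Lemma gen_dense x e : 0 < e -> exists y z, gen y z /\ rnorm (y - x) <= e.
Proof.
move=> e0; have [d d0 Hd] := semigroup_right0 x e0.
have [F F0 HF] := orbit_primitive_exists x (ltr_pwDl d0 ler01).
have hd : 0 <= d < d + 1 by apply/andP; split; lra.
exists ((d^-1)%:C *: F d), ((d^-1)%:C *: (T d x - x)); split.
  by apply: genZ; exact: primitive_gen F0 HF _ hd.
have d0' : 0 <= d by exact: ltW.
have := @HF 0 d (lexx _) d0'; rewrite F0 !subr0 => H.
have -> : x = (d^-1)%:C *: (d%:C *: x).
  by rewrite scalerA -rmorphM /= mulVf ?gt_eqF // scale1r.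
rewrite -scalerBr rnormZ gtr0_norm ?invr_gt0 // -ler_pdivlMl ?invr_gt0 // invrK.
by apply: H => //; lra.
Qed.

Lemma orbit_rderiv t x y e : 0 <= t -> gen x y -> 0 < e -> exists2 d : R, 0 < d &
  forall h : R, 0 < h < d -> rnorm (T (t + h) x - T t x - h%:C *: T t y) <= e * h.
Proof.
move=> t0 g e0; have [d d0 Hd] := gen_orbit t0 g e0.
exists d => // h /[dup] hh /Hd; have /andP[h0 _] := hh.
by have [_ _ TD _] := HT; rewrite -TD ?(ltW h0) // [h + t]addrC.
Qed.

End semigroup_theory.

(** * Curves and Duhamel's formula *)

Section curves.
Context (R : realType) (V : normedModType R[i]).
Implicit Types (f : R -> V) (t : R) (v c : V).

Definition rderiv f t v : Prop := forall e : R, 0 < e ->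
  exists2 d : R, 0 < d & forall h : R, 0 < h < d ->
    rnorm (f (t + h) - f t - h%:C *: v) <= e * h.

Definition lcontV f t : Prop := forall e : R, 0 < e ->
  exists2 d : R, 0 < d & forall h : R, 0 < h < d -> rnorm (f t - f (t - h)) <= e.

Lemma rslope_rnorm f t v c : rderiv f t v -> rslope (fun s => rnorm (f s - c)) t (rnorm v).
Proof.
move=> H e e0; have [d d0 Hd] := H _ e0; exists d => // h /[dup] /andP[h0 _] /Hd h1.
have := rnorm_le_dist (f (t + h) - c) (f t - c).
have -> : f (t + h) - c - (f t - c) = (f (t + h) - f t - h%:C *: v) + h%:C *: v by zmod.
have := rnormD (f (t + h) - f t - h%:C *: v) (h%:C *: v).
rewrite rnormZ gtr0_norm //; lra.
Qed.

Lemma lcont_rnorm f t c : lcontV f t -> lcont (fun s => rnorm (f s - c)) t.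
Proof.
move=> H e e0; have [d d0 Hd] := H _ e0; exists d => // h /Hd h1.
have := rnorm_le_dist (f t - c) (f (t - h) - c).
have -> : f t - c - (f (t - h) - c) = f t - f (t - h) by zmod.
lra.
Qed.

Lemma rderiv_line (c v : V) t : rderiv (fun s => c + s%:C *: v) t v.
Proof.
move=> e e0; exists 1 => // h /andP[h0 _].
have -> : c + (t + h)%:C *: v - (c + t%:C *: v) - h%:C *: v = 0.
  by rewrite rmorphD scalerDl; zmod.
by rewrite rnorm0 mulr_ge0 // ltW.
Qed.

Lemma lcontV_line (c v : V) t : lcontV (fun s => c + s%:C *: v) t.
Proof.
move=> e e0; have v0 := rnorm_ge0 v; have v1 : 0 < rnorm v + 1 by lra.
exists (e / (rnorm v + 1)); first by rewrite divr_gt0.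
move=> h /andP[h0]; rewrite ltr_pdivlMr // => hd.
have -> : c + t%:C *: v - (c + (t - h)%:C *: v) = h%:C *: v.
  by rewrite rmorphB scalerBl; zmod.
rewrite rnormZ gtr0_norm //; lra.
Qed.

Lemma rderivB f g t v w : rderiv f t v -> rderiv g t w ->
  rderiv (fun s => f s - g s) t (v - w).
Proof.
move=> H1 H2 e e0; have e2 : 0 < e / 2 by lra.
have [d1 d10 Hd1] := H1 _ e2; have [d2 d20 Hd2] := H2 _ e2.
exists (Num.min d1 d2); first by rewrite lt_min d10.
move=> h /andP[h0]; rewrite lt_min => /andP[hd1 hd2].
have := Hd1 h; rewrite h0 hd1 => /(_ isT); have := Hd2 h; rewrite h0 hd2 => /(_ isT) h2 h1.
have := rnormB (f (t + h) - f t - h%:C *: v) (g (t + h) - g t - h%:C *: w).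
have -> : f (t + h) - f t - h%:C *: v - (g (t + h) - g t - h%:C *: w) =
  f (t + h) - g (t + h) - (f t - g t) - h%:C *: (v - w) by rewrite scalerBr; zmod.
lra.
Qed.

Lemma lcontVB f g t : lcontV f t -> lcontV g t -> lcontV (fun s => f s - g s) t.
Proof.
move=> H1 H2 e e0; have e2 : 0 < e / 2 by lra.
have [d1 d10 Hd1] := H1 _ e2; have [d2 d20 Hd2] := H2 _ e2.
exists (Num.min d1 d2); first by rewrite lt_min d10.
move=> h /andP[h0]; rewrite lt_min => /andP[hd1 hd2].
have := Hd1 h; rewrite h0 hd1 => /(_ isT); have := Hd2 h; rewrite h0 hd2 => /(_ isT) h2 h1.
have := rnormB (f t - f (t - h)) (g t - g (t - h)).
have -> : f t - f (t - h) - (g t - g (t - h)) = f t - g t - (f (t - h) - g (t - h)) by zmod.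
lra.
Qed.

End curves.

Section duhamel.
Context (R : realType) (V : normedModType R[i]) (T : R -> {linear V -> V}).
Hypothesis (cV : rcomplete V) (HT : C0_semigroup T).
Variables (b M : R) (z dz g : R -> V).
Hypotheses (M0 : (0 : R) < M) (HM : forall (t : R) x, 0 <= t <= b -> rnorm (T t x) <= M * rnorm x).

Let TB t x y : T t (x - y) = T t x - T t y.
Proof. exact: linearB. Qed.

Let k s := rnorm (T (b - s) (z s) - T b (z 0)).

(** Duhamel's formula in differential form: [T (b - s) (z s)] would be constant in [s] if
    [z] were an orbit, so it moves only as fast as the defect [dz - g] of [z]. *)
Lemma duhamel_rslope (s : R) : 0 <= s < b -> rderiv z s (dz s) -> gen T (z s) (g s) ->
  rslope k s (M * rnorm (dz s - g s)).
Proof.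
move=> /andP[s0 sb] Hz Hg e e0.
have eM : 0 < e / (2 * M) by rewrite divr_gt0 // mulr_gt0.
have [d1 d10 Hd1] := Hz _ eM; have [d2 d20 Hd2] := Hg _ eM.
exists (Num.min (b - s) (Num.min d1 d2)); first by rewrite !lt_min d10 d20 !andbT; lra.
move=> h /andP[h0]; rewrite !lt_min => /and3P[hb hd1 hd2].
have := Hd1 h; rewrite h0 hd1 => /(_ isT); have := Hd2 h; rewrite h0 hd2 => /(_ isT) h2 h1.
have [_ _ TD _] := HT.
have := rnorm_le_dist (T (b - (s + h)) (z (s + h)) - T b (z 0)) (T (b - s) (z s) - T b (z 0)).
have -> : T (b - (s + h)) (z (s + h)) - T b (z 0) - (T (b - s) (z s) - T b (z 0)) =
    T (b - (s + h)) (z (s + h) - T h (z s)).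
  rewrite TB; have -> : T (b - s) (z s) = T (b - (s + h)) (T h (z s)).
    by rewrite -TD; [congr (T _ _); ring | lra | lra].
  by zmod.
have := HM (t := b - (s + h)) (z (s + h) - T h (z s)).
have /[swap]/[apply] : 0 <= b - (s + h) <= b by apply/andP; split; lra.
have -> : z (s + h) - T h (z s) = (z (s + h) - z s - h%:C *: dz s)
    - (T h (z s) - z s - h%:C *: g s) + h%:C *: (dz s - g s).
  by rewrite scalerBr; zmod.
set u1 := z (s + h) - z s - h%:C *: dz s in h1 *.
set u2 := T h (z s) - z s - h%:C *: g s in h2 *.
set u3 := h%:C *: (dz s - g s).
have u3E : rnorm u3 = h * rnorm (dz s - g s) by rewrite /u3 rnormZ gtr0_norm.
have h3 := rnormD (u1 - u2) u3; have h4 := rnormB u1 u2.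
have h5 : M * rnorm (u1 - u2 + u3) <= M * (e / (2 * M) * h + e / (2 * M) * h + rnorm u3).
  by rewrite ler_pM2l //; lra.
have E : M * (e / (2 * M) * h + e / (2 * M) * h + rnorm u3) =
    (M * rnorm (dz s - g s) + e) * h by rewrite u3E; field; rewrite gt_eqF.
rewrite /k; lra.
Qed.

Lemma duhamel_lcont (s : R) : 0 < s <= b -> lcontV z s -> lcont k s.
Proof.
move=> /andP[s0 sb] Hz; apply: (@lcont_rnorm _ _ (fun s => T (b - s) (z s))).
move=> e e0; pose K := M * (1 + M); have K0 : 0 < K by rewrite mulr_gt0 ?addr_gt0.
have eK : 0 < e / K by rewrite divr_gt0.
have [d1 d10 Hd1] := Hz _ eK; have [d2 d20 Hd2] := semigroup_right0 HT (z s) eK.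
exists (Num.min s (Num.min d1 d2)); first by rewrite !lt_min d10 d20 !andbT; lra.
move=> h /andP[h0]; rewrite !lt_min => /and3P[hs hd1 hd2].
have := Hd1 h; rewrite h0 hd1 => /(_ isT) h1.
have h2 : rnorm (T h (z s) - z s) <= e / K by apply: Hd2; rewrite !ltW.
have [_ _ TD _] := HT.
have -> : T (b - (s - h)) (z (s - h)) = T (b - s) (T h (z (s - h))).
  by rewrite -TD; [congr (T _ _); ring | lra | lra].
rewrite -TB.
have -> : z s - T h (z (s - h)) = T h (z s - z (s - h)) - (T h (z s) - z s).
  by rewrite TB; zmod.
have := HM (t := b - s) (T h (z s - z (s - h)) - (T h (z s) - z s)).
have /[swap]/[apply] : 0 <= b - s <= b by apply/andP; split; lra.
move/le_trans; apply.
have h3 := rnormB (T h (z s - z (s - h))) (T h (z s) - z s).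
have h4 : rnorm (T h (z s - z (s - h))) <= M * rnorm (z s - z (s - h)).
  by apply: HM; apply/andP; split; lra.
have h5 : M * rnorm (z s - z (s - h)) <= M * (e / K) by rewrite ler_pM2l.
have : M * rnorm (T h (z s - z (s - h)) - (T h (z s) - z s)) <= M * (M * (e / K) + e / K).
  by rewrite ler_pM2l //; lra.
move/le_trans; apply; have -> : M * (M * (e / K) + e / K) = e; last exact: lexx.
by rewrite /K; field; rewrite !gt_eqF ?addr_gt0.
Qed.

End duhamel.

(** * Quadratic and linear functionals along curves *)

Section energy.
Context (R : realType) (V : normedModType R[i]) (a : V -> V -> R) (Ca : R).
Hypotheses (Ca0 : (0 : R) <= Ca)
  (aD : forall x y z, a (x + y) z = a x z + a y z)
  (aZ : forall (c : R) x z, a (c%:C *: x) z = c * a x z)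
  (aC : forall x y, a x y = a y x)
  (a_le : forall x y, `|a x y| <= Ca * rnorm x * rnorm y)
  (a_ge0 : forall x, 0 <= a x x).

Lemma quad_expand x y : a (x + y) (x + y) = a x x + 2 * a y x + a y y.
Proof. by rewrite aD (aC x) (aC y) !aD (aC x y); ring. Qed.

Lemma rslope_quad (f : R -> V) (t : R) (w : V) : rderiv f t w ->
  rslope (fun s => a (f s) (f s)) t (2 * a w (f t)).
Proof.
move=> H e e0; have Ca1 := Ca0.
set nx := rnorm (f t); set nw := rnorm w.
have nx0 : 0 <= nx by exact: rnorm_ge0.
have nw0 : 0 <= nw by exact: rnorm_ge0.
have k10 : 0 < 4 * Ca * nx + 1 by have := mulr_ge0 Ca1 nx0; lra.
have k20 : 0 < 2 * Ca * (nw + 1) ^+ 2 + 1.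
  by have := mulr_ge0 Ca1 (sqr_ge0 (nw + 1)); lra.
pose e' := Num.min 1 (e / (4 * Ca * nx + 1)).
have e'0 : 0 < e' by rewrite lt_min ltr01 divr_gt0.
have e'1 : e' <= 1 by rewrite ge_min lexx.
have e'2 : e' * (4 * Ca * nx + 1) <= e by rewrite -ler_pdivlMr // ge_min lexx orbT.
have [d d0 Hd] := H _ e'0.
exists (Num.min d (e / (2 * Ca * (nw + 1) ^+ 2 + 1))); first by rewrite lt_min d0 divr_gt0.
move=> h /andP[h0]; rewrite lt_min ltr_pdivlMr // => /andP[hd he].
have := Hd h; rewrite h0 hd => /(_ isT).
set z := f (t + h) - f t - h%:C *: w => hz.
have -> : f (t + h) = f t + (h%:C *: w + z) by rewrite /z; zmod.
rewrite quad_expand aD aZ.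
have hy : rnorm (h%:C *: w + z) <= h * (nw + 1).
  apply: (le_trans (rnormD _ _)); rewrite rnormZ gtr0_norm // mulrDr lerD2l mulr1.
  by apply: (le_trans hz); rewrite -[leRHS]mul1r ler_pM2r.
have hyy : a (h%:C *: w + z) (h%:C *: w + z) <= Ca * (h * (nw + 1)) ^+ 2.
  apply: (le_trans (ler_norm _)); apply: (le_trans (a_le _ _)).
  rewrite -mulrA ler_wpM2l // expr2 ler_pM ?rnorm_ge0 //.
have hzx : a z (f t) <= Ca * (e' * h) * nx.
  apply: (le_trans (ler_norm _)); apply: (le_trans (a_le _ _)).
  by rewrite ler_wpM2r // ler_wpM2l.
have q1 : Ca * (h * (nw + 1)) ^+ 2 <= e / 2 * h.
  have -> : Ca * (h * (nw + 1)) ^+ 2 = (h * (2 * Ca * (nw + 1) ^+ 2)) / 2 * h by field.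
  by rewrite ler_pM2r // ler_pM2r // ltW // (le_lt_trans _ he) // ler_pM2l //; lra.
have q2 : 2 * (Ca * (e' * h) * nx) <= e / 2 * h.
  have -> : 2 * (Ca * (e' * h) * nx) = (e' * (4 * Ca * nx)) / 2 * h by field.
  by rewrite ler_pM2r // ler_pM2r // (le_trans _ e'2) // ler_pM2l //; lra.
lra.
Qed.

Lemma lcont_quad (f : R -> V) (t : R) : lcontV f t -> lcont (fun s => a (f s) (f s)) t.
Proof.
move=> H e e0; have Ca1 := Ca0; set nx := rnorm (f t).
have nx0 : 0 <= nx by exact: rnorm_ge0.
have k0 : 0 < 2 * Ca * nx + 1 by have := mulr_ge0 Ca1 nx0; lra.
have ek : 0 < e / (2 * Ca * nx + 1) by rewrite divr_gt0.
have [d d0 Hd] := H _ ek; exists d => // h /Hd; rewrite ler_pdivlMr //.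
set u := f t - f (t - h) => hu.
have fE : f t = f (t - h) + u by rewrite /u; zmod.
have aE : a (f t) (f t) = a (f (t - h)) (f (t - h)) + 2 * a u (f t) - a u u.
  by rewrite fE quad_expand (aC u (_ + u)) aD (aC _ u); ring.
have := a_ge0 u; have := le_trans (ler_norm _) (a_le u (f t)); rewrite -/nx.
rewrite aE => h1 h2; have := rnorm_ge0 u; lra.
Qed.

Lemma rslope_lform (f : R -> V) (t : R) (w : V) (l : V -> R) (k c : R) :
  (forall x y, l (x - y) = l x - l y) -> (forall (r : R) x, l (r%:C *: x) = r * l x) ->
  (forall x, `|l x| <= k * rnorm x) -> rderiv f t w ->
  rslope (fun s => c * l (f s)) t (c * l w).
Proof.
move=> lB lZ lk H e e0.
pose q := `|c| * `|k| + 1; have q0 : 0 < q.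
  by have := mulr_ge0 (normr_ge0 c) (normr_ge0 k); rewrite /q; lra.
have eq : 0 < e / q by rewrite divr_gt0.
have [d d0 Hd] := H _ eq; exists d => // h /[dup] /andP[h0 _] /Hd.
set z := _ - _ - _ => hz.
have lz : l z = l (f (t + h)) - l (f t) - h * l w by rewrite /z !lB lZ.
have h1 : `|c * l z| <= e * h.
  rewrite normrM; apply: (@le_trans _ _ (`|c| * (`|k| * rnorm z))).
    rewrite ler_wpM2l // (le_trans (lk z)) // ler_wpM2r ?rnorm_ge0 //.
    exact: ler_norm.
  apply: (@le_trans _ _ (q * rnorm z)).
    by rewrite mulrA ler_wpM2r ?rnorm_ge0 // /q; lra.
  apply: (@le_trans _ _ (q * (e / q * h))); first by rewrite ler_pM2l.
  by rewrite mulrA mulrCA divff ?mulr1 // gt_eqF.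
have := ler_norm (c * l z); rewrite lz in h1 *; lra.
Qed.

Lemma lcont_lform (f : R -> V) (t : R) (l : V -> R) (k c : R) :
  (forall x y, l (x - y) = l x - l y) ->
  (forall x, `|l x| <= k * rnorm x) -> lcontV f t ->
  lcont (fun s => c * l (f s)) t.
Proof.
move=> lB lk H e e0.
pose q := `|c| * `|k| + 1; have q0 : 0 < q.
  by have := mulr_ge0 (normr_ge0 c) (normr_ge0 k); rewrite /q; lra.
have eq : 0 < e / q by rewrite divr_gt0.
have [d d0 Hd] := H _ eq; exists d => // h /Hd.
set z := _ - _ => hz.
have lz : l z = l (f t) - l (f (t - h)) by rewrite /z !lB.
have h1 : `|c * l z| <= e.
  rewrite normrM; apply: (@le_trans _ _ (`|c| * (`|k| * rnorm z))).
    rewrite ler_wpM2l // (le_trans (lk z)) // ler_wpM2r ?rnorm_ge0 //.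
    exact: ler_norm.
  apply: (@le_trans _ _ (q * rnorm z)).
    by rewrite mulrA ler_wpM2r ?rnorm_ge0 // /q; lra.
  apply: (@le_trans _ _ (q * (e / q))); first by rewrite ler_pM2l.
  by rewrite mulrCA divff ?mulr1 // gt_eqF.
have := ler_norm (c * l z); rewrite lz in h1 *; lra.
Qed.

End energy.

Section product_norm.
Context (R : realType) (V W : normedModType R[i]).

Lemma rnorm_pair (x : V) (y : W) : rnorm ((x, y) : (V * W)%type) = Num.max (rnorm x) (rnorm y).
Proof.
apply: complexI; rewrite -normrE prod_normE /= !normrE.
by rewrite !maxEle lecR; case: ifP.
Qed.

Lemma rcomplete_pair : rcomplete V -> rcomplete W -> rcomplete (V * W)%type.
Proof.
move=> cV cW u Hu.
have [|l Hl] := cV (fun n => (u n).1).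
  move=> e /Hu[n0 H]; exists n0 => p q hp hq; have := H p q hp hq.
  rewrite [u p - u q]surjective_pairing rnorm_pair ge_max => /andP[+ _].
  by [].
have [|m Hm] := cW (fun n => (u n).2).
  move=> e /Hu[n0 H]; exists n0 => p q hp hq; have := H p q hp hq.
  rewrite [u p - u q]surjective_pairing rnorm_pair ge_max => /andP[_ +].
  by [].
exists (l, m) => e e0; have [n1 H1] := Hl e e0; have [n2 H2] := Hm e e0.
exists (n1 + n2)%N => p hp.
rewrite [u p - _]surjective_pairing rnorm_pair ge_max; apply/andP; split.
  by apply: H1; apply: leq_trans hp; exact: leq_addr.
by apply: H2; apply: leq_trans hp; exact: leq_addl.
Qed.

End product_norm.

(** * Transfer of stability between dissipative semigroups *)

(** The real arithmetic of the estimates, kept apart from the long contexts in which it is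
    used. *)
Lemma drop_rearrange (R : realType) (k c m a1 a2 a3 b1 b2 b3 : R) :
  k + c * (a1 + a2 + a3) <= c * (b1 + b2 + b3) + m ->
  k <= c * ((b1 - a1) + (b2 - a2) + (b3 - a3)) + m.
Proof. lra. Qed.

Lemma drop_double (R : realType) (c e0 el eb ebl f0 fb fbl : R) :
  0 <= c -> el <= e0 -> ebl <= eb -> fbl <= fb -> fb <= f0 ->
  c * ((el - ebl) + (e0 - eb) + (f0 - fb)) <= c * (2 * ((e0 - ebl) + (f0 - fbl))).
Proof. by move=> c0 h1 h2 h3 h4; rewrite ler_wpM2l //; lra. Qed.

Lemma chain_arith (R : realType) (t z k u x w m y : R) :
  t <= z -> z <= u + k -> u <= x -> k <= w + m -> w <= y -> t <= x + (m + y).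
Proof. lra. Qed.

Lemma oscillation_arith (R : realType) (ca K Q q n w : R) :
  0 < ca -> 0 < K -> 0 <= Q -> 0 <= q -> 0 <= n -> 0 <= w -> w <= q ->
  ca * n ^+ 2 <= K * (n + w) * Q + ca / 4 * n * (n + w) ->
  n <= (1 + 4 * K / ca) * (Q + q).
Proof.
move=> ca0 K0 Q0 q0 n0 w0 wq h; set C3 := _ + _.
have C31 : 1 <= C3 by rewrite /C3 lerDl divr_ge0 ?mulr_ge0 // ltW.
have C30 : 0 < C3 by lra.
rewrite leNgt; apply/negP => hn.
have np : 0 < n by apply: le_lt_trans hn; apply: mulr_ge0; [exact: ltW | exact: addr_ge0].
have hQ : Q + q < n / C3 by rewrite ltr_pdivlMr // mulrC.
have nC : n / C3 <= n by rewrite ler_pdivrMr // ler_peMr.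
have KQ : K * Q < ca / 4 * n.
  have h1 : K * Q <= K * (n / C3) by rewrite ler_pM2l //; lra.
  apply: (le_lt_trans h1); rewrite mulrA ltr_pdivrMr // mulrAC.
  have -> : ca / 4 * C3 * n = ca / 4 * n + K * n by rewrite /C3; field; rewrite gt_eqF.
  by rewrite ltr_pwDl // mulr_gt0 //; lra.
have h1 : K * (n + w) * Q + ca / 4 * n * (n + w) = (n + w) * (K * Q + ca / 4 * n) by ring.
have h2 : (n + w) * (K * Q + ca / 4 * n) <= 2 * n * (K * Q + ca / 4 * n).
  rewrite ler_wpM2r //; last lra.
  by rewrite addr_ge0 // mulr_ge0 //; lra.
have h3 : 2 * n * (K * Q + ca / 4 * n) < 2 * n * (ca / 4 * n + ca / 4 * n).
  by rewrite ltr_pM2l; lra.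
have h4 : 2 * n * (ca / 4 * n + ca / 4 * n) = ca * n ^+ 2 by field.
lra.
Qed.

Lemma rate_arith (R : realType) (Q v w q u d : R) :
  v <= d + u -> w <= q -> Q + (v + w) <= Q + d + q + u.
Proof. lra. Qed.

Lemma budget_arith (R : realType) (r e1 e0 cD m : R) :
  r + e1 <= e0 + m -> e0 - e1 <= cD -> r <= cD + m.
Proof. lra. Qed.

Lemma final_arith (R : realType) (a1 a2 e s A1 A2 d q C n : R) :
  0 <= a1 -> 0 <= a2 -> 0 <= e -> 0 <= s -> 0 <= A1 -> 0 <= A2 -> 0 <= d -> 0 <= q ->
  C * n = a1 + a2 ->
  a1 * e + a2 * s + A1 * d + A2 * q <= C * (e + s) * n + (A1 + A2) * (d + q).
Proof.
move=> h1 h2 h3 h4 h5 h6 h7 h8 hC.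
have -> : C * (e + s) * n = (a1 + a2) * (e + s) by rewrite -hC; ring.
have := mulr_ge0 h1 h4; have := mulr_ge0 h2 h3; have := mulr_ge0 h5 h8.
have := mulr_ge0 h6 h7; lra.
Qed.

Lemma eighth_arith (R : realType) (l C rho : R) :
  l * (C * l) <= l * (rho / 8) -> l * rho / 8 + C * l ^+ 2 <= l * rho / 4.
Proof. lra. Qed.

Lemma quarter_arith (R : realType) (u P Q S l rho n c : R) :
  l * u <= c + (P + Q) -> c <= l * rho / 4 * n -> P = l * rho * n / 4 ->
  Q <= l * rho * n / 2 -> l * u <= l * (rho * n).
Proof. lra. Qed.

Lemma half_arith (R : realType) (ca n Ex Et : R) :
  ca * n <= Ex -> Et <= ca / 2 * n -> ca / 2 * n <= Ex - Et.
Proof. lra. Qed.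

Lemma theta_arith (R : realType) (c e0 e1 f0 f1 k : R) :
  c <= (e0 - e1) + (f0 - f1) -> k <= c -> e1 + f1 <= e0 + f0 - k.
Proof. lra. Qed.

Lemma density_arith (R : realType) (tx tx' td nx nx' eps M e e' nd : R) :
  tx' <= eps * nx' -> td <= M * nd -> tx <= tx' + td -> M * nd <= M * e' ->
  eps * nx' <= eps * (nx + e') -> e = M * e' + eps * e' -> tx <= eps * nx + e.
Proof. lra. Qed.

(** The abstract situation. The energy [a x x] of [T] is equivalent to the squared norm and is
    dissipated at rate [nu * |v x|^2]; the lift [(x, p x)] turns the generator of [T] into that
    of [TA], with second component [v x], and [p] is controlled by [v]. The last hypothesis
    says that the generator is bounded in a weak sense: paired with a suitable functional [l]
    depending on [d], it costs only [|x| + |v x|], while [l] still sees the energy of [d] up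
    to a small error. *)
Section stability.
Context (R : realType) (V W : normedModType R[i]).
Context (T : R -> {linear V -> V}) (TA : R -> {linear (V * W)%type -> (V * W)%type}).
Hypotheses (cV : rcomplete V) (cW : rcomplete W) (HT : C0_semigroup T) (HTA : C0_semigroup TA).
Variables (a : V -> V -> R) (p v : V -> W) (ca Ca nu Cp : R).
Hypotheses (ca0 : (0 : R) < ca) (Ca0 : (0 : R) <= Ca) (nu0 : (0 : R) < nu) (Cp0 : (0 : R) <= Cp)
  (aD : forall x y z, a (x + y) z = a x z + a y z)
  (aZ : forall (c : R) x z, a (c%:C *: x) z = c * a x z)
  (aC : forall x y, a x y = a y x)
  (a_le : forall x y, `|a x y| <= Ca * rnorm x * rnorm y)
  (a_ge : forall x, ca * rnorm x ^+ 2 <= a x x)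
  (diss : forall x y, gen T x y -> a y x <= - nu * rnorm (v x) ^+ 2)
  (p_le : forall x y, gen T x y -> rnorm (p x) <= Cp * rnorm (v x))
  (vB : forall x y x' y', gen T x y -> gen T x' y' -> v (x - x') = v x - v x')
  (pB : forall x y x' y', gen T x y -> gen T x' y' -> p (x - x') = p x - p x')
  (pZ : forall (c : R) x y, gen T x y -> p (c%:C *: x) = c%:C *: p x)
  (ext : forall x y, gen T x y -> gen TA (x, p x) (y, v x))
  (weak : forall eta : R, 0 < eta -> exists2 K : R, 0 < K & forall d e, gen T d e ->
    exists l : V -> R, exists k : R, [/\ forall x y, l (x - y) = l x - l y,
      forall (c : R) x, l (c%:C *: x) = c * l x,
      forall x, `|l x| <= k * rnorm x,
      forall x y, gen T x y ->
        `|l y| <= K * (rnorm x + rnorm (v x)) * (rnorm d + rnorm (v d)) &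
      a d d <= l d + eta * rnorm d * (rnorm d + rnorm (v d))]).

Let cVW := rcomplete_pair cV cW.
Let E x := a x x.
Let C1 := Ca / ca + 1.

Let a_ge0 x : 0 <= a x x.
Proof. by apply: le_trans (a_ge x); rewrite mulr_ge0 ?sqr_ge0 // ltW. Qed.

Let E_le x : E x <= Ca * rnorm x ^+ 2.
Proof. by rewrite expr2 mulrA; exact: le_trans (ler_norm _) (a_le _ _). Qed.

Let C1_ge1 : 1 <= C1.
Proof. by rewrite /C1 ler_wpDl // divr_ge0 // ltW. Qed.

Let norm_of_energy x y : E x <= E y -> rnorm x <= C1 * rnorm y.
Proof.
move=> Exy; have c1 := C1_ge1; have c0 := ca0.
have c1n : 0 <= C1 * rnorm y by rewrite mulr_ge0 ?rnorm_ge0 //; lra.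
rewrite -(@ler_pXn2r _ 2) ?nnegrE ?rnorm_ge0 //.
have h : ca * rnorm x ^+ 2 <= Ca * rnorm y ^+ 2.
  by apply: (le_trans (a_ge x)); apply: (le_trans Exy); exact: E_le.
have h2 : rnorm x ^+ 2 <= Ca / ca * rnorm y ^+ 2.
  by rewrite mulrAC ler_pdivlMr // mulrC.
apply: (le_trans h2); rewrite exprMn ler_wpM2r ?sqr_ge0 //.
by rewrite expr2; apply: (@le_trans _ _ (1 * C1)); [rewrite mul1r /C1; lra|rewrite ler_wpM2r; lra].
Qed.

Let orbitE x y (t : R) : gen T x y -> 0 <= t ->
  rslope (fun s => E (T s x)) t (2 * a (T t y) (T t x)).
Proof.
move=> g t0; apply: (rslope_quad Ca0 aD aZ aC a_le (f := fun s => T s x)).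
by move=> e e0; exact: (orbit_rderiv HT t0 g e0).
Qed.

Let orbit_rslope x y (t : R) : gen T x y -> 0 <= t ->
  rslope (fun s => E (T s x)) t (- (2 * nu) * rnorm (v (T t x)) ^+ 2).
Proof.
move=> g t0; apply: rslopeW (orbitE g t0).
by have := diss (gen_orbit HT t0 g); lra.
Qed.

Let orbit_lcontV x (t : R) : 0 < t -> lcontV (fun s => T s x) t.
Proof. by move=> t0 e e0; exact: (orbit_left cV HT x t0 e0). Qed.

Let orbit_lcont x (t : R) : 0 < t -> lcont (fun s => E (T s x)) t.
Proof. by move=> t0; apply: (lcont_quad Ca0 aD aC a_le a_ge0 (f := fun s => T s x)); exact: orbit_lcontV. Qed.

Let energy_decr x y (s t : R) : gen T x y -> 0 <= s -> s <= t -> E (T t x) <= E (T s x).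
Proof.
move=> g s0 st; apply: (@slope_le0 _ (fun r => E (T r x)) s t st) => r /andP[h1 h2].
- have r0 : 0 <= r by lra.
  apply: rslopeW (orbit_rslope g r0).
  have := mulr_ge0 (ltW nu0) (sqr_ge0 (rnorm (v (T r x)))); lra.
- by apply: orbit_lcont; lra.
Qed.

Let orbit_le x y (s t : R) : gen T x y -> 0 <= s -> s <= t -> rnorm (T t x) <= C1 * rnorm (T s x).
Proof. by move=> g s0 st; apply: norm_of_energy; exact: energy_decr g s0 st. Qed.

Let orbit_le0 x y (t : R) : gen T x y -> 0 <= t -> rnorm (T t x) <= C1 * rnorm x.
Proof.
by move=> g t0; have := orbit_le g (lexx _) t0; have [_ -> _ _] := HT.
Qed.

Let Cv := Ca / nu + 1.

Let Cv0 : 0 < Cv.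
Proof. by rewrite /Cv ltr_wpDl // divr_ge0 // ltW. Qed.

Let v_le x y : gen T x y -> rnorm (v x) <= Cv * (rnorm y + rnorm x).
Proof.
move=> g; have n0 := nu0; have := diss g; have := a_le y x; rewrite ler_norml => /andP[h1 _] h2.
have x0 := rnorm_ge0 x; have y0 := rnorm_ge0 y.
have Cv1 : 1 <= Cv by rewrite /Cv ler_wpDl // divr_ge0 // ltW.
have s0 : 0 <= rnorm y + rnorm x by lra.
have r0 : 0 <= Cv * (rnorm y + rnorm x) by rewrite mulr_ge0 //; lra.
rewrite -(@ler_pXn2r _ 2) ?nnegrE ?rnorm_ge0 //.
have h3 : nu * rnorm (v x) ^+ 2 <= Ca * (rnorm y * rnorm x) by lra.
have h4 : rnorm (v x) ^+ 2 <= Ca / nu * (rnorm y * rnorm x).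
  by rewrite mulrAC ler_pdivlMr // mulrC.
apply: (le_trans h4); rewrite exprMn; apply: ler_pM.
- by rewrite divr_ge0 // ltW.
- exact: mulr_ge0.
- rewrite expr2; apply: (@le_trans _ _ (1 * Cv)); [rewrite mul1r /Cv; lra|rewrite ler_wpM2r; lra].
- by have := sqr_ge0 (rnorm y); have := sqr_ge0 (rnorm x); have := mulr_ge0 y0 x0; rewrite sqrrD mulr2n; lra.
Qed.

Let p_le' x y : gen T x y -> rnorm (p x) <= Cp * Cv * (rnorm y + rnorm x).
Proof.
move=> g; apply: (le_trans (p_le g)); rewrite -mulrA ler_wpM2l //; exact: v_le g.
Qed.

Let young (q d : R) : 0 < d -> q <= d + q ^+ 2 / d.
Proof.
move=> d0; have [qd|dq] := leP q d.
  by rewrite ler_wpDr // divr_ge0 ?sqr_ge0 // ltW.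
rewrite ler_wpDl ?(ltW d0) // ler_pdivlMr // expr2 ler_pM2l ?(ltW dq) //.
exact: lt_trans dq.
Qed.

(** The lifted curve [(X, p X)] is differentiable for the norm of [V * W]
    because [p] is bounded for the graph norm. *)
Let lift_rderiv x y y' (t : R) : gen T x y -> gen T y y' -> 0 <= t ->
  rderiv (fun s => (T s x, p (T s x)) : (V * W)%type) t (T t y, p (T t y)).
Proof.
move=> g g' t0 e e0.
have [_ _ TD _] := HT.
pose K := 2 * Cp * Cv + 1; have K1 : 1 <= K.
  by have := mulr_ge0 Cp0 (ltW Cv0); rewrite /K; lra.
have K0 : 0 < K by lra.
have eK : 0 < e / K by rewrite divr_gt0.
have [d1 d10 Hd1] := orbit_rderiv HT t0 g eK.
have [d2 d20 Hd2] := orbit_rderiv HT t0 g' eK.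
exists (Num.min d1 d2); first by rewrite lt_min d10.
move=> h /andP[h0]; rewrite lt_min => /andP[hd1 hd2].
have := Hd1 h; rewrite h0 hd1 => /(_ isT); have := Hd2 h; rewrite h0 hd2 => /(_ isT) h2 h1.
have gth : gen T (T (t + h) x) (T (t + h) y) by apply: gen_orbit => //; lra.
have gt : gen T (T t x) (T t y) by exact: gen_orbit.
have gt' : gen T (T t y) (T t y') by exact: gen_orbit.
have gZ := genB (genB gth gt) (genZ h gt').
have E1 : p (T (t + h) x - T t x - h%:C *: T t y) =
    p (T (t + h) x) - p (T t x) - h%:C *: p (T t y).
  by rewrite (pB (genB gth gt) (genZ h gt')) (pB gth gt) (pZ h gt').
have -> : ((T (t + h) x, p (T (t + h) x)) - (T t x, p (T t x)) -
    h%:C *: (T t y, p (T t y)) : (V * W)%type) =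
  (T (t + h) x - T t x - h%:C *: T t y, p (T (t + h) x) - p (T t x) - h%:C *: p (T t y)).
  by [].
rewrite rnorm_pair ge_max -E1; apply/andP; split.
  apply: (le_trans h1); rewrite ler_pM2r // ler_pdivrMr //.
  by rewrite ler_peMr // ltW.
apply: (le_trans (p_le' gZ)).
apply: (@le_trans _ _ (Cp * Cv * (e / K * h + e / K * h))).
  by apply: ler_wpM2l; [apply: mulr_ge0 => //; exact: ltW | lra].
have -> : Cp * Cv * (e / K * h + e / K * h) = (2 * Cp * Cv) / K * (e * h).
  by field; rewrite gt_eqF.
rewrite ler_piMl //; first by rewrite ltW // mulr_gt0.
by rewrite ler_pdivrMr // mul1r /K; lra.
Qed.

Let lift_lcontV x y (t : R) : gen T x y -> 0 < t ->
  lcontV (fun s => (T s x, p (T s x)) : (V * W)%type) t.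
Proof.
move=> g t0 e e0.
pose K := 2 * Cp * Cv + 1; have K1 : 1 <= K.
  by have := mulr_ge0 Cp0 (ltW Cv0); rewrite /K; lra.
have K0 : 0 < K by lra.
have eK : 0 < e / K by rewrite divr_gt0.
have [d1 d10 Hd1] := orbit_left cV HT x t0 eK.
have [d2 d20 Hd2] := orbit_left cV HT y t0 eK.
exists (Num.min t (Num.min d1 d2)); first by rewrite !lt_min t0 d10.
move=> h /andP[h0]; rewrite !lt_min => /and3P[ht hd1 hd2].
have := Hd1 h; rewrite h0 hd1 => /(_ isT); have := Hd2 h; rewrite h0 hd2 => /(_ isT) h2 h1.
have gth : gen T (T (t - h) x) (T (t - h) y) by apply: gen_orbit => //; lra.
have gt : gen T (T t x) (T t y) by apply: gen_orbit => //; lra.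
have -> : ((T t x, p (T t x)) - (T (t - h) x, p (T (t - h) x)) : (V * W)%type) =
  (T t x - T (t - h) x, p (T t x) - p (T (t - h) x)) by [].
rewrite rnorm_pair ge_max -(pB gt gth); apply/andP; split.
  apply: (le_trans h1); rewrite ler_pdivrMr //.
  by rewrite ler_peMr // ltW.
apply: (le_trans (p_le' (genB gt gth))).
apply: (@le_trans _ _ (Cp * Cv * (e / K + e / K))).
  by apply: ler_wpM2l; [apply: mulr_ge0 => //; exact: ltW | lra].
have -> : Cp * Cv * (e / K + e / K) = (2 * Cp * Cv) / K * e.
  by field; rewrite gt_eqF.
rewrite ler_piMl //; first by rewrite ltW.
by rewrite ler_pdivrMr // mul1r /K; lra.
Qed.

Let prim_le x y (B l : R) (F : R -> V) : gen T x y -> F 0 = 0 ->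
  primitive (fun t => T t x) B F -> 0 <= l -> l <= B -> rnorm (F l) <= l * (C1 * rnorm x).
Proof.
move=> g F0 HF l0 lB; have := HF 0 l (lexx _) l0 lB 0 (C1 * rnorm x).
rewrite F0 scaler0 !subr0; apply=> u /andP[u0 _].
by rewrite subr0; exact: orbit_le0 g u0.
Qed.

Let C2 := C1 + Cp * Cv * (2 * C1 + 1).

Let C2_ge : C1 <= C2 /\ Cp * Cv * (2 * C1 + 1) <= C2.
Proof.
have c1 : 0 <= C1 by exact: le_trans C1_ge1.
have c2 : 0 <= Cp * Cv * (2 * C1 + 1).
  by apply: mulr_ge0; [apply: mulr_ge0 => //; exact: ltW | rewrite addr_ge0 ?mulr_ge0].
by rewrite /C2 lerDl lerDr.
Qed.

(** Duhamel's formula for [TA] along the lift of [X s = T s (F l)], the orbit averaged over a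
    window of length [l]. The derivative of [X] is the difference of two values of the orbit
    of [x], so that the defect of the lift is controlled by [v] at three points. The sum of
    these is not small at every time, but by [q <= delta + q^2 / delta] its effect is at most
    [delta] plus the energy lost, divided by [delta]. The average is needed to have a
    lift that is differentiable. *)
Let window_decay x y (b l delta eps M B : R) (F : R -> V) :
  0 <= b -> 0 < l -> l <= 1 -> 0 < delta -> 0 < M -> 0 <= eps ->
  gen T x y -> F 0 = 0 -> primitive (fun t => T t x) B F -> l < B ->
  (forall u, rnorm (TA b u) <= eps * rnorm u) ->
  (forall t u, 0 <= t <= b -> rnorm (TA t u) <= M * rnorm u) ->
  rnorm (T b (F l)) <= eps * (C2 * rnorm x) + M * (Cp + 1) *
    (3 * delta * b + ((E x - E (T (b + l) x)) + (E (F l) - E (T (b + l) (F l)))) / (nu * delta)).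
Proof.
move=> b0 l0 l1 d0 M0 eps0 g F0 HF lB HTb HTM.
have nu1 := nu0; have Cp1 := Cp0; have Cv1 := Cv0; have C11 := C1_ge1.
have [_ T0 TD _] := HT; have [_ TA0 _ _] := HTA.
have l0' : 0 <= l < B by rewrite ltW.
have gX := primitive_gen cV HT F0 HF l0'.
set X0 := F l in gX *; set Y0 := T l x - x in gX *.
have gx t : 0 <= t -> gen T (T t x) (T t y) by move=> t0; exact: gen_orbit.
have gxl : gen T (T l x) (T l y) by apply: gx; exact: ltW.
have gY : gen T Y0 (T l y - y) by exact: genB.
pose z s : (V * W)%type := (T s X0, p (T s X0)).
pose dz s : (V * W)%type := (T s Y0, p (T s Y0)).
pose gz s : (V * W)%type := (T s Y0, v (T s X0)).
pose k s := rnorm (TA (b - s) (z s) - TA b (z 0)).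
pose q1 s := rnorm (v (T (s + l) x)); pose q2 s := rnorm (v (T s x)).
pose q3 s := rnorm (v (T s X0)).
have zT s : 0 <= s -> gen TA (z s) (gz s) by move=> s0; apply: ext; exact: gen_orbit.
have TY s : 0 <= s -> T s Y0 = T (s + l) x - T s x.
  by move=> s0; rewrite /Y0 linearB TD // ltW.
have defect s : 0 <= s -> rnorm (dz s - gz s) <= (Cp + 1) * (q1 s + q2 s + q3 s).
  move=> s0.
  have -> : dz s - gz s = (T s Y0 - T s Y0, p (T s Y0) - v (T s X0)) by [].
  have h1 : 0 <= q1 s by exact: rnorm_ge0.
  have h2 : 0 <= q2 s by exact: rnorm_ge0.
  have h3 : 0 <= q3 s by exact: rnorm_ge0.
  rewrite rnorm_pair subrr rnorm0 ge_max; apply/andP; split.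
    by rewrite mulr_ge0 // !addr_ge0.
  apply: (le_trans (rnormB _ _)).
  have sl : 0 <= s + l by lra.
  have := p_le (genB (gx _ sl) (gx _ s0)); rewrite -(TY _ s0) => h4.
  have h5 : rnorm (v (T s Y0)) <= q1 s + q2 s.
    by rewrite (TY _ s0) (vB (gx _ sl) (gx _ s0)); exact: rnormB.
  have := ler_wpM2l Cp1 h5; have := mulr_ge0 Cp1 h3.
  rewrite -/(q3 s); lra.
(* With this weight the loss of energy pays for the quadratic terms. *)
pose c := M * (Cp + 1) / (2 * nu * delta).
have MC0 : 0 < M * (Cp + 1) by rewrite mulr_gt0 //; lra.
have nd0 : 0 < 2 * nu * delta by rewrite !mulr_gt0.
have c0 : 0 < c by rewrite divr_gt0.
pose m := M * (Cp + 1) * (3 * delta).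
have : k b + c * (E (T (b + l) x) + E (T b x) + E (T b X0)) <=
    k 0 + c * (E (T (0 + l) x) + E (T 0 x) + E (T 0 X0)) + m * (b - 0).
  apply: (@slope_le _ (fun s => k s + c * (E (T (s + l) x) + E (T s x) + E (T s X0))) 0 b m b0) => s /andP[s0 sb].
  - have sb' : 0 <= s < b by rewrite s0.
    have Hz : rderiv z s (dz s) by exact: lift_rderiv gX gY s0.
    have r1 := duhamel_rslope HTA M0 HTM sb' Hz (zT s s0).
    have sl : 0 <= s + l by lra.
    have r2 := rslope_shift (orbit_rslope g sl).
    have r3 := orbit_rslope g s0; have r4 := orbit_rslope gX s0.
    have r5 := rslopeD r1 (rslopeZ (ltW c0) (rslopeD (rslopeD r2 r3) r4)).
    apply: rslopeW r5.
    rewrite -/(q1 s) -/(q2 s) -/(q3 s).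
    have y1 := young (q1 s) d0; have y2 := young (q2 s) d0; have y3 := young (q3 s) d0.
    have h1 : M * rnorm (dz s - gz s) <= M * ((Cp + 1) * (q1 s + q2 s + q3 s)).
      by rewrite ler_pM2l //; exact: defect.
    apply: (le_trans (lerD h1 (lexx _))).
    have -> : c * (- (2 * nu) * q1 s ^+ 2 + - (2 * nu) * q2 s ^+ 2 + - (2 * nu) * q3 s ^+ 2) =
       - (M * (Cp + 1)) * (q1 s ^+ 2 / delta + q2 s ^+ 2 / delta + q3 s ^+ 2 / delta).
      by rewrite /c; field; rewrite !gt_eqF.
    have h2 : M * (Cp + 1) * (q1 s + q2 s + q3 s) <=
       M * (Cp + 1) * (3 * delta + (q1 s ^+ 2 / delta + q2 s ^+ 2 / delta + q3 s ^+ 2 / delta)).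
      by rewrite ler_pM2l //; move: y1 y2 y3; lra.
    by move: h2; rewrite /m; lra.
  - have sl : 0 < s + l by lra.
    have sb' : 0 < s <= b by rewrite s0.
    apply: lcontD; first by apply: (duhamel_lcont HTA M0 HTM sb'); exact: lift_lcontV gX s0.
    apply: lcontZ; first exact: ltW.
    apply: lcontD; last exact: orbit_lcont.
    apply: lcontD; last exact: orbit_lcont.
    by apply: (lcont_shift (k := fun s => E (T s x))); exact: orbit_lcont.
have -> : k 0 = 0 by rewrite /k subr0 subrr rnorm0.
have kb : k b = rnorm (z b - TA b (z 0)) by rewrite /k subrr TA0.
rewrite kb !add0r !T0 subr0.
have d1 : E (T l x) <= E x by have := energy_decr g (lexx _) (ltW l0); rewrite T0.
have bl : b <= b + l by lra.
have d2 := energy_decr g b0 bl; have d3 := energy_decr gX b0 bl.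
have d4 : E (T b X0) <= E X0 by have := energy_decr gX (lexx _) b0; rewrite T0.
have h1 := rnorm_le_dist (z b) (TA b (z 0)).
have h2 : rnorm (T b X0) <= rnorm (z b) by rewrite rnorm_pair le_max lexx.
have x0 := rnorm_ge0 x.
have h3 : rnorm (z 0) <= C2 * rnorm x.
  have lX : rnorm X0 <= C1 * rnorm x.
    apply: (le_trans (prim_le g F0 HF (ltW l0) (ltW lB))).
    by rewrite ler_piMl // mulr_ge0 // (le_trans ler01).
  have lY : rnorm Y0 <= C1 * rnorm x + rnorm x.
    by apply: (le_trans (rnormB _ _)); rewrite lerD2r; exact: orbit_le0 g (ltW l0).
  rewrite rnorm_pair !T0 ge_max; apply/andP; split.
    by apply: (le_trans lX); rewrite ler_wpM2r //; case: C2_ge.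
  apply: (le_trans (p_le' gX)).
  have : Cp * Cv * (rnorm Y0 + rnorm X0) <= Cp * Cv * ((2 * C1 + 1) * rnorm x).
    apply: ler_wpM2l; first by apply: mulr_ge0 => //; exact: ltW.
    by rewrite mulrDl mul1r mulr_natl mulr2n mulrDl addrAC lerD.
  by move/le_trans; apply; rewrite mulrA ler_wpM2r //; case: C2_ge.
have h4 : rnorm (TA b (z 0)) <= eps * (C2 * rnorm x).
  by apply: (le_trans (HTb _)); rewrite ler_wpM2l.
move=> h5.
pose Dr := (E (T l x) - E (T (b + l) x)) + (E x - E (T b x)) + (E X0 - E (T b X0)).
have h6 : rnorm (z b - TA b (z 0)) <= c * Dr + m * b by exact: drop_rearrange h5.
have h7 : c * Dr <= c * (2 * ((E x - E (T (b + l) x)) + (E X0 - E (T (b + l) X0)))).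
  exact: drop_double (ltW c0) d1 d2 d3 d4.
have h8 : c * (2 * ((E x - E (T (b + l) x)) + (E X0 - E (T (b + l) X0)))) =
    M * (Cp + 1) * (((E x - E (T (b + l) x)) + (E X0 - E (T (b + l) X0))) / (nu * delta)).
  by rewrite /c; field; rewrite !gt_eqF.
have h9 : m * b = M * (Cp + 1) * (3 * delta * b) by rewrite /m; ring.
by rewrite mulrDr -h9 -h8; exact: chain_arith h2 h1 h4 h6 h7.
Qed.

(** If [|v|] were larger throughout the window, more energy than [D] would be lost. *)
Let good_time x y (b l delta D : R) : gen T x y -> 0 <= b -> 0 < l -> 0 < delta ->
  E (T b x) - E (T (b + l) x) <= D ->
  exists2 s, b <= s <= b + l & rnorm (v (T s x)) <= delta + D / (2 * nu * l * delta).
Proof.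
move=> g b0 l0 d0 HD; have nu1 := nu0.
have bl : b <= b + l by lra.
have D0 : 0 <= D by have := energy_decr g b0 bl; lra.
apply: contrapT => H.
have w0 : 0 < 2 * nu * l by rewrite !mulr_gt0.
pose q := delta + D / (2 * nu * l * delta).
have q0 : 0 < q by rewrite ltr_wpDr // divr_ge0 // ltW // mulr_gt0.
have vq s : b <= s <= b + l -> q < rnorm (v (T s x)).
  by move=> hs; rewrite ltNge; apply/negP => h; apply: H; exists s.
have : E (T (b + l) x) <= E (T b x) + (- (2 * nu) * q ^+ 2) * (b + l - b).
  apply: (@slope_le _ (fun s => E (T s x)) _ _ _ bl) => s /andP[s1 s2].
  - have s0 : 0 <= s by lra.
    apply: rslopeW (orbit_rslope g s0).
    have qv : q ^+ 2 <= rnorm (v (T s x)) ^+ 2.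
      rewrite ler_pXn2r ?nnegrE ?rnorm_ge0 ?(ltW q0) //.
      by apply/ltW/vq; apply/andP; split; lra.
    by rewrite ler_wnM2l //; lra.
  - by apply: orbit_lcont; lra.
have -> : b + l - b = l by ring.
have -> : - (2 * nu) * q ^+ 2 * l = - (2 * nu * l * delta ^+ 2 + 2 * D + D ^+ 2 / (2 * nu * l * delta ^+ 2)).
  by rewrite /q; field; rewrite !gt_eqF.
have : 0 < 2 * nu * l * delta ^+ 2 by rewrite mulr_gt0 // exprn_gt0.
have : 0 <= D ^+ 2 / (2 * nu * l * delta ^+ 2).
  by rewrite divr_ge0 ?sqr_ge0 // ltW // mulr_gt0 // exprn_gt0.
lra.
Qed.

(** Orbits move little while little energy is lost, uniformly over bounded sets of initial
    values although the generator is unbounded. For an increment [d], the functional [l]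
    attached to [d] changes along the orbit at a rate bounded in terms of the norm and of [|v|],
    and [|v|] costs energy; and [l d] controls the energy of [d]. *)
Let oscillation : exists2 C3 : R, 0 < C3 & forall x y (b l delta D s t : R),
  gen T x y -> 0 <= b -> 0 < l -> 0 < delta -> E (T b x) - E (T (b + l) x) <= D ->
  b <= s <= b + l -> b <= t <= b + l ->
  rnorm (T s x - T t x) <= C3 * (l * (C1 * rnorm x + delta) + D / (2 * nu * delta)
     + (rnorm (v (T s x)) + rnorm (v (T t x)))).
Proof.
have ca1 := ca0; have nu1 := nu0; have C11 := C1_ge1.
have eta0 : 0 < ca / 4 by lra.
have [K K0 HK] := weak eta0.
pose C3 := 1 + 4 * K / ca.
have C30 : 1 <= C3 by rewrite /C3; have := divr_ge0 (ltW K0) (ltW ca1); lra.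
exists C3; first lra.
move=> x y b l delta D s t g b0 l0 d0 HD hs ht.
set Q := l * (C1 * rnorm x + delta) + D / (2 * nu * delta).
have bl : b <= b + l by lra.
have D0 : 0 <= D by have := energy_decr g b0 bl; lra.
have nd0 : 0 < 2 * nu * delta by rewrite !mulr_gt0.
have x0 := rnorm_ge0 x.
have Cx0 : 0 <= C1 * rnorm x by rewrite mulr_ge0 //; lra.
have Q0 : 0 <= Q by rewrite addr_ge0 ?divr_ge0 // ?mulr_ge0 //; lra.
have gx r : 0 <= r -> gen T (T r x) (T r y) by move=> r0; exact: gen_orbit.
have [/andP[s1 s2] /andP[t1 t2]] := (hs, ht).
have s0 : 0 <= s by lra.
have t0 : 0 <= t by lra.
set d := T s x - T t x.
have gd : gen T d (T s y - T t y) by apply: genB; exact: gx.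
have [f [kf [fB fZ fk fL fd]]] := HK _ _ gd.
set N0 := rnorm d + rnorm (v d) in fL fd.
have N00 : 0 <= N0 by rewrite addr_ge0 ?rnorm_ge0.
have slow (c r1 r2 : R) : `|c| = 1 -> b <= r1 -> r1 <= r2 -> r2 <= b + l ->
    c * f (T r2 x) - c * f (T r1 x) <= K * N0 * Q.
  move=> c1 br r12 r2b.
  pose w := K * N0 / (2 * nu * delta).
  have KN0 : 0 <= K * N0 by rewrite mulr_ge0 // ltW.
  have w0 : 0 <= w by rewrite divr_ge0 // ltW.
  have : c * f (T r2 x) + w * E (T r2 x) <= c * f (T r1 x) + w * E (T r1 x) +
      K * N0 * (C1 * rnorm x + delta) * (r2 - r1).
    apply: (@slope_le _ (fun r => c * f (T r x) + w * E (T r x)) _ _ _ r12) => r /andP[h1 h2].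
    - have r0 : 0 <= r by lra.
      have hr : rderiv (fun r => T r x) r (T r y).
        by move=> e e0; exact: (orbit_rderiv HT r0 g e0).
      have r1' := rslope_lform c fB fZ fk hr.
      apply: rslopeW (rslopeD r1' (rslopeZ w0 (orbit_rslope g r0))).
      have h3 := fL _ _ (gx r r0).
      have h4 : c * f (T r y) <= K * (rnorm (T r x) + rnorm (v (T r x))) * N0.
        by apply: (le_trans (ler_norm _)); rewrite normrM c1 mul1r.
      set q := rnorm (v (T r x)) in h4 *.
      have h5 := orbit_le0 g r0; have h6 := young q d0.
      have -> : w * (- (2 * nu) * q ^+ 2) = - (K * N0) * (q ^+ 2 / delta).
        by rewrite /w; field; rewrite !gt_eqF.
      have h7 : K * N0 * (rnorm (T r x) + q) <= K * N0 * (C1 * rnorm x + (delta + q ^+ 2 / delta)).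
        by rewrite ler_wpM2l //; lra.
      lra.
    - apply: lcontD; last by apply: lcontZ => //; apply: orbit_lcont; lra.
      by apply: (lcont_lform c fB fk (f := fun r => T r x)); apply: orbit_lcontV; lra.
  have r10 : 0 <= r1 by lra.
  have r20 : 0 <= r2 by lra.
  have e1 := energy_decr g b0 br; have e2 := energy_decr g r20 r2b.
  have h1 : w * (E (T r1 x) - E (T r2 x)) <= w * D by rewrite ler_wpM2l //; lra.
  have h2 : w * D = K * N0 * (D / (2 * nu * delta)) by rewrite /w; ring.
  have h3 : K * N0 * (C1 * rnorm x + delta) * (r2 - r1) <= K * N0 * (C1 * rnorm x + delta) * l.
    by rewrite ler_wpM2l ?mulr_ge0 //; lra.
  rewrite /Q; lra.
have fdQ : f d <= K * N0 * Q.
  rewrite /d fB; have [st|ts] := leP s t.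
    have := slow (-1) s t; rewrite normrN1 !mulN1r => /(_ erefl s1 st t2); lra.
  have := slow 1 t s; rewrite normr1 !mul1r => /(_ erefl t1 (ltW ts) s2); lra.
have ad := a_ge d.
set qq := rnorm (v (T s x)) + rnorm (v (T t x)).
have vd : rnorm (v d) <= qq by rewrite /d (vB (gx _ s0) (gx _ t0)); exact: rnormB.
have qq0 : 0 <= qq by rewrite addr_ge0 ?rnorm_ge0.
apply: (oscillation_arith ca1 K0 Q0 qq0 (rnorm_ge0 d) (rnorm_ge0 (v d)) vd).
by apply: (le_trans ad); apply: (le_trans fd); rewrite lerD2r.
Qed.

Let drop_ge0 x y x' y' (t : R) : gen T x y -> gen T x' y' -> 0 <= t ->
  E x - E (T t x) <= (E x - E (T t x)) + (E x' - E (T t x')).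
Proof.
move=> g g' t0; have := energy_decr g' (lexx _) t0; have [_ -> _ _] := HT.
by move=> h; rewrite lerDl subr_ge0.
Qed.

(** [F (b + l) - F b] is the average [T b (F l)], small by [window_decay]. It is also close to
    [l] times the orbit at a good time of the window, because [F] moves with the velocity of
    the orbit, which [oscillation] keeps close to that value. *)
Let main_estimate : exists2 C : R, 0 < C & forall b l eps M : R,
  0 <= b -> 0 < l -> l <= 1 -> 0 <= eps -> 0 < M ->
  (forall u, rnorm (TA b u) <= eps * rnorm u) ->
  (forall t u, 0 <= t <= b -> rnorm (TA t u) <= M * rnorm u) ->
  exists2 A : R, 0 < A & forall x y (B delta : R) (F : R -> V), 0 < delta ->
  gen T x y -> F 0 = 0 -> primitive (fun t => T t x) B F -> b + l < B ->
  l * rnorm (T (b + l) x) <= C * (eps + l ^+ 2) * rnorm x +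
    A * (delta + ((E x - E (T (b + l) x)) + (E (F l) - E (T (b + l) (F l)))) / delta).
Proof.
have [C3 C30 HC3] := oscillation.
have [c12 c2'] := C2_ge.
have C10 : 0 < C1 by exact: lt_le_trans C1_ge1.
have C20 : 0 < C2 by exact: lt_le_trans c12.
have [Cp1 nu1] : 0 <= Cp /\ 0 < nu by [].
exists (C1 * (C2 + C3 * C1)); first by rewrite mulr_gt0 // addr_gt0 // mulr_gt0.
move=> b l eps M b0 l0 l1 eps0 M0 HTb HTM.
pose A1 := C1 * (3 * M * (Cp + 1) * b + C3 * l * (l + 2)).
pose A2 := C1 * (M * (Cp + 1) / nu + C3 / nu + C3 * l / (2 * nu)).
have Cp10 : 0 < Cp + 1 by rewrite ltr_wpDl.
have A10 : 0 < A1.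
  rewrite mulr_gt0 // ltr_wpDl ?mulr_ge0 ?(ltW M0) ?(ltW Cp10) //.
  by rewrite !mulr_gt0 // addr_gt0.
have A20 : 0 < A2.
  by rewrite mulr_gt0 // !addr_gt0 // divr_gt0 ?mulr_gt0.
exists (A1 + A2); first exact: addr_gt0.
move=> x y B delta F d0 g F0 HF bB.
have bl0 : 0 <= b + l by rewrite addr_ge0 // ltW.
have lB : l < B by apply: le_lt_trans bB; rewrite lerDr.
have gX := primitive_gen cV HT F0 HF (_ : 0 <= l < B).
have {}gX : gen T (F l) (T l x - x) by apply: gX; rewrite lB ltW.
set D := (_ - _) + _.
have HD : E (T b x) - E (T (b + l) x) <= D.
  apply: le_trans (drop_ge0 g gX bl0); rewrite lerD2r.
  by have := energy_decr g (lexx _) b0; have [_ -> _ _] := HT.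
have D0 : 0 <= D.
  by apply: le_trans HD; rewrite subr_ge0; apply: energy_decr g b0 _; rewrite lerDl ltW.
have [s hs vs] := good_time g b0 l0 d0 HD.
set z := T s x.
set Q := l * (C1 * rnorm x + delta) + D / (2 * nu * delta).
set q := delta + D / (2 * nu * l * delta) in vs.
have nd0 : 0 < 2 * nu * delta by rewrite !mulr_gt0.
pose c := C3 / (2 * nu * delta); have c0 : 0 <= c by rewrite divr_ge0 // ltW.
pose f t := F t - (F b - b%:C *: z + t%:C *: z).
have bl : b <= b + l by rewrite lerDl ltW.
have : rnorm (f (b + l) - 0) + c * E (T (b + l) x) <=
    rnorm (f b - 0) + c * E (T b x) + C3 * (Q + delta + q) * (b + l - b).
  apply: (@slope_le _ (fun t => rnorm (f t - 0) + c * E (T t x)) _ _ _ bl) => t /andP[t1 t2].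
  - have t0 : 0 <= t by exact: le_trans t1.
    have tB : 0 <= t < B by rewrite t0 (lt_trans t2).
    have Hf : rderiv f t (T t x - z).
      apply: rderivB; last exact: rderiv_line.
      by move=> e e0; exact: (primitive_right cV HT HF tB e0).
    apply: rslopeW (rslopeD (rslope_rnorm 0 Hf) (rslopeZ c0 (orbit_rslope g t0))).
    have ht : b <= t <= b + l by rewrite t1 ltW.
    have h1 := HC3 _ _ _ _ _ _ t s g b0 l0 d0 HD ht hs.
    have h2 := young (rnorm (v (T t x))) d0.
    rewrite -/Q -/z in h1.
    have -> : c * (- (2 * nu) * rnorm (v (T t x)) ^+ 2) = - (C3 * (rnorm (v (T t x)) ^+ 2 / delta)).
      by rewrite /c; field; rewrite !gt_eqF.
    rewrite lerBlDr; apply: (le_trans h1); rewrite -mulrDr ler_wpM2l ?(ltW C30) //.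
    exact: rate_arith h2 vs.
  - have t0 : 0 < t by exact: le_lt_trans t1.
    have tB : 0 < t <= B by rewrite t0 (le_trans t2) // ltW.
    apply: lcontD; last by apply: lcontZ => //; exact: orbit_lcont.
    apply: lcont_rnorm; apply: lcontVB; last exact: lcontV_line.
    by move=> e e0; exact: (primitive_left cV HT HF tB e0).
have -> : f b = 0 by rewrite /f; zmod.
have Xb : T b (F l) = F (b + l) - F b.
  by rewrite (primitive_shift cV HT F0 HF (ltW l0) b0) [l + b]addrC // ltW.
have -> : f (b + l) = T b (F l) - l%:C *: z.
  by rewrite Xb /f rmorphD scalerDl; zmod.
rewrite subr0 subrr rnorm0 add0r [b + l - b]addrAC subrr add0r => h1.
have h2 := window_decay b0 l0 l1 d0 M0 eps0 g F0 HF lB HTb HTM.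
rewrite -/D in h2.
have h3 : l * rnorm z <= rnorm (T b (F l)) + rnorm (T b (F l) - l%:C *: z).
  by have := rnorm_le_dist (l%:C *: z) (T b (F l)); rewrite rnormZ gtr0_norm // rnorm_distC.
have h4 : rnorm (T (b + l) x) <= C1 * rnorm z.
  by have /andP[s1 s2] := hs; apply: orbit_le g _ s2; exact: le_trans s1.
have h5 : c * E (T b x) - c * E (T (b + l) x) <= c * D by rewrite -mulrBr ler_wpM2l.
have h6 : l * rnorm (T (b + l) x) <= C1 * (l * rnorm z).
  by rewrite mulrCA ler_wpM2l // ltW.
apply: (le_trans h6).
have h7 : l * rnorm z <= eps * (C2 * rnorm x) + M * (Cp + 1) * (3 * delta * b + D / (nu * delta))
    + (c * D + C3 * (Q + delta + q) * l).
  apply: (le_trans h3); apply: lerD h2 _.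
  exact: budget_arith h1 h5.
apply: (le_trans (ler_wpM2l (ltW C10) h7)).
have -> : C1 * (eps * (C2 * rnorm x) + M * (Cp + 1) * (3 * delta * b + D / (nu * delta))
    + (c * D + C3 * (Q + delta + q) * l)) =
  C1 * C2 * rnorm x * eps + C1 * C3 * C1 * rnorm x * l ^+ 2 + A1 * delta + A2 * (D / delta).
  by rewrite /A1 /A2 /c /Q /q; field; rewrite !gt_eqF.
apply: final_arith => //.
- by rewrite !mulr_ge0 ?rnorm_ge0 // ltW.
- by rewrite !mulr_ge0 ?rnorm_ge0 // ltW.
- exact: sqr_ge0.
- by rewrite ltW.
- by rewrite ltW.
- by rewrite ltW.
- by rewrite divr_ge0 // ltW.
- by ring.
Qed.

Hypothesis TA_stable : forall eps : R, 0 < eps ->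
  exists2 b : R, 0 <= b & forall u, rnorm (TA b u) <= eps * rnorm u.

(** If the energy lost up to time [b + l] is a small fraction of the squared norm, then
    [main_estimate] with [delta] proportional to the norm makes the orbit so small at that
    time that half of the energy has been lost after all. The energy of the average
    enters because its loss occurs in the estimate. *)
Let decay_step : exists b l th : R, [/\ 0 < b, 0 < l, l <= 1 /\ l <= b, 0 < th < 1 &
  forall x y (B : R) (F : R -> V), gen T x y -> F 0 = 0 ->
    primitive (fun t => T t x) B F -> b < B ->
    E (T b x) + E (T b (F l)) <= th * (E x + E (F l))].
Proof.
have [C C0 HC] := main_estimate.
have [ca1 Ca1] : 0 < ca /\ 0 <= Ca by [].
have C10 : 0 < C1 by exact: lt_le_trans C1_ge1.
have Ca10 : 0 < Ca + 1 by rewrite ltr_wpDl.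
(* Shrinking the norm by [rho] leaves at most half of the lower bound for the energy. *)
pose rho := Num.min 1 (ca / (2 * (Ca + 1))).
have rho0 : 0 < rho by rewrite lt_min ltr01 divr_gt0 // mulr_gt0.
have rhoE : Ca * rho ^+ 2 <= ca / 2.
  apply: (@le_trans _ _ ((Ca + 1) * rho)).
    rewrite expr2 mulrA ler_pM2r //; apply: (@le_trans _ _ (Ca * 1)).
      by rewrite ler_wpM2l // ge_min lexx.
    by rewrite mulr1 lerDl.
  rewrite mulrC -ler_pdivlMr // -mulrA -invfM ge_min; apply/orP; right.
  by [].
(* [l] and [eps] make the first term of [main_estimate] at most a quarter of
   [l * rho * n0]; [b] and then [A] depend on them. *)
pose l := Num.min 1 (rho / (8 * C)).
have C80 : 0 < 8 * C by rewrite mulr_gt0.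
have l0 : 0 < l by rewrite lt_min ltr01 divr_gt0.
have l1 : l <= 1 by rewrite ge_min lexx.
have lC : C * l <= rho / 8.
  have : l <= rho / (8 * C) by rewrite ge_min lexx orbT.
  by rewrite ler_pdivlMr // ler_pdivlMr // (_ : l * (8 * C) = C * l * 8) //; ring.
pose eps := l * rho / (8 * C).
have eps0 : 0 < eps by rewrite divr_gt0 // mulr_gt0.
have Cel : C * (eps + l ^+ 2) <= l * rho / 4.
  rewrite mulrDr; have -> : C * eps = l * rho / 8 by rewrite /eps; field; rewrite gt_eqF.
  have : l * (C * l) <= l * (rho / 8) by rewrite ler_pM2l.
  exact: eighth_arith.
have [b b0 HTb] := TA_stable eps0.
have [M M0 HM] := semigroup_bounded_on cVW HTA b0.
have [A A0 HA] := HC b l eps M b0 l0 l1 (ltW eps0) M0 HTb (fun t u => HM t u).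
(* [delta] will be [d0 * n0], so that [A * delta] is another quarter. *)
pose d0 := l * rho / (4 * A).
have d00 : 0 < d0 by rewrite divr_gt0 // mulr_gt0.
pose c := l * rho * d0 / (2 * A).
have c0 : 0 < c.
  by apply: divr_gt0; [apply: mulr_gt0 => //; exact: mulr_gt0 | exact: mulr_gt0].
pose c' := Num.min c (ca / 2).
have c'0 : 0 < c' by rewrite lt_min c0 divr_gt0.
pose K := Ca * (1 + C1 ^+ 2) + ca.
have K0 : 0 < K by rewrite ltr_wpDl // mulr_ge0 // addr_ge0 // sqr_ge0.
have c'K : c' < K.
  apply: (@lt_le_trans _ _ ca).
    by rewrite gt_min; apply/orP; right; rewrite ltr_pdivrMr // ltr_pMr // ltr1n.
  by rewrite lerDr mulr_ge0 // addr_ge0 // sqr_ge0.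
exists (b + l), l, (1 - c' / K); split=> //.
- by rewrite ltr_wpDl.
- by split=> //; rewrite lerDr.
- by rewrite subr_gt0 ltr_pdivrMr // mul1r c'K gtrBl divr_gt0.
move=> x y B F g F0 HF bB.
have bl0 : 0 <= b + l by rewrite addr_ge0 // ltW.
have lB : l < B by apply: le_lt_trans bB; rewrite lerDr.
have gX : gen T (F l) (T l x - x).
  by apply: (primitive_gen cV HT F0 HF); rewrite lB ltW.
set n0 := rnorm x.
set D := (E x - E (T (b + l) x)) + (E (F l) - E (T (b + l) (F l))).
have D0 : E x - E (T (b + l) x) <= D by exact: drop_ge0 g gX bl0.
have Dn : c' * n0 ^+ 2 <= D.
  have [n00|n0n] := eqVneq n0 0.
    rewrite n00 expr0n mulr0; apply: le_trans D0; rewrite subr_ge0.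
    by have := energy_decr g (lexx _) bl0; have [_ -> _ _] := HT.
  have np : 0 < n0 by rewrite lt_neqAle eq_sym n0n rnorm_ge0.
  have dp : 0 < d0 * n0 by rewrite mulr_gt0.
  have := HA x y B (d0 * n0) F dp g F0 HF bB; rewrite -/D -/n0 => h1.
  have [Dc|cD] := leP (c * n0 ^+ 2) D.
    by apply: le_trans Dc; rewrite ler_wpM2r ?sqr_ge0 // ge_min lexx.
  have h2 : A * (D / (d0 * n0)) <= l * rho * n0 / 2.
    have -> : l * rho * n0 / 2 = A * (c * n0 ^+ 2 / (d0 * n0)).
      by rewrite /c; field; rewrite !gt_eqF.
    by rewrite ler_pM2l // ler_pM2r ?invr_gt0 // ltW.
  have h3 : A * (d0 * n0) = l * rho * n0 / 4 by rewrite /d0; field; rewrite gt_eqF.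
  have h4 : C * (eps + l ^+ 2) * n0 <= l * rho / 4 * n0 by rewrite ler_wpM2r // ltW.
  have h5 : l * rnorm (T (b + l) x) <= l * (rho * n0).
    by rewrite (mulrDr A) in h1; exact: quarter_arith h1 h4 h3 h2.
  have {}h5 : rnorm (T (b + l) x) <= rho * n0 by rewrite -(ler_pM2l l0).
  have h6 : E (T (b + l) x) <= ca / 2 * n0 ^+ 2.
    apply: (le_trans (E_le _)); apply: (@le_trans _ _ (Ca * (rho * n0) ^+ 2)).
      by rewrite ler_wpM2l // ler_pXn2r ?nnegrE ?rnorm_ge0 // ltW // mulr_gt0.
    by rewrite exprMn mulrA ler_wpM2r ?sqr_ge0.
  apply: le_trans D0; apply: (@le_trans _ _ (ca / 2 * n0 ^+ 2)).
    by rewrite ler_wpM2r ?sqr_ge0 // ge_min lexx orbT.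
  exact: half_arith (a_ge x) h6.
have e0 : E x + E (F l) <= K * n0 ^+ 2.
  have h1 : rnorm (F l) <= C1 * n0.
    apply: (le_trans (prim_le g F0 HF (ltW l0) (ltW lB))).
    by rewrite ler_piMl // mulr_ge0 ?rnorm_ge0 // ltW.
  have h2 : E (F l) <= Ca * (C1 * n0) ^+ 2.
    apply: (le_trans (E_le _)); rewrite ler_wpM2l // ler_pXn2r ?nnegrE ?rnorm_ge0 //.
    by rewrite mulr_ge0 ?rnorm_ge0 // ltW.
  apply: (le_trans (lerD (E_le x) h2)).
  have -> : K * n0 ^+ 2 = Ca * n0 ^+ 2 + Ca * (C1 * n0) ^+ 2 + ca * n0 ^+ 2 by rewrite /K; ring.
  by rewrite lerDl mulr_ge0 ?sqr_ge0 // ltW.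
have h1 : c' / K * (E x + E (F l)) <= c' * n0 ^+ 2.
  by rewrite mulrAC ler_pdivrMr // -mulrA ler_pM2l // mulrC.
rewrite mulrBl mul1r; exact: theta_arith Dn h1.
Qed.

(** The primitive of a shifted orbit is the shifted primitive up to a constant, so that one
    primitive on a long interval serves all steps. *)
Let decay_iter : exists b K th : R, [/\ 0 < b, 0 < K, 0 < th < 1 &
  forall (n : nat) x y, gen T x y -> rnorm (T (n%:R * b) x) ^+ 2 <= th ^+ n * K * rnorm x ^+ 2].
Proof.
have [b [l [th [b0 l0 [l1 lb] th01 Hstep]]]] := decay_step.
have [ca1 Ca1] : 0 < ca /\ 0 <= Ca by [].
have C10 : 0 < C1 by exact: lt_le_trans C1_ge1.
have /andP[th0 th1] := th01.
pose K0 := Ca * (1 + C1 ^+ 2); have K00 : 0 <= K0 by rewrite mulr_ge0 // addr_ge0 // sqr_ge0.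
exists b, (K0 / ca + 1), th; split=> //; first by rewrite ltr_wpDl // divr_ge0 // ltW.
move=> n x y g.
pose B := n.+2%:R * b.
have B0 : 0 < B by rewrite mulr_gt0 // ltr0n.
have [F F0 HF] := orbit_primitive_exists cV HT x B0.
have [_ T0 TD _] := HT.
have kb0 k : 0 <= k%:R * b by rewrite mulr_ge0 // ltW.
have main k : (k <= n)%N ->
    E (T (k%:R * b) x) + E (T (k%:R * b) (F l)) <= th ^+ k * (E x + E (F l)).
  elim: k => [|k IH] kn; first by rewrite mul0r !T0 expr0 mul1r.
  have {}IH := IH (ltnW kn).
  pose r := k%:R * b; pose G t := F (t + r) - F r.
  have r0 : 0 <= r by exact: kb0.
  have rB : r + 2 * b <= B.
    by rewrite -mulrDl ler_pM2r // -natrD ler_nat addn2 !ltnS ltnW.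
  have G0 : G 0 = 0 by rewrite /G add0r subrr.
  have HG : primitive (fun t => T t (T r x)) (2 * b) G.
    move=> s t s0 st tb w e Hw.
    have -> : G t - G s - (t - s)%:C *: w = F (t + r) - F (s + r) - (t + r - (s + r))%:C *: w.
      have -> : t + r - (s + r) = t - s by ring.
      by rewrite /G; zmod.
    have -> : t - s = t + r - (s + r) by ring.
    apply: HF; rewrite ?addr_ge0 ?lerD2r //.
      by apply: le_trans rB; rewrite addrC lerD2l.
    move=> u /andP[su ut].
    have ur : 0 <= u - r by rewrite subr_ge0 (le_trans _ su) // lerDr.
    have -> : T u x = T (u - r) (T r x) by rewrite -TD // subrK.
    by apply: Hw; rewrite lerBrDr su lerBlDr.
  have b2 : b < 2 * b by rewrite ltr_pMl // ltr1n.
  have lrB : l + r <= B.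
    by apply: le_trans rB; rewrite addrC lerD2l (le_trans lb) // ltW.
  have GE : G l = T r (F l) by rewrite (primitive_shift cV HT F0 HF (ltW l0) r0 lrB).
  have := Hstep _ _ _ _ (gen_orbit HT r0 g) G0 HG b2.
  rewrite GE -!TD ?(ltW b0) //.
  have -> : b + r = k.+1%:R * b by rewrite /r -natr1; ring.
  move/le_trans; apply; rewrite exprS -mulrA ler_pM2l //.
have := main n (leqnn n).
have lB : l <= B.
  apply: (le_trans lb); rewrite /B -[leLHS]mul1r ler_pM2r // ler1n.
  by [].
have h1 : rnorm (F l) <= C1 * rnorm x.
  apply: (le_trans (prim_le g F0 HF (ltW l0) lB)).
  by rewrite ler_piMl // mulr_ge0 ?rnorm_ge0 // ltW.
have h2 : E x + E (F l) <= K0 * rnorm x ^+ 2.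
  have h2 : E (F l) <= Ca * (C1 * rnorm x) ^+ 2.
    apply: (le_trans (E_le _)); rewrite ler_wpM2l // ler_pXn2r ?nnegrE ?rnorm_ge0 //.
    by rewrite mulr_ge0 ?rnorm_ge0 // ltW.
  apply: (le_trans (lerD (E_le x) h2)).
  by rewrite (_ : K0 * _ = Ca * rnorm x ^+ 2 + Ca * (C1 * rnorm x) ^+ 2) // /K0; ring.
move=> h3.
have h4 : ca * rnorm (T (n%:R * b) x) ^+ 2 <= th ^+ n * (K0 * rnorm x ^+ 2).
  apply: (le_trans (a_ge _)); rewrite -[a _ _]addr0.
  apply: (le_trans (lerD (lexx _) (a_ge0 (T (n%:R * b) (F l))))); apply: (le_trans h3).
  by rewrite ler_wpM2l // exprn_ge0 // ltW.
rewrite -(ler_pM2l ca1); apply: (le_trans h4).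
have -> : ca * (th ^+ n * (K0 / ca + 1) * rnorm x ^+ 2) =
  th ^+ n * (K0 * rnorm x ^+ 2) + ca * (th ^+ n * rnorm x ^+ 2) by field; rewrite gt_eqF.
rewrite lerDl; apply: mulr_ge0; first exact: ltW.
by apply: mulr_ge0; [apply: exprn_ge0; exact: ltW | exact: sqr_ge0].
Qed.

(** The decay along orbits starting in the domain extends to all vectors by density. *)
Lemma semigroup_stable : forall eps : R, 0 < eps ->
  exists2 t0 : R, 0 <= t0 & forall t x, t0 <= t -> rnorm (T t x) <= eps * rnorm x.
Proof.
move=> eps eps0.
have [b [K [th [b0 K0 /andP[th0 th1] Hit]]]] := decay_iter.
have C10 : 0 < C1 by exact: lt_le_trans C1_ge1.
pose e1 := eps / C1; have e10 : 0 < e1 by rewrite divr_gt0.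
have [n Hn] : exists n : nat, th ^+ n * K <= e1 ^+ 2.
  have e2 : 0 < e1 ^+ 2 / K by rewrite divr_gt0 // exprn_gt0.
  have thn : `|th| < 1 by rewrite gtr0_norm.
  have /cvgrPdist_le /(_ _ e2) [n _ /(_ n (leqnn n))] := cvg_expr thn.
  rewrite /= sub0r normrN ger0_norm ?exprn_ge0 ?(ltW th0) // ler_pdivlMr // => h.
  by exists n.
have nb0 : 0 <= n%:R * b by rewrite mulr_ge0 // ltW.
exists (n%:R * b) => // t x nbt.
have dom x' y : gen T x' y -> rnorm (T t x') <= eps * rnorm x'.
  move=> g; apply: (le_trans (orbit_le g nb0 nbt)).
  have -> : eps = C1 * e1 by rewrite /e1 mulrC divfK // gt_eqF.
  have re : 0 <= e1 * rnorm x' by apply: mulr_ge0; [exact: ltW | exact: rnorm_ge0].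
  rewrite -mulrA ler_pM2l // -(@ler_pXn2r _ 2) ?nnegrE ?rnorm_ge0 //.
  by apply: (le_trans (Hit n _ _ g)); rewrite exprMn ler_wpM2r ?sqr_ge0.
have t0 : 0 <= t by exact: le_trans nbt.
have [M M0 HM] := semigroup_bounded HT t0.
apply/ler_addgt0Pr => e e0.
pose e' := e / (M + eps); have Me : 0 < M + eps by rewrite addr_gt0.
have e'0 : 0 < e' by rewrite divr_gt0.
have [w [y [g hx]]] := gen_dense cV HT x e'0.
have h1 := dom _ _ g; have h2 := HM (x - w).
rewrite linearB in h2.
have h3 := rnorm_le_dist (T t x) (T t w).
have h4 := rnorm_le_dist w x.
have h5 : M * rnorm (x - w) <= M * e' by rewrite ler_pM2l // rnorm_distC.
have h6 : eps * rnorm w <= eps * (rnorm x + e').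
  by rewrite ler_pM2l //; apply: (le_trans h4); rewrite lerD2l.
have h7 : e = M * e' + eps * e' by rewrite -mulrDl /e' mulrC divfK // gt_eqF.
exact: density_arith h1 h2 h3 h5 h6 h7.
Qed.
End stability.

(** * Exponential stability in terms of vectors *)

Section operator_norm.
Context (R : realType) (V : normedModType R[i]).

Lemma opnorm_ge0 (B : {linear V -> V}) (c : R) :
  (forall x, rnorm (B x) <= c * rnorm x) -> 0 <= c -> 0 <= opnorm B <= c.
Proof.
move=> HB c0; rewrite /opnorm; set A := [set _ | _].
have A0 : A 0 by exists 0; rewrite ?normr0 ?ler01 // linear0 normr0.
have Ac : ubound A c.
  move=> _ [x x1 ->]; apply: (le_trans (HB x)).
  have : rnorm x <= 1 by rewrite -lecR -normrE.
  by move=> h; rewrite ler_piMr.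
apply/andP; split; last by apply: ge_sup => //; exists 0.
by apply: ub_le_sup => //; exists c.
Qed.

Lemma rnorm_le_opnorm (B : {linear V -> V}) x : continuous B ->
  rnorm (B x) <= opnorm B * rnorm x.
Proof.
move=> cB; have [M M0 HM] := linear_bounded cB.
have [->|x0] := eqVneq x 0; first by rewrite linear0 !rnorm0 mulr0.
have nx : 0 < rnorm x.
  rewrite lt_neqAle rnorm_ge0 andbT; apply/eqP => /esym /rnorm_eq0 h.
  by move: x0; rewrite h eqxx.
have : rnorm (B ((rnorm x)^-1%:C *: x)) <= opnorm B.
  apply: ub_le_sup.
    exists M => _ [y y1 ->]; apply: (le_trans (HM y)).
    have h : rnorm y <= 1 by rewrite -lecR -normrE.
    by rewrite ler_piMr // ltW.
  exists ((rnorm x)^-1%:C *: x) => //.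
  by rewrite normrE rnormZ gtr0_norm ?invr_gt0 // mulVf ?gt_eqF.
rewrite linearZ rnormZ gtr0_norm ?invr_gt0 //.
by rewrite mulrC ler_pdivrMr.
Qed.

(** Bounds on all vectors replace the operator norm, which is a supremum that exists
    only for bounded operators. *)
Lemma exponentially_stableP (T : R -> {linear V -> V}) : C0_semigroup T ->
  exponentially_stable T <->
  forall eps : R, 0 < eps -> exists2 t0 : R, 0 <= t0 &
    forall t x, t0 <= t -> rnorm (T t x) <= eps * rnorm x.
Proof.
case=> cT _ _ _; split=> [/cvgrPdist_le H eps eps0 | H].
- have [M [_ HM]] := H _ eps0; exists (Num.max 0 (M + 1)); first by rewrite le_max lexx.
  move=> t x; rewrite ge_max => /andP[t0 Mt].
  apply: (le_trans (rnorm_le_opnorm x (cT t t0))); rewrite ler_wpM2r ?rnorm_ge0 //.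
  have := HM t; rewrite sub0r normrN => h; apply: le_trans (ler_norm _) _; apply: h.
  by apply: lt_le_trans Mt; rewrite ltrDl.
- apply/cvgrPdist_le => eps eps0; have [t0 t00 Ht0] := H _ eps0.
  exists t0; split; first exact: num_real.
  move=> t tt0; rewrite sub0r normrN.
  have /andP[h1 h2] := @opnorm_ge0 (T t) eps (fun x => Ht0 t x (ltW tt0)) (ltW eps0).
  by rewrite ger0_norm.
Qed.

End operator_norm.

(** * Integrals on the unit interval *)

Section unit_interval_integrals.
Context (R : realType).
Local Notation mu := (@lebesgue_measure R).
Local Notation I01 := (`]0%R, 1%R[%classic : set R).
Implicit Types (f g : R -> R).

Definition int01 f : Prop := mu.-integrable I01 (EFin \o f).

Lemma int01_meas f : int01 f -> measurable_fun I01 f.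
Proof. by move=> /measurable_int /measurable_EFinP. Qed.

Lemma int01D f g : int01 f -> int01 g -> int01 (fun x => f x + g x).
Proof. by move=> hf hg; apply: (integrableD _ hf hg); exact: measurable_itv. Qed.

Lemma int01Z c f : int01 f -> int01 (fun x => c * f x).
Proof. by move=> hf; apply: (integrableZl _ c hf); exact: measurable_itv. Qed.

Lemma int01B f g : int01 f -> int01 g -> int01 (fun x => f x - g x).
Proof. by move=> hf hg; apply: (integrableB _ hf hg); exact: measurable_itv. Qed.

Lemma int01_le f g : measurable_fun I01 f -> (forall x, I01 x -> `|f x| <= g x) ->
  int01 g -> int01 f.
Proof.
move=> mf fg; apply: le_integrable => //; first exact/measurable_EFinP.
move=> x Ix; rewrite /= lee_fin; exact: le_trans (fg x Ix) (ler_norm _).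
Qed.

Lemma int01_cst c : int01 (fun=> c).
Proof.
apply/integrableP; split; first exact/measurable_EFinP.
rewrite integral_cst //= lebesgue_measure_itv /= lte_fin ltr01 oppr0 adde0 mule1.
exact: ltry.
Qed.

Lemma int01_norm f : int01 f -> int01 (fun x => `|f x|).
Proof.
move=> hf; apply: (le_integrable _ _ _ hf) => //.
  by apply/measurable_EFinP; apply: measurableT_comp; [exact: normr_measurable | exact: int01_meas].
by move=> x Ix /=; rewrite normr_id.
Qed.

Lemma int01_sub f (t : R) : t <= 1 -> int01 f -> mu.-integrable `]0, t[ (EFin \o f).
Proof.
move=> t1; apply: integrableS => //.
by apply: subset_itvl; rewrite bnd_simp.
Qed.

Definition prim f (t : R) : R := \int[mu]_(x in `]0, t[) f x.

(** Extension by zero, to apply Fubini's theorem on the whole line. *)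
Definition cut (t : R) f : R -> R := f \_ `]0, t[.

Lemma cutE (u : R) h x : cut u h x = h x * ((0 < x < u)%R)%:R.
Proof. by rewrite /cut patchE mem_setE in_itv /=; case: ifP => _; rewrite ?mulr1 ?mulr0. Qed.

Lemma cut_integrable t f : t <= 1 -> int01 f -> mu.-integrable setT (EFin \o cut t f).
Proof.
move=> t1 hf; rewrite -restrict_EFin; apply/integrable_restrict => //.
by rewrite setTI; exact: int01_sub.
Qed.

Lemma prim_cut f t : prim f t = \int[mu]_x cut t f x.
Proof. by rewrite /prim Rintegral_mkcond. Qed.

Lemma prim_fin f t : t <= 1 -> int01 f ->
  (\int[mu]_x (cut t f x)%:E)%E = (prim f t)%:E.
Proof.
move=> t1 hf; rewrite prim_cut /Rintegral fineK //.
by apply: integrable_fin_num => //; exact: cut_integrable.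
Qed.

(** The product is the integral of [f x * g y] over a square; the diagonal cuts it into two
    triangles, and Fubini's theorem evaluates one of them in both orders. *)
Lemma prim_mul f g t : 0 <= t -> t <= 1 -> int01 f -> int01 g ->
  mu.-integrable `]0, t[ (EFin \o (fun x => f x * prim g x)) ->
  mu.-integrable `]0, t[ (EFin \o (fun x => prim f x * g x)) ->
  prim f t * prim g t = prim (fun x => f x * prim g x) t + prim (fun x => prim f x * g x) t.
Proof.
move=> t0 t1 hf hg hfg hgf.
pose F := cut t f; pose G := cut t g.
have iF := cut_integrable t1 hf; have iG := cut_integrable t1 hg.
have mF : measurable_fun setT F by move/measurable_int/measurable_EFinP: iF.
have mG : measurable_fun setT G by move/measurable_int/measurable_EFinP: iG.
pose D : set (R * R) := [set z | z.1 <= z.2].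
have mD : measurable D.
  have := measurable_fun_ler (@measurable_fst _ _ R R) (@measurable_snd _ _ R R) measurableT.
  by move=> /(_ [set true] I); rewrite setTI /preimage /=.
pose k (z : R * R) : R := F z.1 * G z.2 * \1_D z.
have mk : measurable_fun setT (EFin \o k).
  apply/measurable_EFinP; apply: measurable_funM; last exact: measurable_indic.
  by apply: measurable_funM; [exact: measurableT_comp mF (measurable_fst) |
    exact: measurableT_comp mG (measurable_snd)].
have mabs : measurable_fun setT (fun z => `|(EFin \o k) z|)%E.
  by apply: measurableT_comp.
have nF : measurable_fun setT (fun x => `|F x|%:E).
  by apply/measurable_EFinP; apply: measurableT_comp.
have nG : measurable_fun setT (fun x => `|G x|%:E).
  by apply/measurable_EFinP; apply: measurableT_comp.
have finG : (\int[mu]_y `|G y|%:E < +oo)%E by move/integrableP : iG => [].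
have finF : (\int[mu]_y `|F y|%:E < +oo)%E by move/integrableP : iF => [].
have ik : (mu \x mu)%E.-integrable setT (EFin \o k).
  apply: (integrable12ltyP mu mu mk).2.
  apply: (@le_lt_trans _ _ (\int[mu]_x (`|F x|%:E * \int[mu]_y `|G y|%:E))%E).
    apply: ge0_le_integral => //=.
    - by move=> x _; apply: integral_ge0.
    - exact: (measurable_fun_fubini_tonelli_F (m2 := mu) _ mabs (fun z => abse_ge0 _)).
    - by apply: emeasurable_funM => //; exact: measurable_cst.
    - move=> x _; rewrite -ge0_integralZl //=.
      apply: ge0_le_integral => //=.
      + exact: (measurable_fun_pair2 x mabs).
      + by apply: emeasurable_funM => //; exact: measurable_cst.
      + move=> y _; rewrite -EFinM lee_fin /k !normrM ler_piMr ?mulr_ge0 //.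
        by rewrite indicE; case: (_ \in _); rewrite ?normr1 ?normr0.
  rewrite ge0_integralZr //=; last exact: integral_ge0.
  by rewrite lte_mul_pinfty ?ge0_fin_numE ?integral_ge0.
have := Fubini ik.
have DE x y : \1_D (x, y) = ((x <= y)%R)%:R :> R.
  by rewrite indicE; congr (_%:R); congr nat_of_bool; apply/idP/idP; rewrite inE.
have kL x y : k (x, y) = F x * (G y - cut x g y).
  rewrite /k /F /G /= !cutE DE.
  have [/andP[x0 xt]|xt] := boolP (0 < x < t); last by rewrite mulr0 !mul0r.
  rewrite mulr1 -mulrA; congr (_ * _).
  have [y0|y0] := ltP 0 y; last by rewrite !mulr0 mul0r subrr.
  have [yx|xy] := ltP y x; last by rewrite mulr1 mulr0 subr0.
  by rewrite (lt_trans yx xt) mulr0 mulr1 subrr.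
have kR x y : k (x, y) = G y * (f \_ `]0, y]) x.
  rewrite /k /F /G /= !cutE DE patchE mem_setE in_itv /=.
  have [/andP[y0 yt]|yt] := boolP (0 < y < t); last by rewrite !mulr0 !mul0r.
  rewrite mulr1 [_ * g y]mulrC -mulrA; congr (_ * _).
  have [x0|x0] := ltP 0 x; last by rewrite mulr0 mul0r.
  have [xy|yx] := leP x y; last by rewrite mulr0.
  by rewrite (le_lt_trans xy yt) !mulr1.
have L x : (\int[mu]_y (EFin \o k) (x, y) = (F x * (prim g t - prim g x))%:E)%E.
  have [/andP[x0 xt]|xt] := boolP (0 < x < t); last first.
    rewrite /F cutE (negbTE xt) mulr0 mul0r.
    rewrite integral0_eq // => y _; rewrite /= kL /F cutE (negbTE xt).
    by rewrite mulr0 mul0r.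
  have x1 : x <= 1 by rewrite (le_trans (ltW xt)).
  have ix := cut_integrable x1 hg.
  under eq_integral do rewrite /= kL EFinM EFinB.
  rewrite integralZl //; last exact: integrableB.
  rewrite (integralB_EFin _ iG ix) // !prim_fin //.
have Rr y : (\int[mu]_x (EFin \o k) (x, y) = (G y * prim f y)%:E)%E.
  have [/andP[y0 yt]|yt] := boolP (0 < y < t); last first.
    rewrite /G cutE (negbTE yt) mulr0 mul0r.
    rewrite integral0_eq // => x _; rewrite /= kR /G cutE (negbTE yt).
    by rewrite mulr0 mul0r.
  have y1 : y < 1 by rewrite (lt_le_trans yt).
  have iy : mu.-integrable `]0, y] (EFin \o f).
    apply: integrableS hf => //; apply: subset_itvl; by rewrite bnd_simp.
  have iy' : mu.-integrable setT (EFin \o (f \_ `]0, y])).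
    by rewrite -restrict_EFin; apply/integrable_restrict => //; rewrite setTI.
  under eq_integral do rewrite /= kR EFinM.
  rewrite integralZl // EFinM; congr (_ * _)%E.
  rewrite -(fineK (integrable_fin_num _ iy')) //; congr EFin.
  rewrite -[LHS]/(\int[mu]_x (f \_ `]0, y]) x) -Rintegral_mkcond /prim.
  by rewrite -Rintegral_itv_bndo_bndc //; exact: int01_sub (ltW y1) hf.
under eq_integral do rewrite L.
under [X in _ = X -> _]eq_integral do rewrite Rr.
move=> /(congr1 fine) E.
have E' : \int[mu]_x (F x * (prim g t - prim g x)) = \int[mu]_y (G y * prim f y) by exact: E.
have i1 : mu.-integrable setT (EFin \o cut t (fun x => f x * prim g x)).
  by rewrite -restrict_EFin; apply/integrable_restrict => //; rewrite setTI.
have E1 : \int[mu]_x (F x * (prim g t - prim g x)) =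
    prim g t * prim f t - prim (fun x => f x * prim g x) t.
  rewrite (prim_cut f) (prim_cut (fun x => f x * prim g x)) -RintegralZl // -RintegralB //; last first.
    by apply: (integrableZl _ (prim g t) iF).
  apply: eq_Rintegral => x _; rewrite /F !cutE; ring.
have E2 : \int[mu]_y (G y * prim f y) = prim (fun x => prim f x * g x) t.
  rewrite prim_cut; apply: eq_Rintegral => x _; rewrite /G !cutE; ring.
by rewrite -E2 -E' E1; ring.
Qed.

End unit_interval_integrals.

(** * Absolutely continuous functions *)

Section absolute_continuity.
Context (R : realType).
Local Notation mu := (@lebesgue_measure R).
Local Notation I01 := (`]0%R, 1%R[%classic : set R).
Implicit Types (f g F G : R -> R).

Lemma prim0 f : prim f 0 = 0.
Proof. by rewrite /prim set_itv_ge ?Rintegral_set0 // bnd_simp ltxx. Qed.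

Lemma primD f g t : t <= 1 -> int01 f -> int01 g ->
  prim (fun x => f x + g x) t = prim f t + prim g t.
Proof. by move=> t1 hf hg; rewrite /prim RintegralD //; exact: int01_sub. Qed.

Lemma primZ c f t : t <= 1 -> int01 f -> prim (fun x => c * f x) t = c * prim f t.
Proof. by move=> t1 hf; rewrite /prim RintegralZl //; exact: int01_sub. Qed.

Lemma eq_prim f g t : (forall x, 0 < x < t -> f x = g x) -> prim f t = prim g t.
Proof. by move=> fg; apply: eq_Rintegral => x; rewrite inE /= in_itv /=; exact: fg. Qed.

Lemma prim_le f t : t <= 1 -> int01 f -> `|prim f t| <= prim (fun x => `|f x|) 1.
Proof.
move=> t1 hf; have hf' := int01_norm hf.
apply: (le_trans (le_normr_Rintegral _ (int01_sub t1 hf))) => //.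
rewrite -/(prim (fun x => `|f x|) t) !prim_cut; apply: le_Rintegral => //.
- exact: cut_integrable.
- exact: cut_integrable.
move=> x _; rewrite !cutE ler_wpM2l // ler_nat; case: ltP => //= x0.
by case: ltP => //= xt; rewrite (lt_le_trans xt).
Qed.

(** [F] is absolutely continuous on [0, 1] with derivative [f]. Recording the derivative as an
    integrand makes the product rule an instance of Fubini's theorem. *)
Definition ac F f : Prop := int01 f /\ forall t, 0 <= t <= 1 -> F t = F 0 + prim f t.

Lemma ac_prim f : int01 f -> ac (prim f) f.
Proof. by move=> hf; split=> // t _; rewrite prim0 add0r. Qed.

Lemma ac_cst c : ac (fun=> c) (fun=> 0).
Proof.
split=> [|t _]; first exact: int01_cst.
by rewrite /prim Rintegral_cst // mul0r addr0.
Qed.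

Lemma acD F G f g : ac F f -> ac G g -> ac (fun x => F x + G x) (fun x => f x + g x).
Proof.
move=> [hf HF] [hg HG]; split=> [|t /[dup] t01 /andP[_ t1]]; first exact: int01D.
by rewrite HF // HG // primD //; ring.
Qed.

Lemma acZ c F f : ac F f -> ac (fun x => c * F x) (fun x => c * f x).
Proof.
move=> [hf HF]; split=> [|t /[dup] t01 /andP[_ t1]]; first exact: int01Z.
by rewrite HF // primZ //; ring.
Qed.

Lemma acB F G f g : ac F f -> ac G g -> ac (fun x => F x - G x) (fun x => f x - g x).
Proof.
move=> hF hG; have := acD hF (acZ (-1) hG).
have -> : (fun x => F x + -1 * G x) = (fun x => F x - G x) by apply/funext => x; ring.
by have -> : (fun x => f x + -1 * g x) = (fun x => f x - g x) by apply/funext => x; ring.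
Qed.

Lemma prim_continuous f : int01 f -> {within `[0, 1], continuous (prim f)}.
Proof.
move=> hf; pose f0 := cut 1 f.
have i0 : mu.-integrable `[0, 1] (EFin \o f0).
  by apply: integrableS (cut_integrable (lexx 1) hf).
have := parameterized_integral_continuous ler01 i0.
apply: subspace_eq_continuous => t; rewrite inE /= in_itv /= => /andP[t0 t1].
rewrite -[RHS]/(prim f t) -[LHS]/(\int[mu]_(x in `[0, t]) f0 x) /prim.
rewrite -Rintegral_itv_obnd_cbnd; last first.
  by apply: integrableS i0 => // x /=; rewrite !in_itv /= => /andP[/ltW-> /= /le_trans]; exact.
rewrite -Rintegral_itv_bndo_bndc; last first.
  apply: integrableS i0 => // x /=; rewrite !in_itv /= => /andP[/ltW-> /= /ltW /le_trans]; exact.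
apply: eq_Rintegral => x; rewrite inE /= in_itv /= => /andP[x0 xt].
by rewrite /f0 cutE x0 (lt_le_trans xt) // mulr1.
Qed.

Lemma ac_continuous F f : ac F f -> {within `[0, 1], continuous F}.
Proof.
move=> [hf HF]; have c : {within `[0, 1], continuous (fun t => F 0 + prim f t)}.
  by move=> t; apply: cvgD; [exact: cvg_cst | exact: prim_continuous].
apply: subspace_eq_continuous c => t; rewrite inE /= in_itv /= => t01.
exact/esym/HF.
Qed.

Lemma cont01_meas F : {within `[0, 1], continuous F} -> measurable_fun I01 F.
Proof.
move=> cF.
have h : measurable_fun (`[0, 1]%classic : set R) F by exact: subspace_continuous_measurable_fun.
by apply: measurable_funS h => //; exact: subset_itv_oo_cc.
Qed.

Lemma ac_bounded F f : ac F f -> exists2 c : R, 0 <= c & forall t, 0 <= t <= 1 -> `|F t| <= c.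
Proof.
move=> [hf HF]; exists (`|F 0| + prim (fun x => `|f x|) 1).
  by rewrite addr_ge0 // Rintegral_ge0.
move=> t /[dup] t01 /andP[_ t1]; rewrite HF //; apply: (le_trans (ler_normD _ _)).
by rewrite lerD2l prim_le.
Qed.

Lemma int01_acM F f g : ac F f -> int01 g -> int01 (fun x => g x * F x).
Proof.
move=> hF hg; have [c c0 Hc] := ac_bounded hF.
apply: (@int01_le _ _ (fun x => c * `|g x|)).
- by apply: measurable_funM; [exact: int01_meas | exact: cont01_meas (ac_continuous hF)].
- move=> x; rewrite /= in_itv /= => /andP[x0 x1].
  by rewrite normrM mulrC ler_wpM2r // Hc // !ltW.
- by apply: int01Z; exact: int01_norm.
Qed.

Lemma acM F G f g : ac F f -> ac G g ->
  ac (fun x => F x * G x) (fun x => f x * G x + F x * g x).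
Proof.
move=> hF hG; have [hf HF] := hF; have [hg HG] := hG.
have i1 : int01 (fun x => f x * G x) by exact: int01_acM hG hf.
have i2 : int01 (fun x => F x * g x).
  have := int01_acM hF hg; congr int01; apply/funext => x; exact: mulrC.
split=> [|t /[dup] t01 /andP[t0 t1]]; first exact: int01D.
have j1 : int01 (fun x => f x * prim g x) by exact: int01_acM (ac_prim hg) hf.
have j2 : int01 (fun x => prim f x * g x).
  have := int01_acM (ac_prim hf) hg; congr int01; apply/funext => x; exact: mulrC.
have E1 : prim (fun x => f x * G x + F x * g x) t =
    G 0 * prim f t + prim (fun x => f x * prim g x) t +
    (F 0 * prim g t + prim (fun x => prim f x * g x) t).
  have k1 : int01 (fun x => G 0 * f x) by exact: int01Z.
  have k2 : int01 (fun x => F 0 * g x) by exact: int01Z.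
  have k3 := int01D k1 j1; have k4 := int01D k2 j2.
  rewrite -(primZ (G 0) t1 hf) -(primZ (F 0) t1 hg) -(primD t1 k1 j1) -(primD t1 k2 j2) -(primD t1 k3 k4).
  apply: eq_prim => x /andP[x0 xt]; have x01 : 0 <= x <= 1 by rewrite ltW //= ltW // (lt_le_trans xt).
  by rewrite (HF x x01) (HG x x01); ring.
rewrite E1 (HF t t01) (HG t t01).
have := prim_mul t0 t1 hf hg (int01_sub t1 j1) (int01_sub t1 j2).
move=> E; have -> : (F 0 + prim f t) * (G 0 + prim g t) =
  F 0 * G 0 + F 0 * prim g t + G 0 * prim f t + prim f t * prim g t by ring.
by rewrite E; ring.
Qed.

Lemma ac_C1 (phi : R -> R) : (forall z, derivable phi z 1) -> continuous (derive1 phi) ->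
  ac phi (derive1 phi).
Proof.
move=> dphi cphi.
have i1 : int01 (derive1 phi).
  have h : mu.-integrable (`[0, 1]%classic : set R) (EFin \o derive1 phi).
    apply: continuous_compact_integrable; first exact: segment_compact.
    exact: continuous_subspaceT.
  by apply: integrableS h => //; exact: subset_itv_oo_cc.
split=> // t /andP[]; rewrite le_eqVlt => /predU1P[<- _|t0 t1]; first by rewrite prim0 addr0.
have cphi' : continuous phi.
  by move=> z; apply: differentiable_continuous; apply/derivable1_diffP.
have := @continuous_FTC2 R (derive1 phi) phi 0 t t0.
have cd : derivable_oo_LRcontinuous phi 0 t.
  split=> [z _ //| |].
  - by apply: cvg_at_right_filter; exact: cphi'.
  - by apply: cvg_at_left_filter; exact: cphi'.
move=> /(_ (continuous_subspaceT cphi) cd (fun _ _ => erefl)) => /(congr1 fine) /=.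
have it : mu.-integrable `[0, t] (EFin \o derive1 phi).
  apply: continuous_compact_integrable; first exact: segment_compact.
  exact: continuous_subspaceT.
rewrite -[LHS]/(\int[mu]_(x in `[0, t]) derive1 phi x) -Rintegral_itv_obnd_cbnd; last first.
  by apply: integrableS it => // x /=; rewrite !in_itv /= => /andP[/ltW-> ->].
rewrite -Rintegral_itv_bndo_bndc; last exact: int01_sub.
by rewrite -/(prim _ _) => ->; ring.
Qed.

Lemma ac_ibp F G f g : ac F f -> ac G g ->
  \int[mu]_(x in I01) (f x * G x + F x * g x) = F 1 * G 1 - F 0 * G 0.
Proof.
move=> hF hG; have [_ H] := acM hF hG.
by rewrite (H 1) ?ler01 ?lexx // addrC addKr.
Qed.

End absolute_continuity.

(** * The du Bois-Reymond lemma *)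

Section du_Bois_Reymond.
Context (R : realType).
Local Notation mu := (@lebesgue_measure R).
Local Notation I01 := (`]0%R, 1%R[%classic : set R).
Implicit Types (f g F G phi psi : R -> R).

Lemma ae_int01 f g : int01 f -> int01 g -> ae01 (fun z => f z = g z) ->
  \int[mu]_(x in I01) f x = \int[mu]_(x in I01) g x.
Proof.
move=> hf hg h; congr fine; apply: ae_eq_integral => //.
- exact: measurable_int hf.
- exact: measurable_int hg.
by apply: (ae01S _ h) => z _ ->.
Qed.

(** By Lebesgue's differentiation theorem. *)
Lemma prim_eq0_ae f : int01 f -> (forall t, 0 < t < 1 -> prim f t = 0) ->
  ae01 (fun z => f z = 0).
Proof.
move=> hf p0; pose f0 := cut 1 f.
have i0 : mu.-integrable setT (EFin \o f0) by exact: cut_integrable.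
have iy (y : R) : mu.-integrable `[0, y] (EFin \o f0) by exact: integrableS i0.
have := FTC1 iy (open_integrable_locally openT i0).
rewrite /ae01; have FF := @ae_filter_ringOfSetsType _ _ _ (@lebesgue_measure R).
apply: (@filterS _ _ FF) => z H; rewrite /= in_itv /= => /andP[z0 z1].
have z0' : (0%:E < (z : R)%:E)%E by rewrite lte_fin.
have [_ H2] := H z0'.
rewrite -[LHS](_ : f0 z = _); last by rewrite /f0 cutE z0 z1 mulr1.
rewrite -H2 derive1E (near_eq_derive (g := cst 0)) ?derive_cst //.
have : z \in `]0, 1[ by rewrite in_itv /= z0.
move=> /near_in_itvoo; apply: filterS => y; rewrite in_itv /= => /andP[y0 y1].
rewrite -Rintegral_itv_obnd_cbnd; last first.
  by apply: integrableS (iy y) => //; exact: subset_itv_oc_cc.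
rewrite -Rintegral_itv_bndo_bndc; last first.
  by apply: integrableS (iy y) => //; exact: subset_itv_oo_cc.
rewrite -[RHS](p0 y) ?y0 //; apply: eq_prim => x /andP[x0 xy].
by rewrite /f0 cutE x0 (lt_trans xy) // mulr1.
Qed.

Lemma int01_contM f psi : int01 f -> continuous psi -> int01 (fun x => f x * psi x).
Proof.
move=> hf cpsi.
have [c Hc] : exists c, forall x, I01 x -> `|psi x| <= c.
  have := compact_bounded (continuous_compact (continuous_subspaceT cpsi) (@segment_compact R 0 1)).
  move=> [M [_ /(_ (M + 1))]]; rewrite ltrDl ltr01 => /(_ isT) HM.
  exists (M + 1) => x; rewrite /= in_itv /= => /andP[x0 x1]; apply: HM.
  by exists x => //=; rewrite in_itv /= !ltW.
apply: (@int01_le _ _ (fun x => c * `|f x|)).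
- apply: measurable_funM; first exact: int01_meas.
  by apply: cont01_meas; exact: continuous_subspaceT.
- by move=> x Ix; rewrite normrM mulrC ler_wpM2r // Hc.
- by apply: int01Z; exact: int01_norm.
Qed.

Lemma test_continuous phi : test_function phi -> continuous phi.
Proof.
by move=> [dphi _ _] z; apply: differentiable_continuous; apply/derivable1_diffP.
Qed.

Lemma test_ac phi : test_function phi -> [/\ ac phi (derive1 phi), phi 0 = 0 & phi 1 = 0].
Proof.
move=> [dphi cphi [a [b [a0 b1 H]]]]; split; first exact: ac_C1.
- by apply: H; rewrite in_itv /= leNgt a0.
- by apply: H; rewrite in_itv /= andbC leNgt b1.
Qed.

(** The primitive of [psi] is constant on both sides of its support, and the constants are
    zero because the integral vanishes. *)
Lemma test_of_derivative psi a b : continuous psi -> 0 < a -> b < 1 ->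
  (forall z, z \notin `[a, b] -> psi z = 0) -> \int[mu]_(x in I01) psi x = 0 ->
  exists2 phi, test_function phi & derive1 phi = psi.
Proof.
move=> cpsi a0 b1 Hpsi psi0.
have i0 : mu.-integrable setT (EFin \o psi).
  have -> : psi = psi \_ `[a, b].
    apply/funext => z; rewrite patchE mem_setE; case: ifPn => // /Hpsi -> //.
  rewrite -restrict_EFin; apply/integrable_restrict => //; rewrite setTI.
  apply: continuous_compact_integrable; first exact: segment_compact.
  exact: continuous_subspaceT.
pose phi (x : R) := \int[mu]_(t in [set` `]-oo, x]]) psi t.
have H z : derivable phi z 1 /\ derive1 phi z = psi z.
  have zz : z < z + 1 by rewrite ltrDl.
  apply: (@continuous_FTC1 R psi -oo%O z (z + 1) zz); first exact: integrableS i0.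
    by rewrite ltNyr.
  exact: cpsi.
have dphi : derive1 phi = psi by apply/funext => z; case: (H z).
exists phi => //; split.
- by move=> z; case: (H z).
- by rewrite dphi.
exists a, b; split=> // z; rewrite in_itv /= negb_and -!ltNge => /orP[za|bz].
  transitivity (\int[mu]_(t in [set` `]-oo, z]]) 0); last by rewrite Rintegral_cst // mul0r.
  apply: eq_Rintegral => x; rewrite inE /= in_itv /= => xz; apply: Hpsi.
  by rewrite in_itv /= leNgt (le_lt_trans xz).
rewrite /phi -psi0 Rintegral_mkcond [RHS]Rintegral_mkcond.
apply: eq_Rintegral => x _; rewrite !patchE !mem_setE !in_itv /=.
have [->|px] := eqVneq (psi x) 0; first by case: ifP; case: ifP.
have /andP[ax xb] : a <= x <= b.
  by apply: contra_neqT px => xab; apply: Hpsi; rewrite in_itv.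
by rewrite (le_trans xb (ltW bz)) (lt_le_trans a0 ax) (le_lt_trans xb b1).
Qed.

(** Continuous approximations from below of the indicator function of the interval from
    [a] to [b]. *)
Definition trapezoid (a b : R) (n : nat) (x : R) : R :=
  Num.max 0 (Num.min 1 (Num.min (n%:R * (x - a)) (n%:R * (b - x)))).

Lemma trapezoid_continuous a b n : continuous (trapezoid a b n).
Proof.
have E : trapezoid a b n = cst 0 \max (cst 1 \min
  ((fun x => n%:R * (x - a)) \min (fun x => n%:R * (b - x)))) by [].
move=> x; rewrite E; apply: continuous_max; first exact: cvg_cst.
apply: continuous_min; first exact: cvg_cst.
apply: continuous_min.
  by apply: cvgM; [exact: cvg_cst | apply: cvgB; [exact: cvg_id | exact: cvg_cst]].
by apply: cvgM; [exact: cvg_cst | apply: cvgB; [exact: cvg_cst | exact: cvg_id]].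
Qed.

Lemma trapezoid_ge0 a b n x : 0 <= trapezoid a b n x.
Proof. by rewrite le_max lexx. Qed.

Lemma trapezoid_le1 a b n x : trapezoid a b n x <= 1.
Proof. by rewrite ge_max ler01 ge_min lexx. Qed.

Lemma trapezoid_out a b n x : ~~ (a < x < b) -> trapezoid a b n x = 0.
Proof.
rewrite negb_and -!leNgt /trapezoid => h; apply/max_idPl.
rewrite !ge_min; apply/orP; right; apply/orP; case/orP: h => h; [left|right].
  by rewrite mulr_ge0_le0 // subr_le0.
by rewrite mulr_ge0_le0 // subr_le0.
Qed.

Lemma trapezoid_in a b x : a < x < b ->
  exists n0 : nat, forall n, (n0 <= n)%N -> trapezoid a b n x = 1.
Proof.
move=> /andP[ax xb].
pose d := Num.min (x - a) (b - x); have d0 : 0 < d by rewrite lt_min !subr_gt0 ax.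
exists (Num.truncn d^-1).+1 => n hn.
have nd : 1 <= n%:R * d.
  rewrite -ler_pdivrMr // mul1r (le_trans (ltW (truncnS_gt _))) // ler_nat //.
have h1 : 1 <= n%:R * (x - a) by apply: (le_trans nd); rewrite ler_wpM2l // ge_min lexx.
have h2 : 1 <= n%:R * (b - x) by apply: (le_trans nd); rewrite ler_wpM2l // ge_min lexx orbT.
by rewrite /trapezoid (min_idPl _) ?le_min ?h1 // (max_idPr _).
Qed.

Lemma prim_sub f (s t : R) : 0 <= s -> s <= t -> t <= 1 -> int01 f ->
  \int[mu]_(x in I01) (f x * \1_(`]s, t[%classic : set R) x) = prim f t - prim f s.
Proof.
move=> s0 st t1 hf.
have E : \int[mu]_(x in I01) (f x * \1_(`]s, t[%classic : set R) x) =
    \int[mu]_(x in `]s, t[) f x.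
  rewrite Rintegral_mkcond [RHS]Rintegral_mkcond; apply: eq_Rintegral => x _.
  rewrite !patchE indicE !mem_setE !in_itv /=.
  have [sx|sx] := ltP s x; last by case: ifP; rewrite ?mulr0.
  have [xt|xt] := ltP x t; last by case: ifP; rewrite ?mulr0.
  by rewrite (le_lt_trans s0 sx) (lt_le_trans xt t1) mulr1.
rewrite E; move: st; rewrite le_eqVlt => /predU1P[->|st].
  by rewrite subrr set_itv_ge ?Rintegral_set0 // bnd_simp ltxx.
rewrite -(@Rintegral_itvB _ _ (BRight 0) (BLeft t)) //.
- congr (_ - _); rewrite -Rintegral_itv_bndo_bndc //.
  by apply: int01_sub => //; apply: ltW; exact: lt_le_trans st t1.
- exact: int01_sub.
Qed.

Lemma prim_cst (c t : R) : 0 <= t -> prim (fun=> c) t = c * t.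
Proof.
move=> t0; rewrite /prim Rintegral_cst //= lebesgue_measure_itv /= lte_fin.
by case: ltP => [_|h] /=; [rewrite oppr0 addr0 | rewrite (le_anti (introT andP (conj h t0)))].
Qed.

Lemma trapezoid_limit f (a b : R) : 0 < a -> a <= b -> b < 1 -> int01 f ->
  (forall n, \int[mu]_(x in I01) (f x * trapezoid a b n x) = 0) -> prim f b = prim f a.
Proof.
move=> a0 ab b1 hf Hn; apply/eqP; rewrite -subr_eq0 -prim_sub //; last 2 first.
- exact: ltW.
- exact: ltW.
set F := fun x => f x * _.
have mI : measurable_fun I01 F.
  by apply: measurable_funM; [exact: int01_meas | exact: measurable_indic].
have := @dominated_convergence _ _ _ mu I01 (measurable_itv _)
   (fun n x => (f x * trapezoid a b n x)%:E) (EFin \o F) (EFin \o (fun x => `|f x|)).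
case.
- move=> n; apply/measurable_EFinP; apply: measurable_funM; first exact: int01_meas.
  by apply: cont01_meas; apply: continuous_subspaceT; exact: trapezoid_continuous.
- exact/measurable_EFinP.
- apply: aeW => x _.
  have [xab|xab] := boolP (a < x < b).
    have [n0 Hn0] := trapezoid_in xab.
    apply: cvg_near_cst; exists n0 => // n /= hn.
    by rewrite Hn0 // /F /= indicE mem_setE in_itv /= xab.
  apply: cvg_near_cst; exists 0%N => // n _ /=.
  by rewrite trapezoid_out // /F indicE mem_setE in_itv /= (negbTE xab).
- exact: int01_norm.
- apply: aeW => x n _ /=; rewrite lee_fin normrM ler_piMr //.
  by rewrite ger0_norm ?trapezoid_ge0 // trapezoid_le1.
move=> iF _ H.
have E n : (\int[mu]_(x in I01) (f x * trapezoid a b n x)%:E = 0)%E.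
  have it : int01 (fun x => f x * trapezoid a b n x).
    by apply: int01_contM => //; exact: trapezoid_continuous.
  by rewrite -(fineK (integrable_fin_num _ it)) //; congr EFin; exact: Hn.
have : (\int[mu]_(x in I01) (EFin \o F) x = 0)%E.
  move: H; rewrite (_ : [sequence _]_n = cst 0%E); last by apply/funext => n; exact: E.
  by move=> /(cvg_lim (@ereal_hausdorff R)) <-; rewrite lim_cst.
by move=> h; rewrite /Rintegral h.
Qed.

(** Subtracting a multiple of a fixed bump [rho] makes the integral of a trapezoid vanish, so
    that it becomes the derivative of a test function. Hence [f - c] is orthogonal to all
    trapezoids, by dominated convergence to all intervals, and so it vanishes. *)
Lemma du_bois_reymond f : int01 f ->
  (forall phi, test_function phi -> \int[mu]_(x in I01) (f x * derive1 phi x) = 0) ->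
  exists c, ae01 (fun z => f z = c).
Proof.
move=> hf H.
have i4 : 0 < 4^-1 :> R by rewrite invr_gt0.
pose rho := trapezoid 4^-1 (3 / 4) 8.
have crho : continuous rho by exact: trapezoid_continuous.
have irho : int01 rho.
  have := int01_contM (int01_cst 1) crho; congr int01; apply/funext => x; exact: mul1r.
pose m := \int[mu]_(x in I01) rho x.
have m0 : m != 0.
  have q1 : 0 <= 3 / 8 :> R by rewrite divr_ge0.
  have q2 : 3 / 8 <= 5 / 8 :> R by rewrite ler_pM2r ?invr_gt0 // ler_nat.
  have q3 : 5 / 8 <= 1 :> R by rewrite ler_pdivrMr // mul1r ler_nat.
  have := prim_sub q1 q2 q3 (int01_cst 1).
  rewrite !prim_cst // ?(le_trans q1) // !mul1r => E.
  have : \int[mu]_(x in I01) (1 * \1_(`](3 / 8), (5 / 8)[%classic : set R) x) <= m.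
    apply: le_Rintegral => //.
    - apply: (@int01_le _ _ (cst 1)); last exact: int01_cst.
        by apply: measurable_funM => //; exact: measurable_indic.
      by move=> x _; rewrite mul1r indicE ger0_norm // lern1 leq_b1.
    move=> x _; rewrite mul1r indicE mem_setE in_itv /=.
    have [/andP[h1 h2]|_] := boolP (3 / 8 < x < 5 / 8); last exact: trapezoid_ge0.
    rewrite /rho /trapezoid le_max; apply/orP; right.
    by rewrite !le_min lexx /=; apply/andP; split; lra.
  by rewrite E => h; rewrite gt_eqF // (lt_le_trans _ h) //; lra.
pose c := (\int[mu]_(x in I01) (f x * rho x)) / m.
exists c.
pose h x := f x - c.
have hh : int01 h by apply: int01B => //; exact: int01_cst.
have Hh a b n : 0 < a -> b < 1 -> \int[mu]_(x in I01) (h x * trapezoid a b n x) = 0.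
  move=> a0 b1; pose psi := trapezoid a b n.
  have cpsi : continuous psi by exact: trapezoid_continuous.
  have ipsi : int01 psi.
    have := int01_contM (int01_cst 1) cpsi; congr int01; apply/funext => x; exact: mul1r.
  pose q := (\int[mu]_(x in I01) psi x) / m.
  pose eta x := psi x - q * rho x.
  have ceta : continuous eta.
    move=> x; apply: cvgB; first exact: cpsi.
    by apply: cvgM; [exact: cvg_cst | exact: crho].
  have eta0 : \int[mu]_(x in I01) eta x = 0.
    have -> : \int[mu]_(x in I01) eta x = \int[mu]_(x in I01) psi x - q * m.
      by rewrite /m -RintegralZl // -RintegralB //; exact: int01Z.
    by rewrite /q divfK // subrr.
  have [||z hz||phi tphi dphi] := @test_of_derivative eta (Num.min a 4^-1) (Num.max b (3 / 4)) ceta.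
  - by rewrite lt_min a0.
  - by rewrite gt_max b1 /=; lra.
  - have z1 : ~~ (a < z < b).
      apply: contra hz => /andP[h1 h2]; rewrite in_itv /= ge_min le_max.
      by rewrite (ltW h1) (ltW h2).
    have z2 : ~~ (4^-1 < z < 3 / 4).
      apply: contra hz => /andP[h1 h2]; rewrite in_itv /= ge_min le_max.
      by rewrite (ltW h1) (ltW h2) !orbT.
    by rewrite /eta /psi /rho !trapezoid_out // mulr0 subr0.
  - exact: eta0.
  have := H phi tphi; rewrite dphi.
  have j1 : int01 (fun x => f x * psi x) by exact: int01_contM.
  have j2 : int01 (fun x => f x * rho x) by exact: int01_contM.
  have -> : \int[mu]_(x in I01) (f x * eta x) =
      \int[mu]_(x in I01) (f x * psi x) - q * \int[mu]_(x in I01) (f x * rho x).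
    rewrite -RintegralZl // -RintegralB //; last exact: int01Z.
    by apply: eq_Rintegral => x _; rewrite /eta; ring.
  move=> E1.
  have -> : \int[mu]_(x in I01) (h x * psi x) =
      \int[mu]_(x in I01) (f x * psi x) - c * \int[mu]_(x in I01) psi x.
    rewrite -RintegralZl // -RintegralB //; last exact: int01Z.
    by apply: eq_Rintegral => x _; rewrite /h; ring.
  by rewrite -[RHS]E1 /c /q; field.
suff : ae01 (fun z => h z = 0) by apply: ae01S => z _ /eqP; rewrite subr_eq0 => /eqP.
have hp s t : 0 < s -> s <= t -> t < 1 -> prim h t = prim h s.
  by move=> s0 st t1; apply: trapezoid_limit => // n; exact: Hh.
apply: prim_eq0_ae => // t /andP[t0 t1].
have /(continuous_within_itvP _ ltr01) [_ + _] := prim_continuous hh.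
rewrite prim0 => /cvg_lim <- //; apply/esym/lim_near_cst => //.
by near=> s; apply/esym/hp => //; near: s; exact: nbhs_right_le.
Unshelve. all: by end_near. Qed.

End du_Bois_Reymond.

(** * Weak derivatives of scalar functions *)

Section weak_derivatives.
Context (R : realType).
Local Notation mu := (@lebesgue_measure R).
Local Notation I01 := (`]0%R, 1%R[%classic : set R).
Implicit Types (f g F G phi : R -> R).

Definition wderivative f g : Prop := forall phi, test_function phi ->
  \int[mu]_(x in I01) (f x * derive1 phi x) = - \int[mu]_(x in I01) (g x * phi x).

Lemma test_int f phi : int01 f -> test_function phi ->
  int01 (fun x => f x * derive1 phi x) /\ int01 (fun x => f x * phi x).
Proof.
move=> hf tphi; split; apply: int01_contM => //; last exact: test_continuous.
by case: tphi.
Qed.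

(** By parts, [f] minus the primitive of [g] is orthogonal to all derivatives of test
    functions. *)
Lemma wderivative_ac f g : int01 f -> int01 g -> wderivative f g ->
  exists2 F, ac F g & ae01 (fun z => F z = f z).
Proof.
move=> hf hg H; have hG := ac_prim hg.
have iG : int01 (prim g).
  by have := int01_acM hG (int01_cst 1); congr int01; apply/funext => x; exact: mul1r.
have [phi tphi|c Hc] := @du_bois_reymond R (fun x => f x - prim g x) (int01B hf iG).
  have [aphi phi0 phi1] := test_ac tphi.
  have [i1 _] := test_int hf tphi; have [i2 _] := test_int iG tphi.
  have [_ i3] := test_int hg tphi.
  have := ac_ibp hG aphi; rewrite phi0 phi1 !mulr0 subrr RintegralD //.
  have -> : \int[mu]_(x in I01) ((f x - prim g x) * derive1 phi x) =
    \int[mu]_(x in I01) (f x * derive1 phi x) - \int[mu]_(x in I01) (prim g x * derive1 phi x).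
    by rewrite -RintegralB //; apply: eq_Rintegral => x _; ring.
  by rewrite H // => h; lra.
exists (fun x => prim g x + c).
  have := acD hG (ac_cst c); congr ac; apply/funext => x; exact: addr0.
apply: (ae01S _ Hc) => z _ <-; ring.
Qed.

(** An interval of positive length is not negligible. *)
Lemma ae01_exists (P : R -> Prop) (u v : R) : ae01 P -> 0 <= u -> u < v -> v <= 1 ->
  exists2 x, u < x < v & P x.
Proof.
move=> aP u0 uv v1; apply: contrapT => H.
have : mu.-negligible (`]u, v[%classic : set R).
  apply: negligibleS aP => x /=; rewrite in_itv /= => /andP[ux xv] Px.
  apply: H; exists x; first by rewrite ux.
  by apply: Px; rewrite /= in_itv /= (le_lt_trans u0 ux) (lt_le_trans xv v1).
move=> neg; have h : mu (`]u, v[%classic : set R) = 0%E by apply: measure_negligible.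
have := lebesgue_measure_itv `]u, v[; rewrite -[X in X = _ -> _]/(mu `]u, v[%classic) h /= lte_fin uv -EFinB.
by move=> /esym/eqP; rewrite eqe subr_eq0 gt_eqF.
Qed.

Lemma cont01_ae_eq F G : {within `[0, 1], continuous F} -> {within `[0, 1], continuous G} ->
  ae01 (fun z => F z = G z) -> forall t, 0 <= t <= 1 -> F t = G t.
Proof.
move=> cF cG FG t /andP[t0 t1].
have cD : {within `[0, 1], continuous (fun x => F x - G x)}.
  by move=> x; apply: cvgB; [exact: cF | exact: cG].
apply/eqP; rewrite -subr_eq0 -normr_eq0 eq_le normr_ge0 andbT.
apply/ler_addgt0Pr => e e0; rewrite add0r.
have t01 : `[0, 1]%classic t by rewrite /= in_itv /= t0.
have /subspace_continuousP /(_ t t01) /cvgrPdist_lt /(_ e e0) := cD.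
rewrite near_withinE => /nbhs_ballP[d /= d0 Hd].
have [u [v [u0 uv v1 Huv]]] : exists u v : R, [/\ 0 <= u, u < v, v <= 1 &
    forall x, u < x < v -> `|t - x| < d].
  have [t1'|t1'] := ltP t 1.
    exists t, (Num.min 1 (t + d)); split=> //.
    - by rewrite lt_min t1' ltrDl.
    - by rewrite ge_min lexx.
    move=> x /andP[tx]; rewrite lt_min => /andP[_ xd].
    by rewrite distrC gtr0_norm ?subr_gt0 // ltrBlDl.
  exists (Num.max 0 (t - d)), t; split=> //.
  - by rewrite le_max lexx.
  - by rewrite gt_max (lt_le_trans ltr01 t1') ltrBlDr ltrDl.
  move=> x /andP[+ tx]; rewrite gt_max => /andP[_ xd].
  by rewrite gtr0_norm ?subr_gt0 // ltrBlDr addrC -ltrBlDr.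
have [x /[dup] uxv /andP[ux xv] Fx] := ae01_exists FG u0 uv v1.
have := Hd x (Huv x uxv); rewrite /= in_itv /= (ltW (le_lt_trans u0 ux)) (ltW (lt_le_trans xv v1)).
move=> /(_ isT); rewrite -[X in `|X|]/((F t - G t) - (F x - G x)).
by rewrite Fx subrr subr0 => /ltW.
Qed.

Lemma wderivative_uniq f g g' : int01 f -> int01 g -> int01 g' ->
  wderivative f g -> wderivative f g' -> ae01 (fun z => g z = g' z).
Proof.
move=> hf hg hg' H H'.
have [F aF Ff] := wderivative_ac hf hg H; have [F' aF' Ff'] := wderivative_ac hf hg' H'.
have FF : forall t, 0 <= t <= 1 -> F t = F' t.
  apply: cont01_ae_eq; [exact: ac_continuous aF | exact: ac_continuous aF' |].
  by apply: (ae01S2 _ Ff Ff') => z _ -> ->.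
have p0 t : 0 < t < 1 -> prim (fun x => g x - g' x) t = 0.
  move=> /andP[/ltW t0 /ltW t1].
  have [_ a1] := aF; have [_ a2] := aF'.
  have := a1 t; have := a2 t; rewrite t0 t1 => /(_ isT) e2 /(_ isT) e1.
  have e0 := FF 0; rewrite lexx ler01 in e0; have {}e0 := e0 isT.
  have e3 := FF t; rewrite t0 t1 in e3; have {}e3 := e3 isT.
  have i1 := int01_sub t1 hg; have i2 := int01_sub t1 hg'.
  by rewrite /prim RintegralB // -/(prim g t) -/(prim g' t); lra.
by apply: (ae01S _ (prim_eq0_ae (int01B hg hg') p0)) => z _ /eqP; rewrite subr_eq0 => /eqP.
Qed.

Lemma wderivative_ae f f' g : int01 f -> int01 f' -> ae01 (fun z => f z = f' z) ->
  wderivative f g -> wderivative f' g.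
Proof.
move=> hf hf' ff' H phi tphi; rewrite -H //.
have [i1 _] := test_int hf tphi; have [i2 _] := test_int hf' tphi.
by apply: ae_int01 => //; apply: (ae01S _ ff') => z _ ->.
Qed.

Lemma wderivativeB f g f' g' : int01 f -> int01 g -> int01 f' -> int01 g' ->
  wderivative f g -> wderivative f' g' ->
  wderivative (fun x => f x - f' x) (fun x => g x - g' x).
Proof.
move=> hf hg hf' hg' H H' phi tphi.
have [i1 _] := test_int hf tphi; have [i2 _] := test_int hf' tphi.
have [_ i3] := test_int hg tphi; have [_ i4] := test_int hg' tphi.
under eq_Rintegral do rewrite mulrBl.
rewrite RintegralB // H // H' //.
under [in RHS]eq_Rintegral do rewrite mulrBl.
by rewrite RintegralB //; ring.
Qed.

Lemma wderivativeZ (c : R) f g : int01 f -> int01 g -> wderivative f g ->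
  wderivative (fun x => c * f x) (fun x => c * g x).
Proof.
move=> hf hg H phi tphi.
have [i1 _] := test_int hf tphi; have [_ i3] := test_int hg tphi.
under eq_Rintegral do rewrite -mulrA.
rewrite RintegralZl // H //.
under [in RHS]eq_Rintegral do rewrite -mulrA.
by rewrite RintegralZl // mulrN.
Qed.

(** The derivative of [F^2] is [2 F f], so that [F t ^ 2] differs from [F s ^ 2] by a bounded
    multiple of the right-hand side; then average over [s]. *)
Lemma ac_sup F f : ac F f -> int01 (fun x => f x ^+ 2) ->
  forall t, 0 <= t <= 1 -> F t ^+ 2 <=
    3 * \int[mu]_(x in I01) F x ^+ 2 + 2 * \int[mu]_(x in I01) f x ^+ 2.
Proof.
move=> aF if2 t t01; have [hf _] := aF.
have aF2 := acM aF aF; have [ih HH] := aF2.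
have iF2 : int01 (fun x => F x ^+ 2).
  have := int01_acM aF2 (int01_cst 1); congr int01; apply/funext => x; rewrite mul1r; exact: expr2.
have key s : I01 s -> F t ^+ 2 <= F s ^+ 2 +
    2 * (\int[mu]_(x in I01) F x ^+ 2 + \int[mu]_(x in I01) f x ^+ 2).
  rewrite /= in_itv /= => /andP[/ltW s0 /ltW s1]; have /andP[_ t1] := t01.
  have s01 : 0 <= s <= 1 by rewrite s0.
  have := HH t t01; have := HH s s01; rewrite -!expr2 => es et.
  have pt := prim_le t1 ih; have ps := prim_le s1 ih.
  have : prim (fun x => `|f x * F x + F x * f x|) 1 <=
      \int[mu]_(x in I01) F x ^+ 2 + \int[mu]_(x in I01) f x ^+ 2.
    rewrite -RintegralD //; apply: le_Rintegral => //.
    - exact: int01_norm.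
    - exact: int01D.
    move=> x _; rewrite ler_norml.
    have h1 := sqr_ge0 (F x + f x); have h2 := sqr_ge0 (F x - f x).
    by apply/andP; split; lra.
  move: pt ps; rewrite !ler_norml => /andP[_ pt] /andP[ps _] h; lra.
have : \int[mu]_(s in I01) (F t ^+ 2) <= \int[mu]_(s in I01) (F s ^+ 2 +
    2 * (\int[mu]_(x in I01) F x ^+ 2 + \int[mu]_(x in I01) f x ^+ 2)).
  apply: le_Rintegral => //; [exact: int01_cst | apply: int01D => //; exact: int01_cst].
rewrite RintegralD //; last exact: int01_cst.
have C c : \int[mu]_(s in I01) c = c by rewrite -[LHS]/(prim (fun=> c) 1) prim_cst // mulr1.
by rewrite !C; lra.
Qed.

End weak_derivatives.

(** * The real inner product and its integral *)

Section real_inner_product.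
Context (R : realType).
Local Notation C := R[i].

(** Real and imaginary parts, indexed so that statements about both are made once. *)
Definition cpt (b : bool) (c : C) : R := if b then complex.Im c else complex.Re c.

Lemma cptD b (x y : C) : cpt b (x + y) = cpt b x + cpt b y.
Proof. by case: b; case: x y => ? ? []. Qed.

Lemma cptN b (x : C) : cpt b (- x) = - cpt b x.
Proof. by case: b; case: x. Qed.

Lemma cptZ b (a : R) (x : C) : cpt b (a%:C * x) = a * cpt b x.
Proof. by case: b; case: x => c d /=; ring. Qed.

Lemma cpt_sum b (I : Type) (r : seq I) (P : pred I) (f : I -> C) :
  cpt b (\sum_(i <- r | P i) f i) = \sum_(i <- r | P i) cpt b (f i).
Proof. by apply: (big_morph _ (cptD b)); case: b. Qed.

Lemma cpt_ext (x y : C) : (forall b, cpt b x = cpt b y) -> x = y.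
Proof. by case: x y => a b [c d] h; move: (h true) (h false) => /= -> ->. Qed.

Lemma conjCE (x : C) : Num.conj x = (complex.Re x -i* complex.Im x)%C.
Proof. by case: x. Qed.

(** The real part of the Hermitian inner product; [rdotE] is its matrix form. *)
Definition rdot k (u v : 'cV[C]_k) : R :=
  \sum_(i < k) (complex.Re (u i ord0) * complex.Re (v i ord0) +
                complex.Im (u i ord0) * complex.Im (v i ord0)).

Lemma rdotE k (u v : 'cV[C]_k) : rdot u v = complex.Re ((v^t* *m u) ord0 ord0).
Proof.
rewrite mxE -[RHS]/(cpt false _) cpt_sum; apply: eq_bigr => i _.
rewrite !mxE conjCE; case: (u i ord0) (v i ord0) => a b [c d] /=; ring.
Qed.

Lemma rdotC k (u v : 'cV[C]_k) : rdot u v = rdot v u.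
Proof. by apply: eq_bigr => i _; ring. Qed.

Lemma rdotDl k (u v w : 'cV[C]_k) : rdot (u + v) w = rdot u w + rdot v w.
Proof. by rewrite !rdotE mulmxDr mxE -!/(cpt false _) cptD. Qed.

Lemma rdotNl k (u w : 'cV[C]_k) : rdot (- u) w = - rdot u w.
Proof. by rewrite !rdotE mulmxN mxE -!/(cpt false _) cptN. Qed.

Lemma rdotBl k (u v w : 'cV[C]_k) : rdot (u - v) w = rdot u w - rdot v w.
Proof. by rewrite rdotDl rdotNl. Qed.

Lemma rdotDr k (u v w : 'cV[C]_k) : rdot w (u + v) = rdot w u + rdot w v.
Proof. by rewrite ![rdot w _]rdotC rdotDl. Qed.

Lemma rdotNr k (u w : 'cV[C]_k) : rdot w (- u) = - rdot w u.
Proof. by rewrite ![rdot w _]rdotC rdotNl. Qed.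

Lemma rdotBr k (u v w : 'cV[C]_k) : rdot w (u - v) = rdot w u - rdot w v.
Proof. by rewrite rdotDr rdotNr. Qed.

Lemma rdotZl k (a : R) (u w : 'cV[C]_k) : rdot (a%:C *: u) w = a * rdot u w.
Proof. by rewrite !rdotE -scalemxAr mxE -!/(cpt false _) cptZ. Qed.

Lemma rdotZr k (a : R) (u w : 'cV[C]_k) : rdot w (a%:C *: u) = a * rdot w u.
Proof. by rewrite rdotC rdotZl rdotC. Qed.

Lemma rdot0l k (w : 'cV[C]_k) : rdot 0 w = 0.
Proof. by rewrite rdotE mulmx0 mxE. Qed.

Lemma rdot_sqnorm k (u : 'cV[C]_k) : rdot u u = sqnorm u.
Proof. by apply: eq_bigr => i _; rewrite -!expr2. Qed.

Lemma trmxCK p q (A : 'M[C]_(p, q)) : (A^t*)^t* = A.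
Proof. by apply/matrixP => i j; rewrite !mxE conjCK. Qed.

Lemma trmxCM p q s (A : 'M[C]_(p, q)) (B : 'M[C]_(q, s)) : (A *m B)^t* = B^t* *m A^t*.
Proof. by rewrite trmx_mul map_mxM. Qed.

Lemma rdot_mxl p q (A : 'M[C]_(p, q)) (u : 'cV[C]_q) (v : 'cV[C]_p) :
  rdot (A *m u) v = rdot u (A^t* *m v).
Proof. by rewrite !rdotE trmxCM trmxCK mulmxA. Qed.

Lemma rdot_mxr p q (A : 'M[C]_(p, q)) (u : 'cV[C]_q) (v : 'cV[C]_p) :
  rdot v (A *m u) = rdot (A^t* *m v) u.
Proof. by rewrite rdotC rdot_mxl rdotC. Qed.

Lemma rdot_le k (u v : 'cV[C]_k) : `|rdot u v| <= 2^-1 * (sqnorm u + sqnorm v).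
Proof.
have h1 := sqnorm_ge0 (u + v); have h2 := sqnorm_ge0 (u - v).
rewrite -rdot_sqnorm rdotDl !rdotDr (rdotC v u) in h1.
rewrite -rdot_sqnorm rdotBl !rdotBr (rdotC v u) in h2.
rewrite -!rdot_sqnorm ler_norml; apply/andP; split; lra.
Qed.

Lemma rdot_col p q (u u' : 'cV[C]_p) (v v' : 'cV[C]_q) :
  rdot (col_mx u v) (col_mx u' v') = rdot u u' + rdot v v'.
Proof.
rewrite /rdot big_split_ord /=; congr (_ + _); apply: eq_bigr => i _.
  by rewrite !col_mxEu.
by rewrite !col_mxEd.
Qed.

Lemma sqnorm_col p q (u : 'cV[C]_p) (v : 'cV[C]_q) :
  sqnorm (col_mx u v) = sqnorm u + sqnorm v.
Proof. by rewrite -!rdot_sqnorm rdot_col. Qed.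

Lemma normc_sqr (c : C) : complex.Re c ^+ 2 + complex.Im c ^+ 2 = Normc.normc c ^+ 2.
Proof. by case: c => a b /=; rewrite sqr_sqrtr // addr_ge0 ?sqr_ge0. Qed.

Lemma normc_ge0 (c : C) : 0 <= Normc.normc c.
Proof. by case: c => a b; exact: sqrtr_ge0. Qed.

Lemma normc_sum (I : Type) (r : seq I) (f : I -> C) :
  Normc.normc (\sum_(i <- r) f i) <= \sum_(i <- r) Normc.normc (f i).
Proof.
elim: r => [|i r IH]; first by rewrite !big_nil Normc.normc0.
by rewrite !big_cons; apply: (le_trans (le_normcD _ _)); rewrite lerD2l.
Qed.

Lemma sqnorm_entry k (v : 'cV[C]_k) i : Normc.normc (v i ord0) ^+ 2 <= sqnorm v.
Proof.
rewrite -normc_sqr /sqnorm (bigD1 i) //= lerDl.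
by apply: sumr_ge0 => j _; rewrite addr_ge0 ?sqr_ge0.
Qed.

Lemma sqnorm_mulmx p q (A : 'M[C]_(p, q)) (v : 'cV[C]_q) (M : R) : 0 <= M ->
  (forall i j, `|A i j| <= M%:C) -> sqnorm (A *m v) <= p%:R * (q%:R * M) ^+ 2 * sqnorm v.
Proof.
move=> M0 HA; pose s := Num.sqrt (sqnorm v).
have s0 : 0 <= s by exact: sqrtr_ge0.
have s2 : s ^+ 2 = sqnorm v by rewrite sqr_sqrtr // sqnorm_ge0.
have vs j : Normc.normc (v j ord0) <= s.
  rewrite -(@ler_pXn2r _ 2) ?nnegrE ?normc_ge0 // s2; exact: sqnorm_entry.
have As i j : Normc.normc (A i j) <= M by have := HA i j; rewrite lecR.
have row i : Normc.normc ((A *m v) i ord0) <= q%:R * (M * s).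
  rewrite mxE; apply: (le_trans (normc_sum _ _)).
  rewrite -[leRHS](_ : \sum_(j < q) (M * s) = _); last by rewrite sumr_const card_ord mulr_natl.
  by apply: ler_sum => j _; rewrite Normc.normcM ler_pM ?normc_ge0.
rewrite [leLHS]/sqnorm; apply: (@le_trans _ _ (\sum_(i < p) (q%:R * (M * s)) ^+ 2)).
  apply: ler_sum => i _; rewrite normc_sqr ler_pXn2r ?nnegrE ?normc_ge0 //.
  by rewrite !mulr_ge0.
by rewrite sumr_const card_ord -mulr_natl -s2 le_eqVlt; apply/orP; left; apply/eqP; ring.
Qed.

End real_inner_product.

Section L2_operations.
Context (R : realType).
Local Notation mu := (@lebesgue_measure R).
Local Notation I01 := (`]0%R, 1%R[%classic : set R).
Local Notation C := R[i].

Lemma int01_sqnorm k (f : R -> 'cV[C]_k) : isL2 f -> int01 (fun z => sqnorm (f z)).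
Proof. exact: isL2_integrable. Qed.

Lemma isL2P k (f : R -> 'cV[C]_k) : entrywise (measurable_fun I01) f ->
  int01 (fun z => sqnorm (f z)) -> isL2 f.
Proof.
move=> mf /integrableP[_ h]; split=> //; apply: le_lt_trans h.
apply: ge0_le_integral => //.
- by move=> z _; rewrite lee_fin sqnorm_ge0.
- by apply/measurable_EFinP; exact: measurable_sqnorm.
- by apply: measurableT_comp => //; apply/measurable_EFinP; exact: measurable_sqnorm.
- by move=> z _ /=; rewrite lee_fin ler_norm.
Qed.

Lemma isL2_cpt k (f : R -> 'cV[C]_k) : isL2 f -> forall b i,
  int01 (fun z => cpt b (f z i ord0)) /\ int01 (fun z => cpt b (f z i ord0) ^+ 2).
Proof.
move=> hf b i; have [mf _] := hf; have hs := int01_sqnorm hf.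
have mb : measurable_fun I01 (fun z => cpt b (f z i ord0)).
  by have [m1 m2] := mf i ord0; case: b.
have i2 : int01 (fun z => cpt b (f z i ord0) ^+ 2).
  apply: (int01_le _ _ hs); first exact: measurable_funX.
  move=> z _; rewrite ger0_norm ?sqr_ge0 // /sqnorm (bigD1 i) //=.
  apply: (@le_trans _ _ (complex.Re (f z i ord0) ^+ 2 + complex.Im (f z i ord0) ^+ 2)).
    by case: b {mb}; rewrite ?lerDl ?lerDr sqr_ge0.
  by rewrite lerDl; apply: sumr_ge0 => j _; rewrite addr_ge0 ?sqr_ge0.
split=> //; apply: (int01_le mb _ (int01D (int01_cst 1) i2)) => z _.
have := sqr_ge0 (`|cpt b (f z i ord0)| - 1); rewrite -(real_normK (num_real (cpt b _))).
set x := `|_|; have : 0 <= x by exact: normr_ge0.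
lra.
Qed.

Lemma measurable_rdot k (f g : R -> 'cV[C]_k) : entrywise (measurable_fun I01) f ->
  entrywise (measurable_fun I01) g -> measurable_fun I01 (fun z => rdot (f z) (g z)).
Proof.
move=> mf mg; apply: measurable_sum => i.
have [f1 f2] := mf i ord0; have [g1 g2] := mg i ord0.
by apply: measurable_funD; apply: measurable_funM.
Qed.

Lemma int01_rdot k (f g : R -> 'cV[C]_k) : isL2 f -> isL2 g ->
  int01 (fun z => rdot (f z) (g z)).
Proof.
move=> hf hg; have [mf _] := hf; have [mg _] := hg.
apply: (int01_le (measurable_rdot mf mg) (fun z _ => rdot_le (f z) (g z))).
by apply: int01Z; apply: int01D; exact: int01_sqnorm.
Qed.

Definition ip k (f g : R -> 'cV[C]_k) : R := \int[mu]_(z in I01) rdot (f z) (g z).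

Lemma ip_norm k (f : R -> 'cV[C]_k) : ip f f = l2norm f ^+ 2.
Proof. by rewrite sqr_l2norm; apply: eq_Rintegral => z _; rewrite rdot_sqnorm. Qed.

(** Young's inequality with weight [q / p], where [p] and [q] slightly exceed the two norms,
    which may vanish. *)
Lemma ip_le k (f g : R -> 'cV[C]_k) : isL2 f -> isL2 g -> `|ip f g| <= l2norm f * l2norm g.
Proof.
move=> hf hg.
have f0 := l2norm_ge0 f; have g0 := l2norm_ge0 g.
have young (w : R) : 0 < w -> `|ip f g| <= 2^-1 * (w * l2norm f ^+ 2 + w^-1 * l2norm g ^+ 2).
  move=> w0; have ih := int01_rdot hf hg.
  apply: (le_trans (le_normr_Rintegral _ ih)) => //.
  have i1 := int01Z w (int01_sqnorm hf); have i2 := int01Z w^-1 (int01_sqnorm hg).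
  have -> : 2^-1 * (w * l2norm f ^+ 2 + w^-1 * l2norm g ^+ 2) =
      \int[mu]_(z in I01) (2^-1 * (w * sqnorm (f z) + w^-1 * sqnorm (g z))).
    rewrite RintegralZl //; last exact: int01D.
    by rewrite RintegralD // !RintegralZl ?sqr_l2norm //; exact: int01_sqnorm.
  apply: le_Rintegral => //; [exact: int01_norm | by apply: int01Z; exact: int01D |].
  move=> z _; pose r := Num.sqrt w; have r0 : 0 < r by rewrite sqrtr_gt0.
  have r2 : r ^+ 2 = w by rewrite sqr_sqrtr // ltW.
  have h := rdot_le (r%:C *: f z) ((r^-1)%:C *: g z).
  rewrite rdotZl rdotZr mulrA divff ?gt_eqF // mul1r !sqnormZ /= !expr0n /= !addr0 in h.
  by rewrite exprVn r2 in h.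
apply/ler_addgt0Pr => e e0.
pose K := l2norm f + l2norm g + 1; have K0 : 0 < K by rewrite /K; lra.
pose d := Num.min 1 (e / K); have d0 : 0 < d by rewrite lt_min ltr01 divr_gt0.
have d1 : d <= 1 by rewrite ge_min lexx.
have dK : d * K <= e by rewrite -ler_pdivlMr // ge_min lexx orbT.
pose p := l2norm f + d; pose q := l2norm g + d.
have p0 : 0 < p by rewrite /p; lra.
have q0 : 0 < q by rewrite /q; lra.
apply: (le_trans (young (q / p) (divr_gt0 q0 p0))).
apply: (@le_trans _ _ (p * q)).
  have -> : p * q = 2^-1 * (q / p * p ^+ 2 + (q / p)^-1 * q ^+ 2) by field; rewrite !gt_eqF.
  rewrite ler_pM2l ?invr_gt0 //; apply: lerD; rewrite ler_wpM2l ?invr_ge0 ?divr_ge0 ?(ltW p0) ?(ltW q0) //.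
    by rewrite ler_pXn2r ?nnegrE // ?(ltW p0) // /p; lra.
  by rewrite ler_pXn2r ?nnegrE // ?(ltW q0) // /q; lra.
have -> : p * q = l2norm f * l2norm g + d * (l2norm f + l2norm g + d) by rewrite /p /q; ring.
by rewrite lerD2l; apply: le_trans dK; rewrite ler_pM2l // /K; lra.
Qed.

Lemma Linfty_cst p q (A : 'M[C]_(p, q)) : Linfty (fun _ : R => A).
Proof.
split=> [i j|]; first by split; exact: measurable_cst.
exists (\sum_i \sum_j Normc.normc (A i j)); apply: ae01T => _ i j.
rewrite lecR (bigD1 i) //= (bigD1 j) //= -addrA lerDl addr_ge0 //.
  by apply: sumr_ge0 => j' _; exact: normc_ge0.
by apply: sumr_ge0 => i' _; apply: sumr_ge0 => j' _; exact: normc_ge0.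
Qed.

Lemma meas_mulmx p q (A : R -> 'M[C]_(p, q)) (f : R -> 'cV[C]_q) :
  entrywise (measurable_fun I01) A -> entrywise (measurable_fun I01) f ->
  entrywise (measurable_fun I01) (fun z => A z *m f z).
Proof.
move=> mA mf i j; split.
- have -> : (fun z => complex.Re ((A z *m f z) i j)) = (fun z => \sum_(k < q)
      (complex.Re (A z i k) * complex.Re (f z k j) - complex.Im (A z i k) * complex.Im (f z k j))).
    apply/funext => z; rewrite mxE -[LHS]/(cpt false _) cpt_sum.
    by apply: eq_bigr => k _; case: (A z i k) (f z k j) => ? ? [].
  apply: measurable_sum => k; have [a1 a2] := mA i k; have [f1 f2] := mf k j.
  by apply: measurable_funB; apply: measurable_funM.
- have -> : (fun z => complex.Im ((A z *m f z) i j)) = (fun z => \sum_(k < q)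
      (complex.Re (A z i k) * complex.Im (f z k j) + complex.Im (A z i k) * complex.Re (f z k j))).
    apply/funext => z; rewrite mxE -[LHS]/(cpt true _) cpt_sum.
    by apply: eq_bigr => k _; case: (A z i k) (f z k j) => ? ? [].
  apply: measurable_sum => k; have [a1 a2] := mA i k; have [f1 f2] := mf k j.
  by apply: measurable_funD; apply: measurable_funM.
Qed.

Lemma ae_le_int01 (f g : R -> R) : measurable_fun I01 f -> int01 g ->
  ae01 (fun z => `|f z| <= g z) -> int01 f.
Proof.
move=> mf /integrableP[mg hg] h; apply/integrableP; split; first exact/measurable_EFinP.
apply: le_lt_trans hg; apply: ae_ge0_le_integral => //.
- by apply: measurableT_comp => //; exact/measurable_EFinP.
- by apply: measurableT_comp.
by apply: (ae01S _ h) => z _ hz /=; rewrite lee_fin (le_trans hz) // ler_norm.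
Qed.

Lemma isL2_mulmx p q (A : R -> 'M[C]_(p, q)) : Linfty A ->
  exists2 c : R, 0 < c & forall f : R -> 'cV[C]_q, isL2 f ->
    isL2 (fun z => A z *m f z) /\ l2norm (fun z => A z *m f z) <= c * l2norm f.
Proof.
move=> [mA [M HM]]; pose M' := `|M|.
have M'0 : 0 <= M' by exact: normr_ge0.
pose c0 := p%:R * (q%:R * M') ^+ 2; have c00 : 0 <= c0 by rewrite mulr_ge0 // sqr_ge0.
exists (Num.sqrt c0 + 1); first by rewrite ltr_wpDl // sqrtr_ge0.
move=> f hf; have [mf _] := hf.
have hA : ae01 (fun z => sqnorm (A z *m f z) <= c0 * sqnorm (f z)).
  apply: (ae01S _ HM) => z _ hz; apply: sqnorm_mulmx => // i j.
  by apply: (le_trans (hz i j)); rewrite lecR ler_norm.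
have mAf := meas_mulmx mA mf.
have isq : int01 (fun z => sqnorm (A z *m f z)).
  apply: (ae_le_int01 (measurable_sqnorm mAf) (int01Z c0 (int01_sqnorm hf))).
  by apply: (ae01S _ hA) => z _; rewrite ger0_norm // sqnorm_ge0.
have hAf := isL2P mAf isq; split=> //.
apply: (@le_trans _ _ (Num.sqrt c0 * l2norm f)); last first.
  by rewrite ler_wpM2r ?l2norm_ge0 // lerDl.
rewrite /l2norm -sqrtrM // ler_sqrt; last first.
  by rewrite mulr_ge0 // Rintegral_ge0 // => z _; exact: sqnorm_ge0.
rewrite -RintegralZl //; last exact: int01_sqnorm.
have k1 : (\int[mu]_(z in I01) (sqnorm (A z *m f z))%:E)%E \is a fin_num.
  by apply: integrable_fin_num isq; exact: measurable_itv.
have k2 : (\int[mu]_(z in I01) (c0 * sqnorm (f z))%:E)%E \is a fin_num.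
  by apply: integrable_fin_num (int01Z c0 (int01_sqnorm hf)); exact: measurable_itv.
rewrite -lee_fin /Rintegral !fineK //.
apply: ae_ge0_le_integral => //.
- by move=> z _; rewrite lee_fin sqnorm_ge0.
- by apply/measurable_EFinP; exact: measurable_sqnorm.
- by move=> z _; rewrite lee_fin mulr_ge0 // sqnorm_ge0.
- exact: measurable_int (int01Z c0 (int01_sqnorm hf)).
Qed.

End L2_operations.

(** * Vector-valued Sobolev functions *)

Section vector_H1.
Context (R : realType).
Local Notation mu := (@lebesgue_measure R).
Local Notation I01 := (`]0%R, 1%R[%classic : set R).
Local Notation C := R[i].

Lemma int01_sum (I : Type) (r : seq I) (f : I -> R -> R) :
  (forall i, int01 (f i)) -> int01 (fun z => \sum_(i <- r) f i z) /\
  \int[mu]_(z in I01) (\sum_(i <- r) f i z) = \sum_(i <- r) \int[mu]_(z in I01) f i z.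
Proof.
move=> hf; elim: r => [|i r [IH1 IH2]].
  split; first by under [X in int01 X]eq_fun do rewrite big_nil; exact: int01_cst.
  by under eq_Rintegral do rewrite big_nil; rewrite Rintegral_cst // mul0r big_nil.
split.
  by under [X in int01 X]eq_fun do rewrite big_cons; exact: int01D.
rewrite big_cons -IH2 -RintegralD //; first by apply: eq_Rintegral => z _; rewrite big_cons.
exact: hf.
Qed.

Lemma ac_sum (I : Type) (r : seq I) (F f : I -> R -> R) : (forall i, ac (F i) (f i)) ->
  ac (fun z => \sum_(i <- r) F i z) (fun z => \sum_(i <- r) f i z).
Proof.
move=> hF; elim: r => [|i r IH].
  under [X in ac X]eq_fun do rewrite big_nil.
  under [X in ac _ X]eq_fun do rewrite big_nil.
  exact: ac_cst.
under [X in ac X]eq_fun do rewrite big_cons.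
under [X in ac _ X]eq_fun do rewrite big_cons.
exact: acD.
Qed.

Definition vac k (F f : R -> 'cV[C]_k) : Prop :=
  forall b i, ac (fun z => cpt b (F z i ord0)) (fun z => cpt b (f z i ord0)).

Lemma vac_rdot k (F f G g : R -> 'cV[C]_k) : vac F f -> vac G g ->
  ac (fun z => rdot (F z) (G z)) (fun z => rdot (f z) (G z) + rdot (F z) (g z)).
Proof.
move=> hF hG.
have := @ac_sum _ (index_enum 'I_k)
  (fun i z => complex.Re (F z i ord0) * complex.Re (G z i ord0) +
              complex.Im (F z i ord0) * complex.Im (G z i ord0))
  (fun i z => (complex.Re (f z i ord0) * complex.Re (G z i ord0) +
               complex.Re (F z i ord0) * complex.Re (g z i ord0)) +
              (complex.Im (f z i ord0) * complex.Im (G z i ord0) +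
               complex.Im (F z i ord0) * complex.Im (g z i ord0))).
have H i : ac (fun z => complex.Re (F z i ord0) * complex.Re (G z i ord0) +
              complex.Im (F z i ord0) * complex.Im (G z i ord0))
  (fun z => (complex.Re (f z i ord0) * complex.Re (G z i ord0) +
               complex.Re (F z i ord0) * complex.Re (g z i ord0)) +
              (complex.Im (f z i ord0) * complex.Im (G z i ord0) +
               complex.Im (F z i ord0) * complex.Im (g z i ord0))).
  apply: acD.
    by apply: acM; [exact: (hF false i) | exact: (hG false i)].
  by apply: acM; [exact: (hF true i) | exact: (hG true i)].
move=> /(_ H); congr ac; apply/funext => z.
by rewrite /rdot -big_split /=; apply: eq_bigr => i _; ring.
Qed.

Lemma weak_derivativeP k (f g : R -> 'cV[C]_k) : weak_derivative f g <->
  forall b i, wderivative (fun z => cpt b (f z i ord0)) (fun z => cpt b (g z i ord0)).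
Proof.
split=> [H b i phi tphi|H phi tphi i].
  by have [h1 h2] := H phi tphi i; case: b.
by split; [exact: (H false i phi tphi) | exact: (H true i phi tphi)].
Qed.

Lemma H1_wderiv k (f : R -> 'cV[C]_k) : H1 f ->
  isL2 (wderiv f) /\ weak_derivative f (wderiv f).
Proof.
move=> [hf [g hg fg]]; rewrite /wderiv.
by apply: (@xgetPex _ (0 : R -> 'cV[C]_k) [set g | isL2 g /\ weak_derivative f g]); exists g.
Qed.

Lemma ae01_cpt k (f g : R -> 'cV[C]_k) :
  (forall b i, ae01 (fun z => cpt b (f z i ord0) = cpt b (g z i ord0))) ->
  ae01 (fun z => f z = g z).
Proof.
move=> H.
have Hs (s : seq 'I_k) : ae01 (fun z => forall i, i \in s -> f z i ord0 = g z i ord0).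
  elim: s => [|i s IH]; first exact: ae01T.
  have H1 : ae01 (fun z => f z i ord0 = g z i ord0).
    by apply: (ae01S2 _ (H false i) (H true i)) => z _ h1 h2; apply: cpt_ext => -[].
  apply: (ae01S2 _ H1 IH) => z _ h1 h2 j; rewrite inE => /predU1P[->//|]; exact: h2.
apply: (ae01S _ (Hs (enum 'I_k))) => z _ h; apply/matrixP => i j.
by rewrite (ord1 j); apply: h; rewrite mem_enum.
Qed.

Lemma wderiv_uniq k (f g : R -> 'cV[C]_k) : H1 f -> isL2 g -> weak_derivative f g ->
  ae01 (fun z => wderiv f z = g z).
Proof.
move=> hf hg /weak_derivativeP fg; have [hw /weak_derivativeP fw] := H1_wderiv hf.
have [hf2 _] := hf.
apply: ae01_cpt => b i; apply: wderivative_uniq (fw b i) (fg b i).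
- by have [] := isL2_cpt hf2 b i.
- by have [] := isL2_cpt hw b i.
- by have [] := isL2_cpt hg b i.
Qed.

Lemma trace_ae k (f f' : R -> 'cV[C]_k) : ae01 (fun z => f z = f' z) -> trace f = trace f'.
Proof.
move=> ff'; rewrite /trace; apply/funext => a; congr (xget _ _ a).
apply/seteqP; split=> F /= [cF Ff]; split=> //.
  by apply: (ae01S2 _ Ff ff') => z _ -> ->.
by apply: (ae01S2 _ Ff ff') => z _ -> ->.
Qed.

(** Traces and integration by parts can be computed on the absolutely continuous
    representative [F], whose components come from [wderivative_ac]. *)
Lemma H1_rep k (f : R -> 'cV[C]_k) : H1 f -> exists F, [/\ vac F (wderiv f),
  ae01 (fun z => F z = f z) & forall a, 0 <= a <= 1 -> trace f a = F a].
Proof.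
move=> hf; have [hf2 _] := hf; have [hw /weak_derivativeP fw] := H1_wderiv hf.
have Hbi (bi : bool * 'I_k) : exists F, ac F (fun z => cpt bi.1 (wderiv f z bi.2 ord0)) /\
    ae01 (fun z => F z = cpt bi.1 (f z bi.2 ord0)).
  have [i1 _] := isL2_cpt hf2 bi.1 bi.2; have [i2 _] := isL2_cpt hw bi.1 bi.2.
  by have [F aF Ff] := wderivative_ac i1 i2 (fw bi.1 bi.2); exists F.
have [F0 HF0] := choice Hbi.
pose F z : 'cV[C]_k := \col_i ((F0 (false, i) z) +i* (F0 (true, i) z))%C.
have FE b i : (fun z => cpt b (F z i ord0)) = F0 (b, i).
  by apply/funext => z; rewrite mxE; case: b.
have vF : vac F (wderiv f) by move=> b i; rewrite FE; have [] := HF0 (b, i).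
have Ff : ae01 (fun z => F z = f z).
  apply: ae01_cpt => b i; have [_ h] := HF0 (b, i).
  by apply: (ae01S _ h) => z _; rewrite -(FE b i).
exists F; split=> // a a01.
have cF : entrywise (fun u => {within `[0, 1], continuous u}) F.
  move=> i j; rewrite (ord1 j); split.
    exact: ac_continuous (vF false i).
  exact: ac_continuous (vF true i).
rewrite /trace; set S := [set F | _].
have [cG Gf] : S (xget (0 : R -> 'cV[C]_k) S) by apply: xgetPex; exists F.
set G := xget _ _ in cG Gf *.
apply/matrixP => i j; rewrite (ord1 j); apply: cpt_ext => b.
apply: (@cont01_ae_eq _ (fun z => cpt b (G z i ord0)) (fun z => cpt b (F z i ord0))) => //.
- by have [h1 h2] := cG i ord0; case: b.
- by have [h1 h2] := cF i ord0; case: b.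
by apply: (ae01S2 _ Gf Ff) => z _ -> ->.
Qed.

(** The domains of the operators are described by representatives of classes, which are
    determined only almost everywhere. *)
Lemma H1_ae k (f f' : R -> 'cV[C]_k) : H1 f -> isL2 f' -> ae01 (fun z => f z = f' z) ->
  H1 f' /\ ae01 (fun z => wderiv f' z = wderiv f z).
Proof.
move=> hf hf' ff'; have [hw fw] := H1_wderiv hf; have [hf2 _] := hf.
have w' : weak_derivative f' (wderiv f).
  apply/weak_derivativeP => b i; move/weak_derivativeP : fw => /(_ b i).
  apply: wderivative_ae.
  - by have [] := isL2_cpt hf2 b i.
  - by have [] := isL2_cpt hf' b i.
  - by apply: (ae01S _ ff') => z _ ->.
have h' : H1 f' by split=> //; exists (wderiv f).
by split=> //; exact: wderiv_uniq.
Qed.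

Lemma isL2B k (f g : R -> 'cV[C]_k) : isL2 f -> isL2 g -> isL2 (fun z => f z - g z).
Proof.
move=> hf hg; have := isL2_D hf (isL2_Z (-1) hg); congr isL2; apply/funext => z.
rewrite -[LHS]/(f z + (-1) *: g z) scaleN1r //.
Qed.

Lemma isL2Z k (a : C) (f : R -> 'cV[C]_k) : isL2 f -> isL2 (fun z => a *: f z).
Proof. exact: isL2_Z. Qed.

Lemma isL2D k (f g : R -> 'cV[C]_k) : isL2 f -> isL2 g -> isL2 (fun z => f z + g z).
Proof. exact: isL2_D. Qed.

Lemma H1B k (f g : R -> 'cV[C]_k) : H1 f -> H1 g ->
  H1 (fun z => f z - g z) /\
  ae01 (fun z => wderiv (fun z => f z - g z) z = wderiv f z - wderiv g z).
Proof.
move=> hf hg; have [hf' /weak_derivativeP wf] := H1_wderiv hf.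
have [hg' /weak_derivativeP wg] := H1_wderiv hg; have [hf2 _] := hf; have [hg2 _] := hg.
have w : weak_derivative (fun z => f z - g z) (fun z => wderiv f z - wderiv g z).
  apply/weak_derivativeP => b i.
  have E (u v : R -> 'cV[C]_k) : (fun z => cpt b ((u z - v z) i ord0)) =
      (fun z => cpt b (u z i ord0) - cpt b (v z i ord0)).
    by apply/funext => z; rewrite !mxE cptD cptN.
  have [a1 _] := isL2_cpt hf2 b i; have [a2 _] := isL2_cpt hg2 b i.
  have [a3 _] := isL2_cpt hf' b i; have [a4 _] := isL2_cpt hg' b i.
  by rewrite !E; exact: wderivativeB.
have h : H1 (fun z => f z - g z).
  by split; [exact: isL2B | exists (fun z => wderiv f z - wderiv g z) => //; exact: isL2B].
by split=> //; apply: wderiv_uniq => //; exact: isL2B.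
Qed.

Lemma H1Z k (c : R) (f : R -> 'cV[C]_k) : H1 f ->
  H1 (fun z => c%:C *: f z) /\
  ae01 (fun z => wderiv (fun z => c%:C *: f z) z = c%:C *: wderiv f z).
Proof.
move=> hf; have [hf' /weak_derivativeP wf] := H1_wderiv hf; have [hf2 _] := hf.
have w : weak_derivative (fun z => c%:C *: f z) (fun z => c%:C *: wderiv f z).
  apply/weak_derivativeP => b i.
  have E (u : R -> 'cV[C]_k) : (fun z => cpt b ((c%:C *: u z) i ord0)) =
      (fun z => c * cpt b (u z i ord0)).
    by apply/funext => z; rewrite !mxE cptZ.
  have [a1 _] := isL2_cpt hf2 b i; have [a3 _] := isL2_cpt hf' b i.
  by rewrite !E; exact: wderivativeZ.
have h : H1 (fun z => c%:C *: f z).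
  by split; [exact: isL2Z | exists (fun z => c%:C *: wderiv f z) => //; exact: isL2Z].
by split=> //; apply: wderiv_uniq => //; exact: isL2Z.
Qed.

Lemma isL2_col p q (f : R -> 'cV[C]_p) (g : R -> 'cV[C]_q) : isL2 f -> isL2 g ->
  isL2 (fun z => col_mx (f z) (g z)).
Proof.
move=> hf hg; have [mf _] := hf; have [mg _] := hg; apply: isL2P.
  move=> i j; have [i' ->|i' ->] := split_ordP i.
    rewrite (_ : (fun z => complex.Re _) = (fun z => complex.Re (f z i' j))); last first.
      by apply/funext => z; rewrite col_mxEu.
    rewrite (_ : (fun z => complex.Im _) = (fun z => complex.Im (f z i' j))); last first.
      by apply/funext => z; rewrite col_mxEu.
    exact: mf.
  rewrite (_ : (fun z => complex.Re _) = (fun z => complex.Re (g z i' j))); last first.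
    by apply/funext => z; rewrite col_mxEd.
  rewrite (_ : (fun z => complex.Im _) = (fun z => complex.Im (g z i' j))); last first.
    by apply/funext => z; rewrite col_mxEd.
  exact: mg.
under [X in int01 X]eq_fun do rewrite sqnorm_col.
by apply: int01D; exact: int01_sqnorm.
Qed.

Lemma H1_col p q (f : R -> 'cV[C]_p) (g : R -> 'cV[C]_q) : H1 f -> H1 g ->
  H1 (fun z => col_mx (f z) (g z)) /\
  ae01 (fun z => wderiv (fun z => col_mx (f z) (g z)) z = col_mx (wderiv f z) (wderiv g z)).
Proof.
move=> hf hg; have [hf' /weak_derivativeP wf] := H1_wderiv hf.
have [hg' /weak_derivativeP wg] := H1_wderiv hg; have [hf2 _] := hf; have [hg2 _] := hg.
have w : weak_derivative (fun z => col_mx (f z) (g z)) (fun z => col_mx (wderiv f z) (wderiv g z)).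
  apply/weak_derivativeP => b i; case: (split_ordP i) => i' ->.
    have E (u : R -> 'cV[C]_p) (v : R -> 'cV[C]_q) :
      (fun z => cpt b ((col_mx (u z) (v z)) (lshift q i') ord0)) = (fun z => cpt b (u z i' ord0)).
      by apply/funext => z; rewrite col_mxEu.
    by rewrite !E; exact: wf.
  have E (u : R -> 'cV[C]_p) (v : R -> 'cV[C]_q) :
    (fun z => cpt b ((col_mx (u z) (v z)) (rshift p i') ord0)) = (fun z => cpt b (v z i' ord0)).
    by apply/funext => z; rewrite col_mxEd.
  by rewrite !E; exact: wg.
have h : H1 (fun z => col_mx (f z) (g z)).
  by split; [exact: isL2_col | exists (fun z => col_mx (wderiv f z) (wderiv g z)) => //; exact: isL2_col].
by split=> //; apply: wderiv_uniq => //; exact: isL2_col.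
Qed.

Lemma vac_meas k (F f : R -> 'cV[C]_k) : vac F f -> entrywise (measurable_fun I01) F.
Proof.
move=> hF i j; rewrite (ord1 j); split; apply: cont01_meas.
  exact: ac_continuous (hF false i).
exact: ac_continuous (hF true i).
Qed.

Lemma vac_sup k (F f : R -> 'cV[C]_k) : vac F f -> isL2 F -> isL2 f ->
  forall t, 0 <= t <= 1 -> sqnorm (F t) <= 3 * l2norm F ^+ 2 + 2 * l2norm f ^+ 2.
Proof.
move=> hF iF i_f t t01.
have E (g : R -> 'cV[C]_k) : isL2 g -> l2norm g ^+ 2 = \sum_(i < k)
    (\int[mu]_(z in I01) complex.Re (g z i ord0) ^+ 2 + \int[mu]_(z in I01) complex.Im (g z i ord0) ^+ 2).
  move=> hg; rewrite sqr_l2norm.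
  have [h1 h2] := @int01_sum _ (index_enum 'I_k) (fun i z =>
    complex.Re (g z i ord0) ^+ 2 + complex.Im (g z i ord0) ^+ 2)
    (fun i => int01D (isL2_cpt hg false i).2 (isL2_cpt hg true i).2).
  rewrite h2; apply: eq_bigr => i _; rewrite RintegralD //.
    exact: (isL2_cpt hg false i).2.
  exact: (isL2_cpt hg true i).2.
rewrite !E // !mulr_sumr -big_split /=; apply: ler_sum => i _.
have h1 := ac_sup (hF false i) (isL2_cpt i_f false i).2 t01.
have h2 := ac_sup (hF true i) (isL2_cpt i_f true i).2 t01.
move: h1 h2; rewrite /=; lra.
Qed.

End vector_H1.

(** * Completeness of L2 *)

Section riesz_fischer_scalar.
Context (R : realType).
Local Notation mu := (@lebesgue_measure R).
Local Notation I01 := (`]0%R, 1%R[%classic : set R).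

Lemma fatou_bound (g : nat -> R -> R) (G : R -> R) (c : R) :
  (forall k z, 0 <= g k z) -> (forall k, int01 (g k)) ->
  (forall k, \int[mu]_(z in I01) g k z <= c) ->
  measurable_fun I01 G -> (forall z, 0 <= G z) ->
  ae01 (fun z => g^~ z @ \oo --> G z) -> int01 G /\ \int[mu]_(z in I01) G z <= c.
Proof.
move=> g0 ig gc mG G0 gG.
have mg k : measurable_fun I01 (fun z => (g k z)%:E).
  by apply/measurable_EFinP; exact: int01_meas.
have eqg k : (\int[mu]_(z in I01) (g k z)%:E = (\int[mu]_(z in I01) g k z)%:E)%E.
  rewrite /Rintegral fineK //; apply: integrable_fin_num (ig k); exact: measurable_itv.
have hle : (\int[mu]_(z in I01) (G z)%:E <= c%:E)%E.
  apply: (@le_trans _ _ (\int[mu]_(z in I01) limn_einf (fun k => (g k z)%:E))%E).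
    apply: ae_ge0_le_integral => //.
    - by move=> z _; rewrite lee_fin.
    - exact/measurable_EFinP.
    - move=> z _; rewrite limn_einf_lim; apply: lime_ge; first exact: is_cvg_einfs.
      near=> k; apply: le_ereal_inf_tmp => _ [j _ <-]; by rewrite lee_fin.
    - rewrite (_ : (fun z => _) = (fun z => - limn_esup (fun k => (- (g k z))%:E))%E).
        apply: measurableT_comp => //; apply: measurable_fun_limn_esup => k.
        by apply/measurable_EFinP; apply: measurableT_comp => //; exact: int01_meas.
      by [].
    apply: (ae01S _ gG) => z _ h; rewrite is_cvg_limn_einfE.
      rewrite le_eqVlt; apply/orP; left; apply/eqP/esym/cvg_lim => //.
      by apply/cvg_EFin; [exact: nearW | exact: h].
    by apply: (@cvgP _ _ (G z)%:E); apply/cvg_EFin; [exact: nearW | exact: h].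
  apply: le_trans; first apply: fatou => //.
    by move=> k z _; rewrite lee_fin.
  rewrite limn_einf_lim; apply: lime_le; first exact: is_cvg_einfs.
  near=> k; apply: (@le_trans _ _ (\int[mu]_(z in I01) (g k z)%:E)%E).
    by apply: ereal_inf_lbound; exists k => //=.
  by rewrite eqg lee_fin.
have iG : int01 G.
  apply/integrableP; split; first exact/measurable_EFinP.
  apply: (le_lt_trans _ (ltry c)); apply: le_trans hle.
  by under eq_integral do rewrite /= ger0_norm //.
split=> //; rewrite -lee_fin /Rintegral fineK //.
by apply: integrable_fin_num iG; exact: measurable_itv.
Unshelve. all: by end_near. Qed.

(** The sum of the absolute increments has a finite integral, so it is finite almost
    everywhere. *)
Lemma ae_cvg_of_summable (h : nat -> R -> R) : (forall k, int01 (h k)) ->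
  (forall k, \int[mu]_(z in I01) `|h k.+1 z - h k z| <= 2^-1 ^+ k) ->
  ae01 (fun z => cvgn (h^~ z)).
Proof.
move=> ih hs; pose d k z : R := `|h k.+1 z - h k z|.
have i_d k : int01 (d k) by apply: int01_norm; exact: int01B.
have d0 k z : 0 <= d k z by exact: normr_ge0.
have mE k : measurable_fun I01 (fun z => (d k z)%:E).
  by apply/measurable_EFinP; exact: int01_meas.
have eqd k : (\int[mu]_(z in I01) (d k z)%:E = (\int[mu]_(z in I01) d k z)%:E)%E.
  rewrite /Rintegral fineK //; apply: integrable_fin_num (i_d k); exact: measurable_itv.
have T2 : (\int[mu]_(z in I01) (\sum_(k <oo) (d k z)%:E) <= 2%:E)%E.
  rewrite integral_nneseries //; last by move=> k z _; rewrite lee_fin.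
  apply: lime_le.
    by apply: is_cvg_nneseries => k _ _; apply: integral_ge0 => z _; rewrite lee_fin.
  apply: nearW => N; under eq_bigr do rewrite eqd.
  rewrite sumEFin lee_fin; apply: (@le_trans _ _ (\sum_(0 <= k < N) (2^-1 : R) ^+ k)).
    by apply: ler_sum => k _; exact: hs.
  have -> : \sum_(0 <= k < N) (2^-1 : R) ^+ k = 2 - 2 * 2^-1 ^+ N.
    elim: N => [|N IH]; first by rewrite big_geq // expr0; ring.
    by rewrite big_nat_recr //= IH exprS; field.
  by rewrite gerBl mulr_ge0 // exprn_ge0 // invr_ge0.
have iT : mu.-integrable I01 (fun z => \sum_(k <oo) (d k z)%:E)%E.
  apply/integrableP; split.
    apply: ge0_emeasurable_sum; first by move=> k z _ _; rewrite lee_fin.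
    by move=> k _; exact: mE.
  apply: (le_lt_trans _ (ltry 2)); apply: le_trans T2.
  under eq_integral => z _.
    rewrite gee0_abs; last by apply: nneseries_ge0 => k _ _; rewrite lee_fin.
    over.
  by [].
have aeT : ae01 (fun z => (\sum_(k <oo) (d k z)%:E)%E \is a fin_num).
  by apply: integrable_ae iT; exact: measurable_itv.
apply: (ae01S _ aeT) => z _ Tz.
have cs : cvgn [normed series (fun k => h k.+1 z - h k z)].
  apply: nondecreasing_is_cvgn.
    apply/nondecreasing_seqP => k; rewrite /= !seriesEnat /= big_nat_recr //= lerDl //.
  exists (fine (\sum_(k <oo) (d k z)%:E)%E) => _ [N _ <-] /=.
  rewrite -lee_fin fineK // seriesEnat /= -sumEFin.
  by apply: nneseries_lim_ge => k _ _; rewrite lee_fin.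
have /cvg_ex[l hl] := normed_cvg cs.
apply: (@cvgP _ _ (l + h 0%N z)).
have -> : h^~ z = (fun k => series (fun k => h k.+1 z - h k z) k + h 0%N z).
  by apply/funext => k; rewrite -/(telescope (h^~ z)) telescopeK /= subrK.
by apply: cvgD => //; exact: cvg_cst.
Qed.

End riesz_fischer_scalar.

Section L2_classes.
Context (R : realType) (k : nat).
Local Notation mu := (@lebesgue_measure R).
Local Notation I01 := (`]0%R, 1%R[%classic : set R).
Local Notation C := R[i].
Implicit Types (x y : L2 R k) (f g : R -> 'cV[C]_k).

Lemma ae01_all (I : finType) (P : I -> R -> Prop) :
  (forall i, ae01 (P i)) -> ae01 (fun z => forall i, P i z).
Proof.
move=> H; have Hs (s : seq I) : ae01 (fun z => forall i, i \in s -> P i z).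
  elim: s => [|i s IH]; first exact: ae01T.
  by apply: (ae01S2 _ (H i) IH) => z _ h1 h2 j; rewrite inE => /predU1P[->//|]; exact: h2.
by apply: (ae01S _ (Hs (enum I))) => z _ h i; apply: h; rewrite mem_enum.
Qed.

Lemma L2rep_isL2 x : isL2 (L2rep x).
Proof. exact: L2funP. Qed.

Definition L2mk f (hf : isL2 f) : L2fun R k := MkL2fun (asboolT hf : f \in @L2pred R k).

Lemma L2mk_rep f (hf : isL2 f) : ae01 (fun z => L2rep (L2class (L2mk hf)) z = f z).
Proof. exact: L2class_rep. Qed.

Lemma L2_ext x y : ae01 (fun z => L2rep x z = L2rep y z) -> x = y.
Proof. by move=> h; rewrite -(L2repK x) -(L2repK y); apply/L2classE. Qed.

Lemma l2norm_ae_eq f g : isL2 f -> isL2 g -> ae01 (fun z => f z = g z) -> l2norm f = l2norm g.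
Proof. by move=> hf hg h; exact: (@l2norm_ae _ _ (L2mk hf) (L2mk hg)). Qed.

Lemma L2repD x y : ae01 (fun z => L2rep (x + y) z = L2rep x z + L2rep y z).
Proof.
have E : x + y = L2class (repr x + repr y) by rewrite L2classD !L2repK.
by rewrite E; exact: L2class_rep.
Qed.

Lemma L2repB x y : ae01 (fun z => L2rep (x - y) z = L2rep x z - L2rep y z).
Proof.
have E : x - y = L2class (repr x - repr y) by rewrite -{1}(L2repK x) -{1}(L2repK y) /L2class raddfB.
by rewrite E; exact: L2class_rep.
Qed.

Lemma L2repZ (a : C) x : ae01 (fun z => L2rep (a *: x) z = a *: L2rep x z).
Proof. exact: L2class_rep. Qed.

Lemma L2_rnorm x : rnorm x = l2norm (L2rep x).
Proof. by []. Qed.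

Lemma L2_rnormB x y : rnorm (x - y) = l2norm (fun z => L2rep x z - L2rep y z).
Proof.
by rewrite L2_rnorm; apply: l2norm_ae_eq (L2repB x y); [exact: L2rep_isL2 | apply: isL2B; exact: L2rep_isL2].
Qed.

Lemma int01_cpt_le f (b : bool) (i : 'I_k) (t : R) : isL2 f -> 0 < t -> l2norm f <= t ->
  \int[mu]_(z in I01) `|cpt b (f z i ord0)| <= t.
Proof.
move=> hf t0 ft; have [i1 i2] := isL2_cpt hf b i; have iq := int01_sqnorm hf.
have h : l2norm f ^+ 2 <= t ^+ 2 by rewrite ler_pXn2r ?nnegrE ?l2norm_ge0 // ltW.
rewrite sqr_l2norm in h.
apply: (@le_trans _ _ (\int[mu]_(z in I01) (2^-1 * t + (2 * t)^-1 * sqnorm (f z)))).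
  apply: le_Rintegral => //.
  - exact: int01_norm.
  - by apply: int01D; [exact: int01_cst | exact: int01Z].
  move=> z _; set c := `|_|.
  have cs : c ^+ 2 <= sqnorm (f z).
    rewrite /c real_normK ?num_real //; apply: le_trans (sqnorm_entry (f z) i).
    by rewrite -normc_sqr; case: b {i1 i2 c}; rewrite ?lerDl ?lerDr sqr_ge0.
  apply: (@le_trans _ _ (2^-1 * t + (2 * t)^-1 * c ^+ 2)).
    have := mulr_ge0 (ltW (_ : 0 < (2 * t)^-1)) (sqr_ge0 (c - t)).
    have -> : (2 * t)^-1 * (c - t) ^+ 2 = 2^-1 * t + (2 * t)^-1 * c ^+ 2 - c by field; rewrite gt_eqF.
    by rewrite subr_ge0; apply; rewrite invr_gt0 mulr_gt0.
  by rewrite lerD2l ler_wpM2l // invr_ge0 mulr_ge0 // ltW.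
rewrite RintegralD //; [|exact: int01_cst|exact: int01Z].
rewrite [X in X + _]Rintegral_cst // RintegralZl //.
have -> : fine (mu I01) = 1 by rewrite lebesgue_measure_itv /= lte_fin ltr01 /= subr0.
have := ler_wpM2l (_ : 0 <= (2 * t)^-1) h.
have -> : (2 * t)^-1 * t ^+ 2 = 2^-1 * t by field; rewrite gt_eqF.
move=> H; have {}H := H (ltW (_ : 0 < (2 * t)^-1)).
have : 0 < (2 * t)^-1 by rewrite invr_gt0 mulr_gt0.
move=> /H; lra.
Qed.

Lemma cvg_sqnorm (v : nat -> 'cV[C]_k) (w w0 : 'cV[C]_k) :
  (forall b i, cpt b (v j i ord0) @[j --> \oo] --> cpt b (w i ord0)) ->
  sqnorm (v j - w0) @[j --> \oo] --> sqnorm (w - w0).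
Proof.
move=> h; rewrite /sqnorm.
have E b (u : 'cV[C]_k) i : cpt b ((u - w0) i ord0) = cpt b (u i ord0) - cpt b (w0 i ord0).
  by rewrite !mxE cptD cptN.
apply: cvg_big => [|i _]; first exact: add_continuous.
under eq_fun do rewrite -!/(cpt false _) -!/(cpt true _) !E.
rewrite -!/(cpt false _) -!/(cpt true _) !E.
have hB b : cpt b (v j i ord0) - cpt b (w0 i ord0) @[j --> \oo] --> cpt b (w i ord0) - cpt b (w0 i ord0).
  by apply: cvgB; [exact: h | exact: cvg_cst].
by apply: cvgD; [exact: (cvgM (hB false) (hB false)) | exact: (cvgM (hB true) (hB true))].
Qed.

(** The theorem of Riesz and Fischer. A subsequence with summable increments converges almost
    everywhere, and Fatou's lemma bounds the distance of the limit to each function of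
    the original sequence. *)
Theorem L2_complete : rcomplete (L2 R k).
Proof.
move=> u cu.
have p2 j : 0 < (2^-1 : R) ^+ j by rewrite exprn_gt0 // invr_gt0.
have [N HN] := choice (fun j => cu _ (p2 j)).
pose phi j := (\sum_(l < j.+1) (N l).+1)%N.
have phiN j : (N j <= phi j)%N by rewrite /phi big_ord_recr /=; apply: leq_trans (leqnSn _) (leq_addl _ _).
have phij j : (j <= phi j)%N.
  elim: j => // j IH; rewrite /phi big_ord_recr /= -/(phi j) addnS ltnS.
  exact: leq_trans IH (leq_addr _ _).
have phiS j : (phi j <= phi j.+1)%N by rewrite {2}/phi big_ord_recr /=; exact: leq_addr.
pose v j := L2rep (u (phi j)).
have hv j : isL2 (v j) by exact: L2rep_isL2.
have dv j : l2norm (fun z => v j.+1 z - v j z) <= 2^-1 ^+ j.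
  rewrite -L2_rnormB; apply: HN; last exact: phiN.
  exact: leq_trans (phiN j) (phiS j).
pose h b i j z := cpt b (v j z i ord0).
have ih b i j : int01 (h b i j) by exact: (isL2_cpt (hv j) b i).1.
have aeh b i : ae01 (fun z => cvgn ((h b i)^~ z)).
  apply: ae_cvg_of_summable => // j.
  have := int01_cpt_le b i (isL2B (hv j.+1) (hv j)) (p2 j) (dv j).
  by under eq_Rintegral do rewrite !mxE cptD cptN.
(* The upper limit is measurable, and equals the limit wherever that exists. *)
pose Fs b i z := fine (limn_esup (fun j => (h b i j z)%:E)).
have mF b i : measurable_fun I01 (Fs b i).
  apply: (measurableT_comp (@fine_measurable R setT _)) => //.
  by apply: measurable_fun_limn_esup => j; apply/measurable_EFinP; exact: int01_meas.
have FsE b i : ae01 (fun z => (h b i)^~ z @ \oo --> Fs b i z).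
  apply: (ae01S _ (aeh b i)) => z _ /cvg_ex[l hl].
  have hE : (fun j => (h b i j z)%:E) @ \oo --> l%:E by apply/cvg_EFin; [exact: nearW | exact: hl].
  rewrite /Fs is_cvg_limn_esupE; last by apply: (@cvgP _ _ l%:E).
  by rewrite (cvg_lim _ hE).
pose F z : 'cV[C]_k := \col_i ((Fs false i z) +i* (Fs true i z))%C.
have cF : ae01 (fun z => forall b i, h b i j z @[j --> \oo] --> cpt b (F z i ord0)).
  have := @ae01_all _ (fun bi : bool * 'I_k => _) (fun bi => FsE bi.1 bi.2).
  by apply: ae01S => z _ hz b i; rewrite mxE; case: b; [exact: (hz (true, i)) | exact: (hz (false, i))].
have mFF : entrywise (measurable_fun I01) F.
  move=> i j; rewrite (ord1 j); split.
    rewrite (_ : (fun z => _) = Fs false i); first exact: mF.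
    by apply/funext => z; rewrite mxE.
  rewrite (_ : (fun z => _) = Fs true i); first exact: mF.
  by apply/funext => z; rewrite mxE.
have key p (c : R) n0 : 0 <= c -> (forall j, rnorm (u (phi (j + n0)%N) - u p) <= c) ->
    isL2 (fun z => F z - L2rep (u p) z) /\ l2norm (fun z => F z - L2rep (u p) z) <= c.
  move=> c0 hc.
  have mFp : entrywise (measurable_fun I01) (fun z => F z - L2rep (u p) z).
    have [mu_ _] := isL2Z (-1) (L2rep_isL2 (u p)).
    have := isL2_meas_D mFF mu_; congr (entrywise _ _); apply/funext => z.
    by rewrite -[LHS]/(F z + (-1) *: L2rep (u p) z) scaleN1r.
  pose g j z := sqnorm (v (j + n0)%N z - L2rep (u p) z).
  have ig j : int01 (g j) by apply: int01_sqnorm; apply: isL2B => //; exact: L2rep_isL2.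
  have gc j : \int[mu]_(z in I01) g j z <= c ^+ 2.
    rewrite -sqr_l2norm ler_pXn2r ?nnegrE ?l2norm_ge0 //.
    by rewrite -L2_rnormB.
  have gG : ae01 (fun z => g^~ z @ \oo --> sqnorm (F z - L2rep (u p) z)).
    apply: (ae01S _ cF) => z _ hz; apply: cvg_sqnorm => b i.
    by have := hz b i; rewrite -(@cvg_shiftn n0).
  have [i1 i2] := fatou_bound (fun j z => sqnorm_ge0 _) ig gc (measurable_sqnorm mFp)
    (fun z => sqnorm_ge0 _) gG.
  split; first exact: isL2P.
  by rewrite -(@ler_pXn2r _ 2) ?nnegrE ?l2norm_ge0 // sqr_l2norm.
have F2 : isL2 F.
  have [n0 Hn0] := cu _ ltr01.
  have [|h2 _] := key n0 1 n0 ler01.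
    by move=> j; apply: Hn0 => //; apply: leq_trans (phij _); rewrite leq_addl.
  have := isL2D h2 (L2rep_isL2 (u n0)).
  by congr isL2; apply/funext => z; rewrite subrK.
exists (L2class (L2mk F2)) => e e0; have [n0 Hn0] := cu e e0; exists n0 => p np.
have [|_ h2] := key p e n0 (ltW e0).
  by move=> j; apply: Hn0 => //; apply: leq_trans (phij _); rewrite leq_addl.
rewrite rnorm_distC L2_rnormB; apply: le_trans h2; rewrite le_eqVlt; apply/orP; left; apply/eqP.
apply: l2norm_ae_eq; [by apply: isL2B; exact: L2rep_isL2 | by apply: isL2B => //; exact: L2rep_isL2 |].
by apply: (ae01S _ (L2mk_rep F2)) => z _ ->.
Qed.

End L2_classes.

(** * Boundary conditions *)

Section boundary.
Context (R : realType).
Local Notation C := R[i].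

Lemma trmxCD p q (A B : 'M[C]_(p, q)) : (A + B)^t* = A^t* + B^t*.
Proof. by rewrite linearD map_mxD. Qed.

Lemma trmxCN p q (A : 'M[C]_(p, q)) : (- A)^t* = - A^t*.
Proof. by rewrite linearN map_mxN. Qed.

Lemma psdmx_rdot N (A : 'M[C]_N) (v : 'cV[C]_N) : psdmx A -> 0 <= rdot (A *m v) v.
Proof.
by move=> [_ /(_ v)]; rewrite rdotE mulmxA lecE => /andP[_].
Qed.

Lemma polarization N (u v : 'cV[C]_N) : sqnorm (u + v) - sqnorm (u - v) = 4 * rdot u v.
Proof.
by rewrite -!rdot_sqnorm !(rdotDl, rdotDr, rdotNl, rdotNr) (rdotC v u); ring.
Qed.

(** A Cayley transform. Put [A := W1 + W2] and [B := W1 - W2]. Positivity says that [A A^* - B B^*]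
    is positive, whence [A] is invertible by the rank condition and [A^-1 B] is a
    contraction. The equation reads [A (f + e) = - B (f - e)], so that [f + e] is not longer
    than [f - e], which is the claim. *)
Lemma psd_graph N (W1 W2 : 'M[C]_N) (f e : 'cV[C]_N) :
  row_free (row_mx W1 W2) -> psdmx (W1 *m W2^t* + W2 *m W1^t*) ->
  W1 *m f + W2 *m e = 0 -> rdot f e <= 0.
Proof.
move=> fr psd W0; pose A := W1 + W2; pose B := W1 - W2.
have AB v : sqnorm (B^t* *m v) <= sqnorm (A^t* *m v).
  have := psdmx_rdot v psd.
  rewrite mulmxDl -!mulmxA rdotDl (rdot_mxl W1) (rdot_mxl W2) (rdotC (W1^t* *m v)) => h.
  rewrite -subr_ge0 /A /B !trmxCD trmxCN !mulmxDl mulNmx polarization rdotC.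
  by rewrite mulr_ge0 //; lra.
have uA : A \in unitmx.
  rewrite -row_free_unit -kermx_eq0; apply/eqP/row_matrixP => i; rewrite row0.
  have kA : row i (kermx A) *m A = 0 by apply/sub_kermxP; exact: row_sub.
  set v := row i _ in kA *.
  have vA : A^t* *m v^t* = 0 by rewrite -trmxCM kA; apply/matrixP => a b; rewrite !mxE conjC0.
  have vB : B^t* *m v^t* = 0.
    apply: sqnorm_eq0; apply/eqP; rewrite eq_le sqnorm_ge0 andbT.
    by apply: (le_trans (AB _)); rewrite vA sqnorm0.
  have vB' : v *m B = 0.
    by rewrite -[LHS]trmxCK trmxCM vB; apply/matrixP => a b; rewrite !mxE conjC0.
  have two : (2 : C) != 0 by rewrite pnatr_eq0.
  have v12 : v *m W1 = v *m W2 by apply/eqP; rewrite -subr_eq0 -mulmxBr vB'.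
  have v1 : v *m W1 = 0.
    move/eqP : kA; rewrite mulmxDr -v12 -mulr2n -scaler_nat scaler_eq0 (negPf two).
    by move/eqP.
  by apply: (row_free_inj fr); rewrite mul0mx mul_mx_row -v12 v1 row_mx0.
pose s := f + e; pose d := f - e.
have Es : s = - (invmx A *m B *m d).
  rewrite -[s](mulKmx uA) -mulmxA -mulmxN; congr (_ *m _).
  apply/eqP; rewrite -subr_eq0 opprK; apply/eqP.
  have -> : A *m s + B *m d = (W1 *m f + W2 *m e) + (W1 *m f + W2 *m e).
    rewrite /A /B /s /d !mulmxDl !mulmxDr !mulNmx !mulmxN; zmod.
  by rewrite W0 addr0.
have h : sqnorm s <= sqnorm d.
  have := rdot_le (B^t* *m ((invmx A)^t* *m s)) d.
  have := AB ((invmx A)^t* *m s).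
  have -> : A^t* *m ((invmx A)^t* *m s) = s.
    by rewrite mulmxA -trmxCM mulVmx // trmx1 map_mx1 mul1mx.
  have : sqnorm s = - rdot (B^t* *m ((invmx A)^t* *m s)) d.
    by rewrite -rdot_sqnorm {2}Es rdotNr -mulmxA rdot_mxr rdot_mxr.
  move=> -> h1 /ler_normlP[h2 _]; lra.
by have := polarization f e; rewrite -/s -/d; lra.
Qed.

(** With [f := P (u1 - u0)] and [e := u1 + u0] the difference of the two quadratic forms is
    [rdot f e], and the boundary condition becomes a condition on [f] and [e] with the
    matrix [W]. *)
Lemma boundary_le N (P : 'M[C]_N) (Wt : 'M[C]_(N, N + N)) (u1 u0 : 'cV[C]_N) :
  P^t* = P -> P \in unitmx -> \rank Wt = N ->
  let W := (Num.sqrt 2)%:C *: (Wt *m invmx (block_mx P (- P) 1%:M 1%:M)) in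
  psdmx (W *m block_mx 0 1%:M 1%:M 0 *m W^t*) ->
  Wt *m col_mx u1 u0 = 0 -> rdot (P *m u1) u1 <= rdot (P *m u0) u0.
Proof.
move=> PH uP rk; set Q := block_mx P _ _ _ => W psd W0.
have uQ : Q \in unitmx.
  have two : (2^-1 + 2^-1 : C) = 1 by field.
  have : Q *m (2^-1 *: block_mx (invmx P) 1%:M (- invmx P) 1%:M) = 1%:M.
    rewrite -scalemxAr /Q mulmx_block !mul1mx !mulmx1 !mulmxN !mulNmx opprK mulmxV //.
    rewrite !subrr scale_block_mx !scaler0 !scalerDr -!scalerDl two !scale1r.
    by rewrite -scalar_mx_block.
  by move=> /mulmx1_unit[].
have sq2 : (Num.sqrt 2)%:C != 0 :> C by rewrite eq_complex /= eqxx andbT gt_eqF // sqrtr_gt0.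
have WQ u : W *m (Q *m u) = (Num.sqrt 2)%:C *: (Wt *m u).
  by rewrite /W -scalemxAl -mulmxA mulKmx.
have frW : row_free W.
  rewrite /row_free /W; apply/eqP; rewrite (eqmx_scale _ sq2) mxrankMfree //.
  by rewrite row_free_unit unitmx_inv.
have EW : W = row_mx (lsubmx W) (rsubmx W) by rewrite hsubmxK.
have h : rdot (P *m (u1 - u0)) (u1 + u0) <= 0.
  apply: (@psd_graph _ (lsubmx W) (rsubmx W)).
  - by rewrite -EW.
  - have -> : lsubmx W *m (rsubmx W)^t* + rsubmx W *m (lsubmx W)^t* =
        W *m block_mx 0 1%:M 1%:M 0 *m W^t* => //.
    rewrite [in RHS]EW mul_row_block !mulmx0 !mulmx1 add0r addr0.
    by rewrite tr_row_mx map_col_mx mul_row_col addrC.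
  - rewrite -mul_row_col -EW.
    have -> : col_mx (P *m (u1 - u0)) (u1 + u0) = Q *m col_mx u1 u0.
      by rewrite /Q mul_block_col !mul1mx mulNmx mulmxBr.
    by rewrite WQ W0 scaler0.
have E : rdot (P *m u1) u0 = rdot (P *m u0) u1 by rewrite rdot_mxl PH rdotC.
rewrite mulmxBr !(rdotDl, rdotDr, rdotNl, rdotNr) E in h; lra.
Qed.

(** This is how the rank of [G1] enters: [G1^* w'] determines [w']. *)
Lemma left_inverse_adj n r (G : 'M[C]_(n, r)) : \rank G = n ->
  exists B : 'M[C]_(n, r), B *m G^t* = 1%:M.
Proof.
move=> rk; have fr : row_free G by apply/eqP.
have [D GD] := row_freeP fr.
by exists (D^t*); rewrite -trmxCM GD trmx1 map_mx1.
Qed.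

End boundary.

(** * Pairings, products and cut-offs *)

Section L2_pairing.
Context (R : realType).
Local Notation mu := (@lebesgue_measure R).
Local Notation I01 := (`]0%R, 1%R[%classic : set R).
Local Notation C := R[i].

Lemma ip_ae k (f f' g g' : R -> 'cV[C]_k) : isL2 f -> isL2 f' -> isL2 g -> isL2 g' ->
  ae01 (fun z => f z = f' z) -> ae01 (fun z => g z = g' z) -> ip f g = ip f' g'.
Proof.
move=> hf hf' hg hg' ff gg; apply: ae_int01; [exact: int01_rdot | exact: int01_rdot |].
by apply: (ae01S2 _ ff gg) => z _ -> ->.
Qed.

Lemma ipDl k (f f' g : R -> 'cV[C]_k) : isL2 f -> isL2 f' -> isL2 g ->
  ip (fun z => f z + f' z) g = ip f g + ip f' g.
Proof.
move=> hf hf' hg; rewrite /ip -RintegralD //; [|exact: int01_rdot|exact: int01_rdot].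
by apply: eq_Rintegral => z _; rewrite rdotDl.
Qed.

Lemma ipZl k (c : R) (f g : R -> 'cV[C]_k) : isL2 f -> isL2 g ->
  ip (fun z => c%:C *: f z) g = c * ip f g.
Proof.
move=> hf hg; rewrite /ip -RintegralZl //; last exact: int01_rdot.
by apply: eq_Rintegral => z _; rewrite rdotZl.
Qed.

Lemma ipBl k (f f' g : R -> 'cV[C]_k) : isL2 f -> isL2 f' -> isL2 g ->
  ip (fun z => f z - f' z) g = ip f g - ip f' g.
Proof.
move=> hf hf' hg; rewrite /ip -RintegralB //; [|exact: int01_rdot|exact: int01_rdot].
by apply: eq_Rintegral => z _; rewrite rdotBl.
Qed.

Lemma ipC k (f g : R -> 'cV[C]_k) : ip f g = ip g f.
Proof. by apply: eq_Rintegral => z _; rewrite rdotC. Qed.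

Lemma vac_mulmx p q (A : 'M[C]_(p, q)) (F f : R -> 'cV[C]_q) : vac F f ->
  vac (fun z => A *m F z) (fun z => A *m f z).
Proof.
move=> hF b i.
have E (g : R -> 'cV[C]_q) : (fun z => cpt b ((A *m g z) i ord0)) = (fun z => \sum_(j < q)
    (complex.Re (A i j) * cpt b (g z j ord0) +
     (if b then 1 else -1) * complex.Im (A i j) * cpt (~~ b) (g z j ord0))).
  apply/funext => z; rewrite mxE cpt_sum; apply: eq_bigr => j _.
  by case: b; case: (A i j) (g z j ord0) => ? ? [? ?] /=; ring.
by rewrite !E; apply: ac_sum => j; apply: acD; apply: acZ; exact: hF.
Qed.

Lemma vacZ k (phi dphi : R -> R) (F f : R -> 'cV[C]_k) : ac phi dphi -> vac F f ->
  vac (fun z => (phi z)%:C *: F z) (fun z => (dphi z)%:C *: F z + (phi z)%:C *: f z).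
Proof.
move=> hphi hF b i; have := acM hphi (hF b i).
congr ac; apply/funext => z; first by rewrite !mxE cptZ.
by rewrite !mxE cptD !cptZ.
Qed.

Lemma isL2_scale k (phi : R -> R) (c : R) : measurable_fun I01 phi -> 0 <= c ->
  (forall z, 0 <= z <= 1 -> `|phi z| <= c) ->
  exists2 c' : R, 0 < c' & forall f : R -> 'cV[C]_k, isL2 f ->
    isL2 (fun z => (phi z)%:C *: f z) /\ l2norm (fun z => (phi z)%:C *: f z) <= c' * l2norm f.
Proof.
move=> mphi c0 hc.
have L : Linfty (fun z => ((phi z)%:C)%:M : 'M[C]_k).
  split=> [i j|].
    split.
      rewrite (_ : (fun z => _) = (fun z => phi z * (i == j)%:R)).
        by apply: measurable_funM => //; exact: measurable_cst.
      by apply/funext => z; rewrite mxE; case: eqP => _ /=; rewrite ?mulr1 ?mulr0.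
    rewrite (_ : (fun z => _) = cst 0); first exact: measurable_cst.
    by apply/funext => z; rewrite mxE; case: eqP.
  exists c; apply: aeW => z /= /[!in_itv]/= /andP[z0 z1] i j.
  have h := hc z _; rewrite mxE; case: eqP => _; rewrite ?mulr1n ?mulr0n ?normr0 ?lecR //.
  by rewrite /= expr0n /= addr0 sqrtr_sqr h // !ltW.
have [c' c'0 H] := isL2_mulmx L; exists c' => // f hf; have := H f hf.
rewrite (_ : (fun z => ((phi z)%:C)%:M *m f z) = (fun z => (phi z)%:C *: f z)) //.
by apply/funext => z; rewrite mul_scalar_mx.
Qed.

Lemma ac_id : ac (fun z : R => z) (fun=> 1).
Proof.
split; first exact: int01_cst.
by move=> t /andP[t0 _]; rewrite prim_cst // add0r mul1r.
Qed.

Lemma ac_pow N : ac (fun z : R => (2 * z - 1) ^+ N.+1) (fun z => 2 * N.+1%:R * (2 * z - 1) ^+ N).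
Proof.
have h1 : ac (fun z : R => 2 * z - 1) (fun=> 2).
  have := acB (acZ 2 ac_id) (ac_cst 1); congr ac; apply/funext => z; ring.
elim: N => [|N IH]; first by move: h1; congr ac; apply/funext => z; rewrite ?expr1 // expr0; ring.
have := acM IH h1; congr ac; apply/funext => z; first by rewrite -exprSr.
by rewrite !exprS -!natr1; ring.
Qed.

(** The polynomial [1 - (2 z - 1)^(2 N + 2)] serves, since the integral of [(2 z - 1)^(4 N + 4)]
    over the interval is [1 / (4 N + 5)]. *)
Lemma cutoff (eta : R) : 0 < eta -> exists chi dchi : R -> R, exists c : R,
  [/\ ac chi dchi, chi 0 = 0 /\ chi 1 = 0, forall z, 0 <= z <= 1 -> 0 <= chi z <= 1,
      0 <= c /\ forall z, 0 <= z <= 1 -> `|dchi z| <= c &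
      int01 (fun z => (1 - chi z) ^+ 2) /\ \int[mu]_(z in I01) (1 - chi z) ^+ 2 <= eta ^+ 2].
Proof.
move=> e0; have e2 : 0 < eta ^+ 2 by exact: exprn_gt0.
have [N /= HN] : exists N : nat, (eta ^+ 2)^-1 <= N.+1%:R.
  exists (Num.bound (eta ^+ 2)^-1); apply: ltW.
  apply: (lt_le_trans (archi_boundP _)); first by rewrite invr_ge0 ltW.
  by rewrite ler_nat.
exists (fun z => 1 - (2 * z - 1) ^+ (2 * N).+2), (fun z => 0 - 2 * (2 * N).+2%:R * (2 * z - 1) ^+ (2 * N).+1).
exists (2 * (2 * N).+2%:R).
have pow_le M (z : R) : 0 <= z <= 1 -> `|(2 * z - 1) ^+ M| <= 1.
  move=> /andP[z0 z1]; rewrite normrX exprn_ile1 // ler_norml; apply/andP; split; lra.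
have hE (z : R) : (2 * z - 1) ^+ (2 * N).+2 = ((2 * z - 1) ^+ 2) ^+ N.+1 by rewrite -exprM mulnS.
have [i1 h1] := ac_pow (4 * N).+4.
split.
- by apply: acB; [exact: ac_cst | exact: ac_pow].
- by rewrite !hE mulr0 mulr1 add0r sqrrN expr1n -[2 - 1]/(1 + 1 - 1) addrK !expr1n subrr.
- move=> z hz; have := pow_le (2 * N).+2 z hz; rewrite ler_norml => /andP[_ h].
  have : 0 <= (2 * z - 1) ^+ (2 * N).+2 by rewrite hE exprn_ge0 // sqr_ge0.
  by move=> h'; apply/andP; split; lra.
- split; first by rewrite mulr_ge0.
  by move=> z hz; rewrite sub0r normrN normrM ger0_norm ?mulr_ge0 // ler_piMr ?mulr_ge0 // pow_le.
- have E (z : R) : (1 - (1 - (2 * z - 1) ^+ (2 * N).+2)) ^+ 2 =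
      (2 * (4 * N).+4.+1%:R)^-1 * (2 * (4 * N).+4.+1%:R * (2 * z - 1) ^+ (4 * N).+4).
    rewrite opprB addrC subrK -exprM mulrA mulVf ?mul1r; last by rewrite mulf_neq0 ?pnatr_eq0.
    by rewrite muln2 !doubleS -muln2 mulnAC.
  under [X in int01 X]eq_fun do rewrite E.
  split; first exact: int01Z.
  under eq_Rintegral do rewrite E.
  rewrite RintegralZl //.
  have := h1 1; rewrite ler01 lexx => /(_ isT) /esym /(canRL (addKr _)).
  rewrite /prim => ->; rewrite mulr0 mulr1 add0r.
  have -> : (2 - 1 : R) = 1 by ring.
  have -> : (-1 : R) ^+ (4 * N).+4.+1 = -1.
    by rewrite -signr_odd /= oddM /= expr1.
  rewrite expr1n opprK; set M : R := (4 * N).+4.+1%:R.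
  have M0 : 0 < M by rewrite ltr0n.
  have -> : (2 * M)^-1 * (1 + 1) = M^-1.
    by rewrite invfM -[1 + 1]/(2 : R) mulrAC mulVf ?mul1r // pnatr_eq0.
  rewrite -[leRHS]invrK lef_pV2 ?posrE ?invr_gt0 //; apply: (le_trans HN).
  by rewrite ler_nat ltnS !leqW // leq_pmull.
Qed.

End L2_pairing.

(** * Square integrable functions and their classes *)

Lemma subrACA (V : zmodType) (a b c d : V) : a - b - (c - d) = a - c - (b - d).
Proof. by zmod. Qed.

Section L2_classes_of_functions.
Context (R : realType).
Local Notation mu := (@lebesgue_measure R).
Local Notation I01 := (`]0%R, 1%R[%classic : set R).
Local Notation C := R[i].

Lemma ae01_and (P Q : R -> Prop) : ae01 P -> ae01 Q -> ae01 (fun z => P z /\ Q z).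
Proof. by move=> hP hQ; apply: (ae01S2 _ hP hQ). Qed.

(** Total, with a default value, so that the quantities [v] and [p] below are functions on the
    whole space. *)
Definition L2of k (f : R -> 'cV[C]_k) : L2 R k :=
  if pselect (isL2 f) is left h then L2class (L2mk h) else 0.

Lemma L2ofE k (f : R -> 'cV[C]_k) : isL2 f -> ae01 (fun z => L2rep (L2of f) z = f z).
Proof. by move=> hf; rewrite /L2of; case: pselect => // h; exact: L2mk_rep. Qed.

Lemma L2of_rnorm k (f : R -> 'cV[C]_k) : isL2 f -> rnorm (L2of f) = l2norm f.
Proof.
by move=> hf; rewrite L2_rnorm; apply: l2norm_ae_eq (L2ofE hf) => //; exact: L2rep_isL2.
Qed.

Lemma L2of_sub k (f g h : R -> 'cV[C]_k) : isL2 f -> isL2 g -> isL2 h ->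
  ae01 (fun z => h z = f z - g z) -> L2of h = L2of f - L2of g.
Proof.
move=> hf hg hh E; apply: L2_ext.
have h1 := ae01_and (L2ofE hh) (ae01_and E (ae01_and (L2repB (L2of f) (L2of g))
  (ae01_and (L2ofE hf) (L2ofE hg)))).
by apply: (ae01S _ h1) => z _ [-> [-> [-> [-> ->]]]].
Qed.

Lemma L2of_scale k (c : R) (f h : R -> 'cV[C]_k) : isL2 f -> isL2 h ->
  ae01 (fun z => h z = c%:C *: f z) -> L2of h = c%:C *: L2of f.
Proof.
move=> hf hh E; apply: L2_ext.
have h1 := ae01_and (L2ofE hh) (ae01_and E (ae01_and (L2repZ c%:C (L2of f)) (L2ofE hf))).
by apply: (ae01S _ h1) => z _ [-> [-> [-> ->]]].
Qed.

Lemma isL2_mul p k (A : 'M[C]_(p, k)) f : isL2 f -> isL2 (fun z => A *m f z).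
Proof.
by move=> hf; have [c _ h] := isL2_mulmx (@Linfty_cst R _ _ A); have [] := h _ hf.
Qed.

Lemma l2norm_mul p k (A : 'M[C]_(p, k)) : exists2 c : R, 0 < c &
  forall f : R -> 'cV[C]_k, isL2 f -> l2norm (fun z => A *m f z) <= c * l2norm f.
Proof.
by have [c c0 h] := isL2_mulmx (@Linfty_cst R _ _ A); exists c => // f hf; have [] := h _ hf.
Qed.

Lemma ae_le_Rintegral01 (f g : R -> R) : int01 f -> int01 g -> ae01 (fun z => f z <= g z) ->
  \int[mu]_(z in I01) f z <= \int[mu]_(z in I01) g z.
Proof.
move=> hf hg h; rewrite -subr_ge0 -RintegralB //.
rewrite (@ae_int01 _ _ (fun z => `|g z - f z|)); first by apply: Rintegral_ge0 => z _.
- exact: int01B.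
- by apply: int01_norm; exact: int01B.
by apply: (ae01S _ h) => z _ hz; rewrite ger0_norm // subr_ge0.
Qed.

Lemma isL2_ae k (f g : R -> 'cV[C]_k) : entrywise (measurable_fun I01) f -> isL2 g ->
  ae01 (fun z => f z = g z) -> isL2 f.
Proof.
move=> mf hg fg; apply: isL2P => //.
apply: ae_le_int01 (int01_sqnorm hg) _; first exact: measurable_sqnorm.
by apply: (ae01S _ fg) => z _ ->; rewrite ger0_norm ?sqnorm_ge0.
Qed.

Lemma ip_le_mul k (f g : R -> 'cV[C]_k) (s t : R) : isL2 f -> isL2 g ->
  l2norm f <= s -> l2norm g <= t -> `|ip f g| <= s * t.
Proof.
by move=> hf hg fs gt; apply: (le_trans (ip_le hf hg)); apply: ler_pM => //; exact: l2norm_ge0.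
Qed.

Lemma l2normD_le k (f g : R -> 'cV[C]_k) : isL2 f -> isL2 g ->
  l2norm (fun z => f z + g z) <= l2norm f + l2norm g.
Proof. exact: l2normD. Qed.

End L2_classes_of_functions.

(** * The domain of the port-Hamiltonian operator *)

Section port_hamiltonian.
Context (R : realType) (n r : nat).
Local Notation mu := (@lebesgue_measure R).
Local Notation I01 := (`]0%R, 1%R[%classic : set R).
Local Notation C := R[i].
Variables (H : R -> 'M[C]_n) (m : R) (P0 P1 : 'M[C]_n) (G0 G1 : 'M[C]_(n, r)).
Variables (S : R -> 'M[C]_r) (nu : R) (WBt : 'M[C]_(n + r, (n + r) + (n + r))).
Hypotheses (H_Linfty : Linfty H) (H_herm : ae01 (fun z => (H z)^t* = H z)).
Hypotheses (m_gt0 : 0 < m) (H_ge : ae01 (fun z => psdmx (H z - (m%:C)%:M))).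
Hypotheses (P1_herm : P1^t* = P1) (P0_skew : P0^t* = - P0).
Hypotheses (S_Linfty : Linfty S) (nu_gt0 : 0 < nu).
Hypothesis S_ge : ae01 (fun z => psdmx (2^-1 *: (S z + (S z)^t*) - (nu%:C)%:M)).
Hypotheses (WBt_full_rank : \rank WBt = (n + r)%N) (P1ext_unit : P1ext P1 G1 \in unitmx).
Hypothesis WB_psd :
  psdmx (WB P1 G1 WBt *m block_mx 0 1%:M 1%:M 0 *m (WB P1 G1 WBt)^t*).
Hypothesis G1_rank : \rank G1 = n.

Local Notation D := (opL H P0 P1 G0 G1 S WBt).
Local Notation DA := (opAext H P0 P1 G0 G1 WBt).

(** With [w = H x] for the effort variable, [vf] is [G1^* w' - G0^* w], the quantity that is
    dissipated, and [q] is [S vf], the additional boundary port variable. *)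
Let w (x : L2 R n) : R -> 'cV[C]_n := Hmul H (L2rep x).
Let q (x : L2 R n) : R -> 'cV[C]_r := flux H G0 G1 S (L2rep x).
Let vf (x : L2 R n) : R -> 'cV[C]_r := fun z => G1^t* *m wderiv (w x) z - G0^t* *m w x z.

Lemma isL2_w x : isL2 (w x).
Proof. by have [c _ h] := isL2_mulmx H_Linfty; have [] := h _ (L2rep_isL2 x). Qed.

Lemma isL2_vf x : H1 (w x) -> isL2 (vf x).
Proof.
move=> /H1_wderiv[hw _]; apply: isL2B; apply: isL2_mul => //; exact: isL2_w.
Qed.

Let v x := L2of (vf x).
Let p x := L2of (q x).

Lemma wB x y : ae01 (fun z => w (x - y) z = w x z - w y z).
Proof. by apply: (ae01S _ (L2repB x y)) => z _; rewrite /w /Hmul => ->; rewrite mulmxBr. Qed.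

Lemma wZ (c : R) x : ae01 (fun z => w (c%:C *: x) z = c%:C *: w x z).
Proof. by apply: (ae01S _ (L2repZ c%:C x)) => z _; rewrite /w /Hmul => ->; rewrite -scalemxAr. Qed.

Lemma H1_wB x y : H1 (w x) -> H1 (w y) -> H1 (w (x - y)) /\
  ae01 (fun z => wderiv (w (x - y)) z = wderiv (w x) z - wderiv (w y) z).
Proof.
move=> hx hy; have [h1 h2] := H1B hx hy.
have E : ae01 (fun z => w x z - w y z = w (x - y) z) by apply: (ae01S _ (wB x y)) => z _ ->.
have [h3 h4] := H1_ae h1 (isL2_w (x - y)) E; split; first exact: h3.
by apply: (ae01S2 _ h2 h4) => z _ <- ->.
Qed.

Lemma H1_wZ (c : R) x : H1 (w x) -> H1 (w (c%:C *: x)) /\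
  ae01 (fun z => wderiv (w (c%:C *: x)) z = c%:C *: wderiv (w x) z).
Proof.
move=> hx; have [h1 h2] := H1Z c hx.
have E : ae01 (fun z => c%:C *: w x z = w (c%:C *: x) z) by apply: (ae01S _ (wZ c x)) => z _ ->.
have [h3 h4] := H1_ae h1 (isL2_w (c%:C *: x)) E; split; first exact: h3.
by apply: (ae01S2 _ h2 h4) => z _ <- ->.
Qed.

Lemma vfB x y : H1 (w x) -> H1 (w y) -> ae01 (fun z => vf (x - y) z = vf x z - vf y z).
Proof.
move=> hx hy; have [_ h] := H1_wB hx hy.
by apply: (ae01S2 _ h (wB x y)) => z _; rewrite /vf => -> ->; rewrite !mulmxBr subrACA.
Qed.

Lemma vfZ (c : R) x : H1 (w x) -> ae01 (fun z => vf (c%:C *: x) z = c%:C *: vf x z).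
Proof.
move=> hx; have [_ h] := H1_wZ c hx.
by apply: (ae01S2 _ h (wZ c x)) => z _; rewrite /vf => -> ->; rewrite -!scalemxAr scalerBr.
Qed.

Lemma isL2_q x : H1 (w x) -> isL2 (q x).
Proof. by move=> hx; have [c _ h] := isL2_mulmx S_Linfty; have [] := h _ (isL2_vf hx). Qed.

Lemma v_sub x y : H1 (w x) -> H1 (w y) -> v (x - y) = v x - v y.
Proof.
move=> hx hy; have [hxy _] := H1_wB hx hy.
by apply: L2of_sub (vfB hx hy); exact: isL2_vf.
Qed.

Lemma p_sub x y : H1 (w x) -> H1 (w y) -> p (x - y) = p x - p y.
Proof.
move=> hx hy; have [hxy _] := H1_wB hx hy; apply: L2of_sub; try exact: isL2_q.
apply: (ae01S _ (vfB hx hy)) => z _ E.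
by rewrite -[LHS]/(S z *m vf (x - y) z) E mulmxBr.
Qed.

Lemma p_scale (c : R) x : H1 (w x) -> p (c%:C *: x) = c%:C *: p x.
Proof.
move=> hx; have [hcx _] := H1_wZ c hx; apply: L2of_scale; try exact: isL2_q.
apply: (ae01S _ (vfZ c hx)) => z _ E.
by rewrite -[LHS]/(S z *m vf (c%:C *: x) z) E -scalemxAr.
Qed.

Lemma p_bound : exists2 c : R, 0 < c & forall x, H1 (w x) -> rnorm (p x) <= c * rnorm (v x).
Proof.
have [c c0 h] := isL2_mulmx S_Linfty; exists c => // x hx.
rewrite L2of_rnorm; last exact: isL2_q.
rewrite L2of_rnorm; last exact: isL2_vf.
by have [] := h _ (isL2_vf hx).
Qed.

(** * The energy form *)

Let a x y := ip (L2rep x) (w y).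

Lemma energyD x y z : a (x + y) z = a x z + a y z.
Proof.
rewrite /a -ipDl; try exact: L2rep_isL2; last exact: isL2_w.
apply: ip_ae (L2repD x y) _; try exact: L2rep_isL2; try exact: isL2_w.
  by apply: isL2D; exact: L2rep_isL2.
exact: ae01T.
Qed.

Lemma energyZ (c : R) x z : a (c%:C *: x) z = c * a x z.
Proof.
rewrite /a -ipZl; try exact: L2rep_isL2; last exact: isL2_w.
apply: ip_ae (L2repZ c%:C x) _; try exact: L2rep_isL2; try exact: isL2_w.
  by apply: isL2Z; exact: L2rep_isL2.
exact: ae01T.
Qed.

(** The matrices [H z] are Hermitian. *)
Lemma energyC x y : a x y = a y x.
Proof.
rewrite [RHS]ipC; apply: ae_int01.
- by apply: int01_rdot; [exact: L2rep_isL2 | exact: isL2_w].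
- by apply: int01_rdot; [exact: isL2_w | exact: L2rep_isL2].
by apply: (ae01S _ H_herm) => z _ hz; rewrite /w /Hmul rdot_mxr hz.
Qed.

Lemma energy_le : exists2 c : R, 0 <= c & forall x y, `|a x y| <= c * rnorm x * rnorm y.
Proof.
have [c c0 h] := isL2_mulmx H_Linfty; exists c => [|x y]; first exact: ltW.
apply: (le_trans (ip_le (L2rep_isL2 x) (isL2_w y))); rewrite -mulrA mulrCA.
by rewrite ler_wpM2l ?l2norm_ge0 //; have [] := h _ (L2rep_isL2 y).
Qed.

Lemma energy_ge x : m * rnorm x ^+ 2 <= a x x.
Proof.
rewrite L2_rnorm -ip_norm -ipZl; try exact: L2rep_isL2.
apply: ae_le_Rintegral01.
- by apply: int01_rdot; [apply: isL2Z; exact: L2rep_isL2 | exact: L2rep_isL2].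
- by apply: int01_rdot; [exact: L2rep_isL2 | exact: isL2_w].
apply: (ae01S _ H_ge) => z _ /(psdmx_rdot (L2rep x z)).
by rewrite mulmxBl mul_scalar_mx rdotBl subr_ge0 [rdot _ (w x z)]rdotC.
Qed.

(** * Dissipation of energy *)

Lemma P1ext_rdot (u : 'cV[C]_n) (s : 'cV[C]_r) :
  rdot (P1ext P1 G1 *m col_mx u s) (col_mx u s) = rdot (P1 *m u) u + 2 * rdot (G1 *m s) u.
Proof.
rewrite /P1ext mul_block_col mul0mx addr0 rdot_col rdotDl (rdot_mxl (G1^t*)) trmxCK.
by rewrite (rdotC u); ring.
Qed.

Lemma P1ext_herm : (P1ext P1 G1)^t* = P1ext P1 G1.
Proof. by rewrite /P1ext tr_block_mx map_block_mx P1_herm trmxCK trmx0 map_mx0. Qed.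

Lemma flux_coercive x : H1 (w x) -> nu * l2norm (vf x) ^+ 2 <= ip (q x) (vf x).
Proof.
move=> hx; have hv := isL2_vf hx; have hq := isL2_q hx.
rewrite -ip_norm -ipZl //; apply: ae_le_Rintegral01; [|exact: int01_rdot|].
  by apply: int01_rdot => //; exact: isL2Z.
have half : (2^-1 : C) = (2^-1 : R)%:C by rewrite fmorphV rmorph_nat.
apply: (ae01S _ S_ge) => z _ /(psdmx_rdot (vf x z)).
rewrite -[q x z]/(S z *m vf x z) half; move: (vf x z) => b.
rewrite mulmxBl mul_scalar_mx rdotBl -scalemxAl !rdotZl mulmxDl rdotDl.
by rewrite (rdot_mxl ((S z)^t*)) trmxCK [rdot b (S z *m b)]rdotC; lra.
Qed.

Lemma skew_rdot (u : 'cV[C]_n) : rdot (P0 *m u) u = 0.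
Proof.
have : rdot (P0 *m u) u = - rdot (P0 *m u) u.
  by rewrite {1}rdot_mxl P0_skew mulNmx rdotNr rdotC.
lra.
Qed.

(** Integration by parts. The Hermitian part [P1] and the coupling [G1] combine into the
    boundary form of [P1ext], which has the right sign by [boundary_le]; the skew part [P0] drops
    out, and the terms in [q] that are left pair it with [vf]. *)
Lemma dissipation x y : D x y -> a y x <= - nu * rnorm (v x) ^+ 2.
Proof.
move=> [hw hq bc E]; have hv := isL2_vf hw; have iq := isL2_q hw; have iw := isL2_w x.
have [W [vW Ww tW]] := H1_rep hw; have [Q [vQ Qq tQ]] := H1_rep hq.
set dw := wderiv (w x) in vW; set dq := wderiv (q x) in vQ.
have a1 := acD (acZ 2^-1 (vac_rdot (vac_mulmx P1 vW) vW)) (vac_rdot (vac_mulmx G1 vQ) vW).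
have [i1 e1] := a1.
have hb : a y x = \int[mu]_(z in I01) ((2^-1 * (rdot (P1 *m dw z) (W z) + rdot (P1 *m W z) (dw z)) +
    (rdot (G1 *m dq z) (W z) + rdot (G1 *m Q z) (dw z))) - rdot (q x z) (vf x z)).
  apply: ae_int01.
  - by apply: int01_rdot => //; exact: L2rep_isL2.
  - by apply: int01B => //; exact: int01_rdot.
  apply: (ae01S _ (ae01_and E (ae01_and Ww Qq))) => z _ [-> [-> ->]].
  rewrite -/(w x) -/(q x) -/dw -/dq /vf -/dw !rdotDl skew_rdot rdotBr.
  rewrite (rdot_mxl G0) (rdot_mxl G1 (q x z)) (rdot_mxl P1 (w x z)) P1_herm.
  rewrite (rdotC (w x z)); lra.
rewrite hb RintegralB //; last exact: int01_rdot.
have hF := e1 1; rewrite ler01 lexx in hF; have {}hF := hF isT.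
rewrite /prim in hF; rewrite -/(ip (q x) (vf x)).
have fc := flux_coercive hw.
have bnd := @boundary_le _ _ (P1ext P1 G1) WBt (col_mx (W 1) (Q 1)) (col_mx (W 0) (Q 0))
  P1ext_herm P1ext_unit WBt_full_rank WB_psd.
rewrite !P1ext_rdot -!tW -?tQ ?lexx ?ler01 // in bnd.
have {}bnd := bnd bc.
rewrite !tW ?tQ ?lexx ?ler01 // in bnd.
rewrite L2of_rnorm // mulNr.
move: hF fc bnd; set I := \int[_]_(_ in _) _; move=> hF fc bnd.
have : I <= 0 by lra.
lra.
Qed.

(** * The extended operator *)

(** Introducing [q] as a second unknown turns the second order operator into the first
    order one, at the price of a second component [v x] of the value. *)
Lemma extension x y : D x y -> DA (x, p x) (y, v x).
Proof.
move=> [hw hq bc E]; have hv := isL2_vf hw; have iq := isL2_q hw.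
have Ep := L2ofE iq; have Ev := L2ofE hv.
have E' : ae01 (fun z => q x z = L2rep (p x) z) by apply: (ae01S _ Ep) => z _ ->.
have [hp dp] := H1_ae hq (L2rep_isL2 (p x)) E'.
have [h1 h2] := H1_col hw hp; split=> //=.
  by rewrite /boundary_condition -(trace_ae E').
apply: (ae01S _ (ae01_and E (ae01_and dp (ae01_and Ep (ae01_and Ev h2))))).
move=> z _ /= [-> [e1 [e2 [e3 e4]]]].
rewrite -/(w x) e4 e3 e2 e1 /P1ext /P0ext !mul_block_col !mul0mx !addr0 mulNmx add_col_mx.
by rewrite addrACA.
Qed.

(** * A priori bounds on the domain *)

Let N x := rnorm x + rnorm (v x).

(** Since [G1^*] has a left inverse, [vf] and [w] determine [w'] algebraically. *)
Lemma domain_bounds : exists2 c : R, 0 < c & forall x, H1 (w x) ->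
  [/\ l2norm (w x) <= c * N x, l2norm (wderiv (w x)) <= c * N x & l2norm (q x) <= c * N x].
Proof.
have [cH cH0 hH] := isL2_mulmx H_Linfty; have [cS cS0 hS] := isL2_mulmx S_Linfty.
have [B GB] := left_inverse_adj G1_rank.
have [cB cB0 hB] := l2norm_mul B; have [cG cG0 hG] := l2norm_mul (G0^t*).
exists (cH + cS + cB * (1 + cG * cH)) => [|x hx].
  by rewrite !addr_gt0 // mulr_gt0 // addr_gt0 // mulr_gt0.
have [hdw _] := H1_wderiv hx; have hv := isL2_vf hx; have iw := isL2_w x.
have n1 : 0 <= rnorm x by exact: rnorm_ge0.
have n2 : 0 <= rnorm (v x) by exact: rnorm_ge0.
have E : wderiv (w x) = (fun z => B *m (vf x z + G0^t* *m w x z)).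
  by apply/funext => z; rewrite /vf subrK mulmxA GB mul1mx.
have b1 : l2norm (w x) <= cH * rnorm x by have [] := hH _ (L2rep_isL2 x).
have b2 : l2norm (q x) <= cS * rnorm (v x).
  by rewrite L2of_rnorm //; have [] := hS _ hv.
have b3 : l2norm (wderiv (w x)) <= cB * (rnorm (v x) + cG * (cH * rnorm x)).
  have hs : isL2 (fun z => vf x z + G0^t* *m w x z) by apply: isL2D => //; exact: isL2_mul.
  rewrite E; apply: (le_trans (hB _ hs)); rewrite ler_pM2l //.
  apply: (le_trans (l2normD_le hv (isL2_mul _ iw))); rewrite L2of_rnorm // lerD2l.
  by apply: (le_trans (hG _ iw)); rewrite ler_pM2l.
have p1 := mulr_ge0 (ltW cH0) n1; have p2 := mulr_ge0 (ltW cH0) n2.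
have p3 := mulr_ge0 (ltW cS0) n1; have p4 := mulr_ge0 (ltW cS0) n2.
have p5 := mulr_ge0 (ltW cB0) n1; have p6 := mulr_ge0 (ltW cB0) n2.
have p7 := mulr_ge0 (ltW (mulr_gt0 cB0 (mulr_gt0 cG0 cH0))) n1.
have p8 := mulr_ge0 (ltW (mulr_gt0 cB0 (mulr_gt0 cG0 cH0))) n2.
by split; [apply: (le_trans b1) | apply: (le_trans b3) | apply: (le_trans b2)]; rewrite /N; lra.
Qed.

(** * Testing against a cut-off *)

(** Integration by parts without boundary terms. *)
Lemma ip_ibp k (F f g dg : R -> 'cV[C]_k) (G dG : R -> 'cV[C]_k) :
  isL2 F -> isL2 f -> isL2 g -> isL2 dg -> vac G dG -> G 0 = 0 -> G 1 = 0 ->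
  ae01 (fun z => G z = g z) -> ae01 (fun z => dG z = dg z) -> vac F f ->
  ip f g = - ip F dg.
Proof.
move=> hF hf hg hdg vG G0' G1' Gg dGg vF.
have [i1 e1] := vac_rdot vF vG.
have := e1 1; rewrite ler01 lexx => /(_ isT).
rewrite G0' G1' ![rdot _ 0]rdotC !rdot0l add0r /prim => h.
apply/eqP; rewrite -subr_eq0 opprK -RintegralD //; [|exact: int01_rdot|exact: int01_rdot].
rewrite [X in _ == X]h; apply/eqP/ae_int01 => //.
  by apply: int01D; exact: int01_rdot.
by apply: (ae01S2 _ Gg dGg) => z _ -> ->.
Qed.

Lemma cutoff_arith (L f1 f2 f3 f4 f5 b1 b2 b3 b4 k1 k2 c s t : R) :
  L = f1 + f2 + (f3 + f4) -> f4 = - f5 ->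
  `|f1| <= b1 * (c * s) * (k1 * (c * t)) -> `|f2| <= b2 * (c * s) * (k1 * (c * t)) ->
  `|f3| <= b3 * (c * s) * (k1 * (c * t)) -> `|f5| <= b4 * (c * s) * ((k2 + k1) * (c * t)) ->
  `|L| <= c * c * (b1 * k1 + b2 * k1 + b3 * k1 + b4 * (k2 + k1)) * s * t.
Proof.
move=> -> -> h1 h2 h3 h4; apply: (le_trans (ler_normD _ _)).
apply: (le_trans (lerD (ler_normD _ _) (ler_normD _ _))); rewrite normrN.
apply: (le_trans (lerD (lerD h1 h2) (lerD h3 h4))).
by rewrite le_eqVlt; apply/orP; left; apply/eqP; ring.
Qed.

Lemma sup_arith (s t u : R) : s <= u -> t <= u -> 3 * s + 2 * t <= 5 * u.
Proof. lra. Qed.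

Lemma five_ninths_le1 : 5 / 9 <= 1 :> R.
Proof. lra. Qed.

(** The functional is [y |-> <y, chi w_d>] with a cut-off [chi]. The value [L x] contains
    derivatives of the port variable [q], on which there is no bound; they are moved to
    [chi w_d], without boundary terms because [chi] vanishes at the ends. What is left out,
    [(1 - chi) w_d], is small because [w_d] is bounded pointwise by [vac_sup]. *)
Lemma cutoff_functional (eta : R) : 0 < eta -> exists2 K : R, 0 < K & forall d e, D d e ->
  exists (l : L2 R n -> R) (k : R),
  [/\ forall x y, l (x - y) = l x - l y,
      forall (c : R) x, l (c%:C *: x) = c * l x,
      forall x, `|l x| <= k * rnorm x,
      forall x y, D x y -> `|l y| <= K * N x * N d &
      a d d <= l d + eta * rnorm d * N d].
Proof.
move=> eta0; have [c c0 hc] := domain_bounds.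
have [chi [dchi [c1 [achi [chi0 chi1] chi01 [c10 hdchi] [ichi lechi]]]]] :=
  cutoff (divr_gt0 eta0 (mulr_gt0 (ltr0n R 3) c0)).
have mchi : measurable_fun I01 chi by apply: cont01_meas; exact: ac_continuous achi.
have mdchi : measurable_fun I01 dchi by have [/int01_meas] := achi.
have bchi z : 0 <= z <= 1 -> `|chi z| <= 1.
  by move=> /chi01 /andP[h1 h2]; rewrite ger0_norm.
have [k1 k10 hk1] := isL2_scale n mchi ler01 bchi.
have [k2 k20 hk2] := isL2_scale n mdchi c10 hdchi.
have [b1 b10 hb1] := l2norm_mul P1; have [b2 b20 hb2] := l2norm_mul P0.
have [b3 b30 hb3] := l2norm_mul G0; have [b4 b40 hb4] := l2norm_mul G1.
exists (c * c * (b1 * k1 + b2 * k1 + b3 * k1 + b4 * (k2 + k1))).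
  by rewrite !mulr_gt0 // !addr_gt0 ?mulr_gt0 // addr_gt0.
move=> d e [hwd _ _ _]; have iwd := isL2_w d; have [nw ndw _] := hc d hwd.
have [hdwd _] := H1_wderiv hwd.
have [ig lg] := hk1 _ iwd; have [idg ldg] := hk1 _ hdwd; have [icg lcg] := hk2 _ iwd.
set g := (fun z => (chi z)%:C *: w d z) in ig lg.
set g1 := (fun z => (chi z)%:C *: wderiv (w d) z) in idg ldg.
set g2 := (fun z => (dchi z)%:C *: w d z) in icg lcg.
have [W [vW Ww _]] := H1_rep hwd.
have N0 x : 0 <= N x by apply: addr_ge0; exact: rnorm_ge0.
exists (fun y => ip (L2rep y) g), (l2norm g); split.
- move=> x y; rewrite -(ipBl (L2rep_isL2 x) (L2rep_isL2 y) ig).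
  refine (ip_ae (L2rep_isL2 _) _ ig ig (L2repB x y) (ae01T _)); last by [].
  by apply: isL2B; exact: L2rep_isL2.
- move=> s x; rewrite -(ipZl s (L2rep_isL2 x) ig).
  refine (ip_ae (L2rep_isL2 _) _ ig ig (L2repZ s%:C x) (ae01T _)); last by [].
  by apply: isL2Z; exact: L2rep_isL2.
- by move=> x; rewrite mulrC; exact: (ip_le (L2rep_isL2 x) ig).
- move=> x y [hwx hqx _ E]; have iwx := isL2_w x; have iqx := isL2_q hwx.
  have [nwx ndwx nqx] := hc x hwx.
  have [hdw _] := H1_wderiv hwx; have [hdq _] := H1_wderiv hqx.
  have i1 := isL2_mul P1 hdw; have i2 := isL2_mul P0 iwx.
  have i3 := isL2_mul G0 iqx; have i4 := isL2_mul G1 hdq; have i5 := isL2_mul G1 iqx.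
  have [Q [vQ Qq _]] := H1_rep hqx.
  have lg' : l2norm g <= k1 * (c * N d) by exact: le_trans lg (ler_wpM2l (ltW k10) nw).
  have ibp : ip (fun z => G1 *m wderiv (q x) z) g = - ip (fun z => G1 *m q x z) (fun z => g2 z + g1 z).
    have iQ : isL2 (fun z => G1 *m Q z).
      by apply: isL2_mul; exact: isL2_ae (vac_meas vQ) iqx Qq.
    have ig12 := isL2D icg idg.
    have e1 : ip (fun z => G1 *m wderiv (q x) z) g = - ip (fun z => G1 *m Q z) (fun z => g2 z + g1 z).
      apply: (ip_ibp iQ i4 ig ig12 (vacZ achi vW) _ _ _ _ (vac_mulmx G1 vQ)).
      - by rewrite chi0 scale0r.
      - by rewrite chi1 scale0r.
      - by apply: (ae01S _ Ww) => z _ ->.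
      - by apply: (ae01S _ Ww) => z _ ->.
    apply: (etrans e1); congr (- _); refine (ip_ae iQ i5 ig12 ig12 _ (ae01T _)); last by [].
    by apply: (ae01S _ Qq) => z _ ->.
  have split4 : ip (L2rep y) g = ip (fun z => P1 *m wderiv (w x) z) g + ip (fun z => P0 *m w x z) g +
      (ip (fun z => G0 *m q x z) g + ip (fun z => G1 *m wderiv (q x) z) g).
    refine (etrans (ip_ae (L2rep_isL2 y) (isL2D (isL2D i1 i2) (isL2D i3 i4)) ig ig _ (ae01T _))
      (etrans (ipDl (isL2D i1 i2) (isL2D i3 i4) ig) (congr2 +%R (ipDl i1 i2 ig) (ipDl i3 i4 ig)))).
      by apply: (ae01S _ E) => z _ ->; congr (_ + _); rewrite addrC.
    by [].
  have t1 := ip_le_mul i1 ig (le_trans (hb1 _ hdw) (ler_wpM2l (ltW b10) ndwx)) lg'.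
  have t2 := ip_le_mul i2 ig (le_trans (hb2 _ iwx) (ler_wpM2l (ltW b20) nwx)) lg'.
  have t3 := ip_le_mul i3 ig (le_trans (hb3 _ iqx) (ler_wpM2l (ltW b30) nqx)) lg'.
  have lgg : l2norm (fun z => g2 z + g1 z) <= (k2 + k1) * (c * N d).
    apply: (le_trans (l2normD_le icg idg)); rewrite mulrDl; apply: lerD.
      exact: le_trans lcg (ler_wpM2l (ltW k20) nw).
    exact: le_trans ldg (ler_wpM2l (ltW k10) ndw).
  have t4 := ip_le_mul i5 (isL2D icg idg) (le_trans (hb4 _ iqx) (ler_wpM2l (ltW b40) nqx)) lgg.
  exact: (cutoff_arith split4 ibp t1 t2 t3 t4).
- have i1 : isL2 (fun z => w d z - g z) by exact: isL2B.
  have iW := isL2_ae (vac_meas vW) iwd Ww.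
  have Wbound z : I01 z -> sqnorm (W z) <= 5 * (c * N d) ^+ 2.
    rewrite /= in_itv /= => /andP[z0 z1].
    have z01 : 0 <= z <= 1 by rewrite !ltW.
    have n1 : l2norm W ^+ 2 <= (c * N d) ^+ 2.
      rewrite (l2norm_ae_eq iW iwd Ww) ler_pXn2r ?nnegrE ?l2norm_ge0 //.
      by rewrite mulr_ge0 // ltW.
    have n2 : l2norm (wderiv (w d)) ^+ 2 <= (c * N d) ^+ 2.
      by rewrite ler_pXn2r ?nnegrE ?l2norm_ge0 // mulr_ge0 // ltW.
    exact: le_trans (vac_sup vW iW hdwd z01) (sup_arith n1 n2).
  have h : l2norm (fun z => w d z - g z) <= eta * N d.
    rewrite -(@ler_pXn2r _ 2) ?nnegrE ?l2norm_ge0 //; last by rewrite mulr_ge0 // ltW.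
    rewrite sqr_l2norm; apply: (@le_trans _ _ (\int[mu]_(z in I01) (5 * (c * N d) ^+ 2 * (1 - chi z) ^+ 2))).
      apply: ae_le_Rintegral01; [exact: int01_sqnorm | exact: int01Z |].
      apply: (ae01S _ Ww) => z z01 Wz.
      have -> : w d z - g z = (1 - chi z)%:C *: w d z by rewrite /g rmorphB scalerBl scale1r.
      rewrite sqnormZ /= expr0n /= addr0 mulrC; apply: ler_wpM2r; first exact: sqr_ge0.
      by have := Wbound z z01; rewrite Wz.
    rewrite RintegralZl //; apply: (@le_trans _ _ (5 * (c * N d) ^+ 2 * (eta / (3 * c)) ^+ 2)).
      by rewrite ler_wpM2l // mulr_ge0 // sqr_ge0.
    have -> : 5 * (c * N d) ^+ 2 * (eta / (3 * c)) ^+ 2 = 5 / 9 * (eta * N d) ^+ 2.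
      by field; rewrite gt_eqF.
    by apply: ler_piMl; [exact: sqr_ge0 | exact: five_ninths_le1].
  have -> : a d d = ip (L2rep d) g + ip (L2rep d) (fun z => w d z - g z).
    rewrite (ipC _ g) (ipC _ (fun z => w d z - g z)) -(ipDl ig i1 (L2rep_isL2 d)).
    by rewrite /a ipC; congr ip; apply/funext => z; rewrite addrC subrK.
  rewrite lerD2l; apply: (le_trans (ler_norm _)).
  rewrite mulrAC mulrC; apply: (le_trans (ip_le (L2rep_isL2 d) i1)).
  by rewrite ler_wpM2l ?l2norm_ge0.
Qed.

(** * Stability *)

Lemma stability_transfer (TA : R -> {linear (L2 R n * L2 R r)%type -> (L2 R n * L2 R r)%type})
    (T : R -> {linear L2 R n -> L2 R n}) :
  generated_by DA TA -> generated_by D T -> exponentially_stable TA -> exponentially_stable T.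
Proof.
move=> genA genT; have [HTA _] := genA; have [HT _] := genT.
move=> /(exponentially_stableP HTA) stA; apply/(exponentially_stableP HT).
have DE x y : gen T x y -> D x y by move/(genP x y genT).
have wE x y : gen T x y -> H1 (w x) by move/DE => [].
have [Ca Ca0 hCa] := energy_le; have [Cp Cp0 hCp] := p_bound.
apply: (@semigroup_stable R (L2 R n) (L2 R r) T TA (@L2_complete R n) (@L2_complete R r)
  HT HTA a p v m Ca nu Cp m_gt0 Ca0 nu_gt0 (ltW Cp0) energyD energyZ energyC hCa energy_ge).
- by move=> x y /DE; exact: dissipation.
- by move=> x y /wE; exact: hCp.
- by move=> x y x' y' /wE h /wE h'; exact: v_sub.
- by move=> x y x' y' /wE h /wE h'; exact: p_sub.
- by move=> c x y /wE; exact: p_scale.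
- by move=> x y /DE /extension /(genP _ _ genA).
- move=> eta /cutoff_functional[K K0 hK]; exists K => // d e /DE /hK [l [k [h1 h2 h3 h4 h5]]].
  by exists l, k; split=> // x y /DE; exact: h4.
- move=> eps /stA[b b0 hb]; exists b => // u; exact: hb.
Qed.

End port_hamiltonian.

Theorem theorem6p4 (R : realType) (n r : nat) (n_ge1 : (1 <= n)%N) (r_ge1 : (1 <= r)%N)
    (H : R -> 'M[R[i]]_n) (m : R)
    (H_Linfty : Linfty H)
    (H_herm : ae01 (fun z => (H z)^t* = H z))
    (m_gt0 : 0 < m)
    (H_ge : ae01 (fun z => psdmx (H z - (m%:C)%:M)))
    (P0 P1 : 'M[R[i]]_n)
    (P1_herm : P1^t* = P1)
    (P0_skew : P0^t* = - P0)
    (G0 G1 : 'M[R[i]]_(n, r))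
    (S : R -> 'M[R[i]]_r) (nu : R)
    (S_Linfty : Linfty S)
    (nu_gt0 : 0 < nu)
    (S_ge : ae01 (fun z => psdmx (2^-1 *: (S z + (S z)^t*) - (nu%:C)%:M)))
    (WBt : 'M[R[i]]_(n + r, (n + r) + (n + r)))
    (WBt_full_rank : \rank WBt = (n + r)%N)
    (P1ext_unit : P1ext P1 G1 \in unitmx)
    (WB_psd : psdmx (WB P1 G1 WBt *m block_mx 0 1%:M 1%:M 0 *m (WB P1 G1 WBt)^t*))
    (G1_rank : \rank G1 = n)
    (TAext : R -> {linear (L2 R n * L2 R r)%type -> (L2 R n * L2 R r)%type})
    (TAext_gen : generated_by (opAext H P0 P1 G0 G1 WBt) TAext)
    (TL : R -> {linear L2 R n -> L2 R n})
    (TL_gen : generated_by (opL H P0 P1 G0 G1 S WBt) TL) :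
  exponentially_stable TAext -> exponentially_stable TL.
Proof.
exact: (stability_transfer H_Linfty H_herm m_gt0 H_ge P1_herm P0_skew S_Linfty nu_gt0 S_ge
  WBt_full_rank P1ext_unit WB_psd G1_rank TAext_gen TL_gen).
Qed.
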